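(* For every $\ell>0$, $U>0$ and $c>0$ there exist a sequence of viscosities $\nu_j>0$ with $\nu_j\to 0$ as $j\to\infty$, a sequence of forces $f^{\nu_j}$ and a force $f$ with $f^{\nu_j}\to f$ in $C(\mathbb{R};L^2)$ as $j\to\infty$, and a sequence of smooth time-periodic solutions $u^{\nu_j}\in L^\infty(\mathbb{R};L^2([0,\ell]^3))$ of the Navier-Stokes equations on the torus $[0,\ell]^3$ with viscosity $\nu_j$ and force $f^{\nu_j}$, $$\partial_t u^{\nu_j}+(u^{\nu_j}\cdot\nabla)u^{\nu_j}=-\nabla p^{\nu_j}+\nu_j\Delta u^{\nu_j}+f^{\nu_j},\qquad \nabla\cdot u^{\nu_j}=0,\qquad t\in\mathbb{R},$$ such that, for every $j$, $$U=\left(\underset{T\to\infty}{\mathrm{Lim}}\ \frac{1}{T\ell^3}\int_0^T\|u^{\nu_j}(t)\|_{L^2}^2\,dt\right)^{1/2},$$ and, setting $$\epsilon=\epsilon_j:=\underset{T\to\infty}{\mathrm{Lim}}\ \frac{1}{T\ell^3}\int_0^T\nu_j\|\nabla u^{\nu_j}(t)\|_{L^2}^2\,dt,$$ one has $$\lim_{j\to\infty}\frac{\epsilon_j\,\ell}{U^3}=c .$$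
   Context: The torus $[0,\ell]^3$ carries periodic boundary conditions, and $L^2$ denotes $L^2([0,\ell]^3)$. $\mathrm{Lim}_{T\to\infty}$ denotes a generalized (Banach) limit, i.e. a positive linear functional on bounded functions of $T$ that coincides with the usual limit as $T\to\infty$ whenever the latter exists. Convergence in $C(\mathbb{R};L^2)$ means convergence uniformly in $t\in\mathbb{R}$ with respect to the $L^2$ norm. The quantity $\epsilon$ is the long-time averaged energy dissipation rate, $U$ the characteristic velocity, and the Reynolds number is $Re=U\ell/\nu_j$ (so $Re\to\infty$ as $j\to\infty$). *)

(* Defs.v *)
From HB Require Import structures.
From mathcomp Require Import all_boot all_order all_algebra.
From mathcomp Require Import all_classical all_reals all_analysis.
Set Implicit Arguments.
Unset Strict Implicit.
Unset Printing Implicit Defensive.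
Import Order.TTheory GRing.Theory Num.Theory.
Import numFieldNormedType.Exports.
Local Open Scope classical_set_scope.
Local Open Scope ring_scope.

Section Calculus.
Context {R : realType}.

(* R^3 is the iterated product R * R * R, which carries both the normed-module
   structure (for derivatives) and the product sigma-algebra (for integrals). *)
Definition basis3 (i : 'I_3) : R * R * R :=
  ((i == 0%N :> nat)%:R, (i == 1%N :> nat)%:R, (i == 2%N :> nat)%:R).

Definition partial (i : 'I_3) (g : R * R * R -> R) : R * R * R -> R :=
  'D_(basis3 i) g.

Definition laplacian (g : R * R * R -> R) (x : R * R * R) : R :=
  \sum_(k < 3) partial k (partial k g) x.

Definition component (v : R * R * R -> 'rV[R]_3) (i : 'I_3) : R * R * R -> R :=
  fun x => v x 0 i.

Definition divergence (v : R * R * R -> 'rV[R]_3) (x : R * R * R) : R :=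
  \sum_(k < 3) partial k (component v k) x.

(* C^n regularity through iterated directional derivatives; taking all
   directions rather than those of a basis avoids fixing coordinates. *)
Fixpoint Ck (V : normedModType R) (n : nat) (g : V -> R) : Prop :=
  match n with
  | 0%N => continuous g
  | m.+1 => continuous g /\
      forall v : V, (forall x, derivable g x v) /\ Ck m ('D_v g)
  end.

Definition smooth (V : normedModType R) (g : V -> R) : Prop :=
  forall n, Ck n g.

Definition smooth_pressure (p : R -> R * R * R -> R) : Prop :=
  smooth (fun z : R * (R * R * R) => p z.1 z.2).

Definition smooth_velocity (u : R -> R * R * R -> 'rV[R]_3) : Prop :=
  forall i : 'I_3, smooth (fun z : R * (R * R * R) => u z.1 z.2 0 i).

End Calculus.

Section Torus.
Context {R : realType}.
Variable l : R.
Local Notation mu := (@lebesgue_measure R).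

(* Functions on the torus are l-periodic functions on R^3; their L^2 norms are
   computed over the fundamental cube. *)
Definition torus_periodic (A : Type) (g : R * R * R -> A) : Prop :=
  forall (i : 'I_3) x, g (x + l *: basis3 i) = g x.

Definition cube : set (R * R * R) := (`[0, l] `*` `[0, l]) `*` `[0, l].

Definition torus_integral (g : R * R * R -> R) : \bar R :=
  (\int[mu \x mu \x mu]_(x in cube) (g x)%:E)%E.

(* The Euclidean norm is spelled out: `|v x| would be the sup norm of 'rV_3. *)
Definition L2norm_sq (v : R * R * R -> 'rV[R]_3) : \bar R :=
  torus_integral (fun x => \sum_(i < 3) v x 0 i ^+ 2).

Definition L2norm (v : R * R * R -> 'rV[R]_3) : \bar R := sqrte (L2norm_sq v).

Definition L2norm_grad_sq (v : R * R * R -> 'rV[R]_3) : \bar R :=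
  torus_integral (fun x =>
    \sum_(k < 3) \sum_(i < 3) partial k (component v i) x ^+ 2).

Definition in_L2 (v : R * R * R -> 'rV[R]_3) : Prop :=
  [/\ torus_periodic v,
      forall i : 'I_3, measurable_fun cube (component v i) &
      (L2norm v < +oo)%E].

Definition in_C_L2 (f : R -> R * R * R -> 'rV[R]_3) : Prop :=
  (forall t, in_L2 (f t)) /\
  (forall t0 : R, L2norm (f t - f t0) @[t --> t0] --> 0%E).

Definition cvg_C_L2 (F : nat -> R -> R * R * R -> 'rV[R]_3)
    (f : R -> R * R * R -> 'rV[R]_3) : Prop :=
  ereal_sup (range (fun t => L2norm (F j t - f t))) @[j --> \oo] --> 0%E.

Definition in_Linfty_L2 (u : R -> R * R * R -> 'rV[R]_3) : Prop :=
  (forall t, in_L2 (u t)) /\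
  ('N[mu]_+oo[(fun t => L2norm (u t))] < +oo)%E.

Definition NS_solution (nu : R) (f u : R -> R * R * R -> 'rV[R]_3)
    (p : R -> R * R * R -> R) : Prop :=
  [/\ forall t, torus_periodic (u t),
      forall t, torus_periodic (p t),
      forall (t : R) x (i : 'I_3),
        derive1 (fun s : R => u s x 0 i) t
        + \sum_(k < 3) u t x 0 k * partial k (component (u t) i) x
        = - partial i (p t) x + nu * laplacian (component (u t) i) x
          + f t x 0 i &
      forall t x, divergence (u t) x = 0].

Definition mean_energy (u : R -> R * R * R -> 'rV[R]_3) (T : R) : R :=
  fine ((T * l ^+ 3)^-1%:E *
        \int[mu]_(t in `[0%R, T]) L2norm_sq (u t))%E.

Definition mean_dissipation (nu : R) (u : R -> R * R * R -> 'rV[R]_3) (T : R)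
    : R :=
  fine ((T * l ^+ 3)^-1%:E *
        \int[mu]_(t in `[0%R, T])
           (nu%:E * L2norm_grad_sq (u t)))%E.

End Torus.

Definition time_periodic {R : realType} (A : Type) (u : R -> A) : Prop :=
  exists2 P : R, 0 < P & forall t, u (t + P) = u t.

Definition bounded_pos {R : realType} (g : R -> R) : Prop :=
  exists M : R, forall T, 0 < T -> `|g T| <= M.

(* Generalized limits act on bounded functions of T > 0; the value of Lim on
   other functions is unconstrained. *)
Record banach_limit {R : realType} (Lim : (R -> R) -> R) : Prop := BanachLimit {
  banach_limit_linear : forall (a : R) (g h : R -> R),
    bounded_pos g -> bounded_pos h ->
    Lim (fun T => a * g T + h T) = a * Lim g + Lim h;
  banach_limit_ge0 : forall g : R -> R,
    bounded_pos g -> (forall T, 0 < T -> 0 <= g T) -> 0 <= Lim g;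
  banach_limit_cvg : forall (g : R -> R) (a : R),
    bounded_pos g -> g T @[T --> +oo] --> a -> Lim g = a }.

(* Main.v *)
Require Import Defs.
From HB Require Import structures.
From mathcomp Require Import all_boot all_order all_algebra.
From mathcomp Require Import all_classical all_reals all_analysis.
From mathcomp Require Import measurable_realfun ess_sup_inf ring lra.
Import Order.TTheory GRing.Theory Num.Theory.
Import numFieldNormedType.Exports.
Local Open Scope classical_set_scope.
Local Open Scope ring_scope.
Set Implicit Arguments.
Unset Strict Implicit.
Unset Printing Implicit Defensive.

(** Dissipation that persists at vanishing viscosity, under a convergent force, is
    produced here by a passive scalar. The flows [(v1, v2, theta)] do not depend on
    the third coordinate and have zero pressure. The horizontal velocity is a sum of
    parallel shears of which at most one is active at any time, so the horizontal
    equations have no nonlinear term, and the vertical velocity [theta] is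
    transported and diffused by the shears. The force is defined as the residual of
    the equations; all the work is to keep it convergent.

    During the first half of a period an inviscid cascade leads a plane wave of fixed
    amplitude through wavenumbers that tend to infinity. In each stage a sawtooth
    shear transports the wave exactly. Since the regularized sawtooth is close to an
    angle modulo [2 pi], the sheared wave is close in L^2 to a plane wave of larger
    wavenumber, with the roles of the two directions exchanged ([saw_defect],
    [mismatch_mean_square]); the vertical force replaces the one by the other. The
    horizontal force is the acceleration of the shear, which is small because the
    shear needed to turn the phase of a wave is inversely proportional to its
    wavenumber ([horizontal_bound]). The stages become shorter, but the wavenumbers
    are chosen after the schedule, so that the forces tend to zero and the infinite
    sequence of stages has a force that is continuous in time with values in L^2.

    The flow number [j] runs only the first stages and then has to lose the energy of
    its wave, at a small viscosity and under a small force. A final shear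
    [sin (kappa v)] of huge wavenumber does this: with [nu * kappa ^+ 2] large and
    fixed before [kappa] is, it acts on the wave as an eddy damping. The wave together
    with its first two responses to the shear solves the equation up to small terms
    ([packet_residual]). The limit of the dissipation comes from the gradient of the
    first response alone ([dissipation_density]), and its integral over a period is
    the energy that the wave had, one quarter of the square of the amplitude per unit
    volume, up to an error that tends to zero ([period_dissipation]).

    The whole pattern is at rest near both ends of the period and is repeated
    periodically, so that generalized limits of time averages are averages over one
    period ([banach_limit_mean]). With amplitude [U / 4] and period [l / (64 c U)] the
    dissipation rate tends to [c * U ^+ 3 / l]. A constant vertical velocity, which
    changes neither the force nor the dissipation, brings the energy to its
    prescribed value ([exists_mean_velocity]). *)

(** * Directional derivatives and smooth functions *)

Section DirectionalCalculus.
Context {R : realType} {V : normedModType R}.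
Implicit Types (f g : V -> R) (x v : V).

(** Restricting to the line through [x] in the direction [v] reduces the chain rule to
    functions of one variable. *)
Lemma is_derive_comp f (h : R -> R) x v (df dh : R) :
  is_derive x v f df -> is_derive (f x) 1 h dh ->
  is_derive x v (h \o f) (dh * df).
Proof.
move=> [fd fE] hD.
(* difference quotients along the line and of the one-variable restriction coincide *)
have line (k : V -> R) : (fun t : R => t^-1 *: (((fun s : R => k (s *: v + x)) \o shift 0) (t *: 1)
    - k (0 *: v + x))) = (fun t : R => t^-1 *: ((k \o shift x) (t *: v) - k x)).
  by apply/funext => t /=; rewrite addr0 scale0r add0r [_%:A]mulr1.
have D1 : is_derive (0 : R) 1 (fun s : R => f (s *: v + x)) df.
  split; first exact: (iffLR (derivable1P f x v) fd).
  by rewrite -fE /derive line.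
have f0 : is_derive (f (0 *: v + x)) 1 h dh by rewrite scale0r add0r.
have [cd cE] := is_derive1_comp f0 D1.
split; first exact: (iffRL (derivable1P (h \o f) x v) cd).
by rewrite -cE /derive -(line (h \o f)).
Qed.

Lemma is_derive_add f g x v (a b : R) :
  is_derive x v f a -> is_derive x v g b ->
  is_derive x v (fun y => f y + g y) (a + b).
Proof. by move=> fa gb; exact: (is_deriveD fa gb). Qed.

Lemma is_derive_sub f g x v (a b : R) :
  is_derive x v f a -> is_derive x v g b ->
  is_derive x v (fun y => f y - g y) (a - b).
Proof. by move=> fa gb; exact: (is_deriveB fa gb). Qed.

Lemma is_derive_opp f x v (a : R) :
  is_derive x v f a -> is_derive x v (fun y => - f y) (- a).
Proof. by move=> fa; exact: (is_deriveN fa). Qed.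

Lemma is_derive_mul f g x v (a b : R) :
  is_derive x v f a -> is_derive x v g b ->
  is_derive x v (fun y => f y * g y) (a * g x + f x * b).
Proof.
move=> fa gb; apply: (is_derive_eq (is_deriveM fa gb)).
by rewrite /GRing.scale /= addrC mulrC.
Qed.

Lemma is_derive_mulc f x v (a c : R) :
  is_derive x v f a -> is_derive x v (fun y => c * f y) (c * a).
Proof. by move=> fa; exact: (is_deriveZ c fa). Qed.

Lemma is_derive_pow f x v (a : R) n :
  is_derive x v f a ->
  is_derive x v (fun y => f y ^+ n) (n%:R * f x ^+ n.-1 * a).
Proof.
move=> fa; have := is_deriveX n fa.
by rewrite (_ : f ^+ n = fun y => f y ^+ n) //; apply/funext => y; rewrite exprfctE.
Qed.

Lemma derive_comp_fun f (h h' : R -> R) v :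
  (forall x, derivable f x v) -> (forall y : R, is_derive y 1 h (h' y)) ->
  'D_v (h \o f) = (fun x => h' (f x) * 'D_v f x).
Proof.
move=> fd hd; apply/funext => x.
by have [_ ->] := is_derive_comp (derivableP (fd x)) (hd (f x)).
Qed.

End DirectionalCalculus.

Section SmoothFunctions.
Context {R : realType} {V : normedModType R}.
Implicit Types (f g : V -> R) (x v : V).

Lemma Ck_continuous n f : Ck n f -> continuous f.
Proof. by case: n => // n []. Qed.

Lemma CkW n f : Ck n.+1 f -> Ck n f.
Proof.
elim: n f => [f [] //|n IH f [cf df]]; split=> // v.
by have [fd /IH] := df v.
Qed.

Lemma smooth_continuous f : smooth f -> continuous f.
Proof. by move=> /(_ 0%N). Qed.

Lemma smooth_derivable f x v : smooth f -> derivable f x v.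
Proof. by move=> /(_ 1%N)[_ /(_ v)[]]. Qed.

Lemma smooth_derive f v : smooth f -> smooth ('D_v f).
Proof. by move=> sf n; have [_ /(_ v)[]] := sf n.+1. Qed.

Lemma smooth_cst (a : R) : smooth (fun _ : V => a).
Proof.
move=> n; elim: n a => [a|n IH a]; first exact: cst_continuous.
split; first exact: cst_continuous.
move=> v; split=> [x|]; first exact: derivable_cst.
rewrite (_ : 'D_v _ = fun=> 0); first exact: IH.
by apply/funext => x; exact: derive_cst.
Qed.

(** The difference quotients of a linear function are constant, so coordinates are
    smooth. *)
Lemma smooth_linear (f : V -> R) : continuous f ->
  (forall (t : R) x y, f (t *: x + y) = t * f x + f y) ->
  (forall x v, is_derive x v f (f v)) /\ smooth f.
Proof.
move=> cf lf.
have gr x v : \forall t \near (0 : R)^',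
    t^-1 *: ((f \o shift x) (t *: v) - f x) = f v.
  near=> t; rewrite /= lf addrK [_ *: _]mulKf //.
  by near: t; exact: nbhs_dnbhs_neq.
have fd x v : is_derive x v f (f v).
  have fc := cvg_near_cst (f v) (gr x v) _.
  by split; [exact: cvgP (fc _) | exact: cvg_lim (fc _)].
split=> // -[//|n]; split=> // v; split=> [x|]; first by have [] := fd x v.
rewrite (_ : 'D_v f = fun=> f v); first exact: smooth_cst.
by apply/funext => x; have [_ ->] := fd x v.
Unshelve. all: by end_near. Qed.

Lemma CkD n f g : Ck n f -> Ck n g -> Ck n (fun x => f x + g x).
Proof.
elim: n f g => [f g cf cg|n IH f g [cf df] [cg dg]] /=.
  by move=> x; exact: cvgD (cf x) (cg x).
split; first by move=> x; exact: cvgD (cf x) (cg x).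
move=> v; have [fd fC] := df v; have [gd gC] := dg v.
split=> [x|]; first exact: derivableD.
rewrite (_ : 'D_v _ = fun x => 'D_v f x + 'D_v g x); first exact: IH.
by apply/funext => x; exact: deriveD.
Qed.

Lemma CkM n f g : Ck n f -> Ck n g -> Ck n (fun x => f x * g x).
Proof.
elim: n f g => [f g cf cg|n IH f g Cf Cg] /=.
  by move=> x; exact: cvgM (cf x) (cg x).
have [cf df] := Cf; have [cg dg] := Cg.
split; first by move=> x; exact: cvgM (cf x) (cg x).
move=> v; have [fd fC] := df v; have [gd gC] := dg v.
split=> [x|]; first exact: derivableM.
rewrite (_ : 'D_v _ = fun x => f x * 'D_v g x + g x * 'D_v f x).
  by apply: CkD; apply: IH => //; exact: CkW.
by apply/funext => x; exact: deriveM.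
Qed.

Lemma smoothD f g : smooth f -> smooth g -> smooth (fun x => f x + g x).
Proof. by move=> sf sg n; exact: CkD. Qed.

Lemma smoothM f g : smooth f -> smooth g -> smooth (fun x => f x * g x).
Proof. by move=> sf sg n; exact: CkM. Qed.

Lemma smoothZ (a : R) f : smooth f -> smooth (fun x => a * f x).
Proof. by move=> sf; apply: smoothM => //; exact: smooth_cst. Qed.

Lemma smoothN f : smooth f -> smooth (fun x => - f x).
Proof.
move=> sf; rewrite (_ : (fun x => _) = (fun x => -1 * f x)); first exact: smoothZ.
by apply/funext => x; rewrite mulN1r.
Qed.

Lemma smoothB f g : smooth f -> smooth g -> smooth (fun x => f x - g x).
Proof. by move=> sf sg; apply: smoothD => //; exact: smoothN. Qed.

Lemma smoothX f n : smooth f -> smooth (fun x => f x ^+ n).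
Proof.
move=> sf; elim: n => [|n IH]; first exact: (smooth_cst 1).
by rewrite (_ : (fun x => _) = (fun x => f x * f x ^+ n));
  [exact: smoothM | apply/funext => x; rewrite exprS].
Qed.

Lemma smooth_sum (I : Type) (r : seq I) (P : pred I) (F : I -> V -> R) :
  (forall i, smooth (F i)) -> smooth (fun x => \sum_(i <- r | P i) F i x).
Proof.
move=> sF; elim: r => [|i r IH].
  by under eq_fun do rewrite big_nil; exact: smooth_cst.
under eq_fun do rewrite big_cons.
by case: (P i) => //; exact: smoothD.
Qed.

End SmoothFunctions.

Section SmoothComposition.
Context {R : realType} {V : normedModType R}.
Implicit Types (f g : V -> R) (x v : V).

Lemma smooth_comp (h : R -> R) f : smooth h -> smooth f -> smooth (h \o f).
Proof.
move=> sh sf n; elim: n h f sh sf => [h f sh sf|n IH h f sh sf].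
  move=> x; apply: continuous_comp; first exact: smooth_continuous.
  exact: smooth_continuous.
have hd (y : R) : is_derive y 1 h ('D_1 h y) by apply: derivableP; exact: smooth_derivable.
split.
  by move=> x; apply: continuous_comp; exact: smooth_continuous.
move=> v; split=> [x|].
  by have [] := is_derive_comp (derivableP (smooth_derivable (x:=x) (v:=v) sf)) (hd (f x)).
rewrite (derive_comp_fun _ hd) => [|x]; last exact: smooth_derivable.
apply: CkM; first by apply: (IH ('D_1 h)) => //; exact: smooth_derive.
exact: smooth_derive.
Qed.

Lemma smooth_inv f : smooth f -> (forall x, f x != 0) ->
  smooth (fun x => (f x)^-1).
Proof.
move=> sf f0; elim=> [|n IH].
  by move=> x; apply: cvgV => //; exact: smooth_continuous.
split; first by move=> x; apply: cvgV => //; exact: smooth_continuous.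
move=> v; split=> [x|].
  by apply: derivableV => //; exact: smooth_derivable.
rewrite (_ : 'D_v _ = fun x => - 1 * ((f x)^-1 * (f x)^-1 * 'D_v f x)).
  apply: CkM; first exact: smooth_cst.
  by apply: CkM; [exact: CkM | exact: smooth_derive].
apply/funext => x; rewrite deriveV //; last exact: smooth_derivable.
by rewrite -exprVn expr2 mulN1r [_ *: _]mulNr.
Qed.

(** Regularity is a local property, which is what allows gluing translates. *)
Lemma smooth_local f :
  (forall x, exists2 g, smooth g & \near x, f x = g x) -> smooth f.
Proof.
move=> loc n; elim: n f loc => [f loc|n IH f loc].
  move=> x; have [g sg fg] := loc x.
  have fx : f x = g x := nbhs_singleton fg.
  have sgx : g @ x --> g x by exact: smooth_continuous.
  rewrite /continuous_at fx; apply: cvg_trans sgx.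
  by apply: near_eq_cvg; near do apply/esym.
split; first exact: (IH f loc 0%N) || exact: Ck_continuous (IH f loc).
move=> v; split=> [x|].
  have [g sg fg] := loc x.
  have gf : {near x, g =1 f} by near do apply/esym.
  exact: near_eq_derivable gf (smooth_derivable (x:=x) (v:=v) sg).
apply: IH => x; have [g sg fg] := loc x.
exists ('D_v g); first exact: smooth_derive.
have := near_join fg; apply: filterS => y fgy.
exact: near_eq_derive.
Unshelve. all: by end_near. Qed.

End SmoothComposition.

(** * Smooth functions of one variable *)

Section SmoothOneVariable.
Context {R : realType}.
Implicit Types (h : R -> R) (x v t : R).

Lemma is_derive_scale h (a x v : R) :
  is_derive x 1 h a -> is_derive x v h (a * v).
Proof. by move=> hd; exact: (is_derive_comp (is_derive_id x v) hd). Qed.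

Lemma CkS_is_derive n h (h' : R -> R) :
  (forall x, is_derive x 1 h (h' x)) -> Ck n h' -> Ck n.+1 h.
Proof.
move=> hd h'C; split.
  move=> x; apply: differentiable_continuous; apply/derivable1_diffP.
  by have [] := hd x.
move=> v; split=> [x|]; first by have [] := is_derive_scale v (hd x).
rewrite (_ : 'D_v h = fun x => h' x * v).
  by apply: CkM => //; exact: smooth_cst.
by apply/funext => x; have [_ ->] := is_derive_scale v (hd x).
Qed.

(** For functions of a real variable all directional derivatives are multiples of one,
    so smoothness can be read off from it. *)
Lemma smooth_is_derive h (h' : R -> R) :
  (forall x, is_derive x 1 h (h' x)) -> smooth h' -> smooth h.
Proof. by move=> hd sh [|n]; [exact: CkW (CkS_is_derive hd (sh 0%N)) | exact: CkS_is_derive]. Qed.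

Lemma smooth_id : smooth (fun x : R => x).
Proof.
exact: (smooth_is_derive (fun x => is_derive_id x 1) (smooth_cst 1)).
Qed.

Lemma smooth_sin_cos : smooth (@sin R) /\ smooth (@cos R).
Proof.
suff H n : Ck n (@sin R) /\ Ck n (@cos R) by split=> n; have [] := H n.
elim: n => [|n [sn cn]].
  by split; [exact: continuous_sin | exact: continuous_cos].
split; first by apply: CkS_is_derive cn.
have dcos (x : R) : is_derive x 1 (@cos R) (- 1 * sin x).
  by apply: is_derive_eq; rewrite mulN1r.
apply: (CkS_is_derive dcos).
by apply: CkM => //; exact: smooth_cst.
Qed.

Lemma smooth_sin : smooth (@sin R). Proof. exact: smooth_sin_cos.1. Qed.
Lemma smooth_cos : smooth (@cos R). Proof. exact: smooth_sin_cos.2. Qed.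

Lemma smooth_expR : smooth (@expR R).
Proof.
elim=> [|n IH]; first exact: continuous_expR.
exact: CkS_is_derive IH.
Qed.

Lemma smooth_atan : smooth (@atan R).
Proof.
apply: (smooth_is_derive (fun x => is_derive1_atan x)).
apply: smooth_inv => [|x]; last by rewrite gt_eqF // ltr_pwDl // sqr_ge0.
by apply: smoothD; [exact: smooth_cst | apply: smoothX; exact: smooth_id].
Qed.

End SmoothOneVariable.

Section FlatFunctions.
Context {R : realType}.
Implicit Types (t : R).

(** The powers of [1/t] are carried along because they make the family stable
    under differentiation. *)
Definition flat_exp (n : nat) (t : R) : R :=
  if 0 < t then t^-1 ^+ n * expR (- t^-1) else 0.

(** Apply [1 + y / n <= exp (y / n)] and raise to the power [n]. *)
Lemma exprn_le_expR (n : nat) (y : R) : 0 <= y -> y ^+ n <= n%:R ^+ n * expR y.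
Proof.
case: n => [|n] y0; first by rewrite !expr0 mul1r -expR0 ler_expR.
have n0 : (0 : R) < n.+1%:R by rewrite ltr0n.
have -> : expR y = expR (y / n.+1%:R) ^+ n.+1.
  by rewrite -expRM_natl mulrCA mulfV ?mulr1 // gt_eqF.
rewrite -exprMn; apply: lerXn2r; rewrite ?nnegrE //.
rewrite -ler_pdivrMl // mulrC; apply: le_trans (expR_ge1Dx _).
by rewrite lerDr.
Qed.

(** One more power of [1/t] is absorbed by the exponential, which leaves a factor [t]. *)
Lemma flat_exp_le (n : nat) : exists C : R, forall t, `|flat_exp n t| <= C * `|t|.
Proof.
exists (n.+1%:R ^+ n.+1) => t; rewrite /flat_exp; case: ifPn => [t0|_]; last first.
  by rewrite normr0 mulr_ge0.
have i0 : 0 < t^-1 by rewrite invr_gt0.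
rewrite !gtr0_norm ?mulr_gt0 ?exprn_gt0 ?expR_gt0 //.
have := exprn_le_expR n.+1 (ltW i0); rewrite exprS => H.
by rewrite expRN ler_pdivrMr ?expR_gt0 // mulrAC -ler_pdivrMr // mulrC.
Qed.

Lemma cvg_flat_exp0 (n : nat) : flat_exp n t @[t --> (0 : R)] --> (0 : R).
Proof.
have [C HC] := flat_exp_le n.
have c0 : C * `|t| @[t --> (0 : R)] --> (0 : R).
  rewrite -[X in _ --> X](mulr0 C) -[X in _ --> C * X](@normr0 _ R).
  by apply: cvgMr; apply: cvg_norm; exact: cvg_id.
apply/norm_cvg0P; apply: (squeeze_cvgr _ (cvg_cst 0) c0).
by near=> t; rewrite normr_ge0 HC.
Unshelve. all: by end_near. Qed.

Lemma is_derive_flat_exp (n : nat) t :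
  is_derive t 1 (flat_exp n) (flat_exp n.+2 t - n%:R * flat_exp n.+1 t).
Proof.
have [t0|t0|->] := ltgtP t 0.
- rewrite /flat_exp ltNge ltW //= mulr0 subr0.
  apply: near_eq_is_derive (is_derive_cst (0 : R) t 1).
  near=> s; rewrite ltNge ltW //=; near: s; exact: lt_nbhsl.
- have tn0 : t != 0 by rewrite gt_eqF.
  have dV : is_derive t 1 (fun s : R => s^-1) (- t^-1 ^+ 2).
    split; first exact: derivableV.
    by rewrite deriveV // derive_id [_ *: _]mulr1 exprVn.
  have dE : is_derive t 1 (fun s : R => s^-1 ^+ n * expR (- s^-1))
      (flat_exp n.+2 t - n%:R * flat_exp n.+1 t).
    have dN : is_derive t 1 (fun s : R => - s^-1) (t^-1 ^+ 2).
      by apply: is_derive_eq; rewrite opprK.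
    have dexp := is_derive_comp dN (is_derive_expR (- t^-1)).
    apply: (is_derive_eq (is_derive_mul (is_derive_pow n dV) dexp)).
    rewrite /flat_exp t0 /=; case: n => [|n]; rewrite ?exprS /=; ring.
  apply: near_eq_is_derive dE; near=> s; rewrite /flat_exp ifT //.
  by near: s; exact: lt_nbhsr.
(* at the origin the difference quotient of [flat_exp n] is [flat_exp n.+1] *)
- have -> : flat_exp n.+2 0 - n%:R * flat_exp n.+1 0 = 0 :> R.
    by rewrite /flat_exp ltxx mulr0 subr0.
  have c : s^-1 *: ((flat_exp n \o shift 0) (s *: 1) - flat_exp n 0)
      @[s --> (0 : R)^'] --> (0 : R).
    apply: cvg_trans (cvg_within_filter _ (cvg_flat_exp0 n.+1)).
    apply: near_eq_cvg; near=> s.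
    rewrite /= addr0 [_%:A]mulr1 /flat_exp ltxx subr0.
    by case: ifP => _; rewrite ?scaler0 // [_ *: _]mulrA -exprS.
  by split; [exact: cvgP c | exact: cvg_lim c].
Unshelve. all: by end_near. Qed.

Lemma smooth_flat_exp (n : nat) : smooth (flat_exp n).
Proof.
move=> m; elim: m n => [|m IH] n.
  move=> t; apply: differentiable_continuous; apply/derivable1_diffP.
  by have [] := is_derive_flat_exp n t.
apply: CkS_is_derive (is_derive_flat_exp n) _.
apply: CkD => //; rewrite (_ : (fun x => _) = (fun t => - n%:R * flat_exp n.+1 t)).
  by apply: CkM => //; exact: smooth_cst.
by apply/funext => t; rewrite mulNr.
Qed.

End FlatFunctions.

(** * Smooth steps *)

Section SmoothStep.
Context {R : realType}.
Local Notation mu := (@lebesgue_measure R).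
Implicit Types (f : R -> R) (x y t : R).

Lemma is_derive_continuous f (f' : R -> R) :
  (forall x, is_derive x 1 f (f' x)) -> continuous f.
Proof.
move=> fd x; apply: differentiable_continuous; apply/derivable1_diffP.
by have [] := fd x.
Qed.

Lemma mean_value f (f' : R -> R) x y :
  (forall x, is_derive x 1 f (f' x)) -> x <= y ->
  exists2 z, x <= z <= y & f y - f x = f' z * (y - x).
Proof.
move=> fd xy; have [z zxy E] := MVT_segment xy (fun z _ => fd z)
  (continuous_subspaceT (is_derive_continuous fd)).
by exists z => //; move: zxy; rewrite in_itv.
Qed.

(** Below [a] the integral from [a - 1] is constant, so it is a primitive on the whole
    line and not only to the right of [a - 1]. *)
Lemma primitive_zero_left (a : R) (w : R -> R) : continuous w ->
  (forall t, t <= a -> w t = 0) -> exists P, forall t, is_derive t 1 P (w t).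
Proof.
move=> cw w0.
exists (fun t => \int[mu]_(s in [set` `[a - 1, t]]) (w s)) => t.
have [ta|ta] := ltP t a.
  rewrite w0 ?ltW //.
  apply: near_eq_is_derive (is_derive_cst (0 : R) t 1).
  near=> s; apply/esym.
  have sa : s < a by near: s; exact: lt_nbhsl.
  rewrite (_ : Rintegral _ _ _ = \int[mu]_(r in [set` `[a - 1, s]]) 0).
    by rewrite Rintegral_cst ?mul0r.
  apply: eq_Rintegral => r /[!inE]/=.
  by rewrite in_itv /= => /andP[_ rs]; rewrite w0 // (le_trans rs) ?ltW.
have iw : mu.-integrable `[a - 1, t + 1] (EFin \o w).
  apply: continuous_compact_integrable; first exact: segment_compact.
  exact: continuous_subspaceT.
have tt : t < t + 1 by rewrite ltrDl.
have at1 : a - 1 < t by rewrite ltrBlDr (le_lt_trans ta).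
have [dP Pw] := continuous_FTC1_closed tt iw at1 (cw t).
split; [exact: dP | rewrite -derive1E; exact: Pw].
Unshelve. all: by end_near. Qed.

(** The derivative is a square of a smooth function: the amplitude of the
    dissipating flow is the square root of a decay rate and must be smooth. *)
Lemma exists_smooth_step (a b : R) : a < b -> exists Hb : (R -> R) * (R -> R),
  [/\ smooth Hb.1 /\ smooth Hb.2,
      forall t, is_derive t 1 Hb.1 (Hb.2 t ^+ 2),
      forall t, 0 <= Hb.1 t <= 1,
      (forall t, t <= a -> Hb.1 t = 0) /\ (forall t, b <= t -> Hb.1 t = 1) &
      forall t, t <= a \/ b <= t -> Hb.2 t = 0].
Proof.
move=> ab.
(* the normalized primitive of the square of a bump that vanishes outside ]a, b[ *)
pose w t := flat_exp 0 (t - a) * flat_exp 0 (b - t) : R.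
have sw : smooth w.
  by apply: smoothM; apply: (smooth_comp (h := flat_exp 0)) (smooth_flat_exp 0) _;
    apply: smoothB; first [exact: smooth_id | exact: smooth_cst].
have wout t : t <= a \/ b <= t -> w t = 0.
  rewrite /w /flat_exp !subr_gt0 => -[ta|bt].
    by rewrite (ltNge a) ta mul0r.
  by rewrite (ltNge t) bt mulr0.
have win t : a < t < b -> 0 < w t.
  move=> /andP[at_ tb]; rewrite /w /flat_exp !subr_gt0 at_ tb !expr0 !mul1r.
  by rewrite mulr_gt0 ?expR_gt0.
have cw2 : continuous (fun t => w t ^+ 2).
  by apply: smooth_continuous; exact: smoothX.
have [P dP] : exists P, forall t, is_derive t 1 P (w t ^+ 2).
  apply: (@primitive_zero_left a) => // t ta.
  by rewrite wout ?expr0n //; left.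
have Pmono x y : x <= y -> P x <= P y.
  move=> xy; have [z _ E] := mean_value dP xy.
  by rewrite -subr_ge0 E mulr_ge0 ?sqr_ge0 ?subr_ge0.
have Pa t : t <= a -> P t = P a.
  move=> ta; have [z /andP[_ za] E] := mean_value dP ta.
  by apply/esym/eqP; rewrite -subr_eq0 E wout ?expr0n ?mul0r //; left.
have Pb t : b <= t -> P t = P b.
  move=> bt; have [z /andP[bz _] E] := mean_value dP bt.
  by apply/eqP; rewrite -subr_eq0 E wout ?expr0n ?mul0r //; right.
have Pab : 0 < P b - P a.
  have h3 : 0 < (b - a) / 3%:R by rewrite divr_gt0 ?subr_gt0.
  set x := a + (b - a) / 3%:R; set y := b - (b - a) / 3%:R.
  have xy : x <= y by rewrite /x /y; lra.
  have [z /andP[xz zy] E] := mean_value dP xy.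
  have ax : P a <= P x by apply: Pmono; rewrite /x; lra.
  have yb : P y <= P b by apply: Pmono; rewrite /y; lra.
  have : 0 < P y - P x.
    rewrite E mulr_gt0 //; last by rewrite /x /y; lra.
    rewrite exprn_gt0 // win //; apply/andP; split.
      by apply: lt_le_trans xz; rewrite /x; lra.
    by apply: le_lt_trans zy _; rewrite /y; lra.
  lra.
pose c := (P b - P a)^-1.
have c0 : 0 < c by rewrite invr_gt0.
pose H t := c * (P t - P a).
pose be t := Num.sqrt c * w t.
have dH t : is_derive t 1 H (be t ^+ 2).
  rewrite /be exprMn sqr_sqrtr ?ltW //; apply: is_derive_mulc.
  rewrite -[w t ^+ 2]subr0; exact: is_derive_sub (dP t) (is_derive_cst (P a) t 1).
have sbe : smooth be by exact: smoothZ.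
have H0 t : t <= a -> H t = 0 by move=> ta; rewrite /H Pa // subrr mulr0.
have H1 t : b <= t -> H t = 1 by move=> ta; rewrite /H Pb // mulVf // gt_eqF.
exists (H, be); split=> //=.
- split=> //; apply: (smooth_is_derive dH); exact: smoothX.
- move=> t; apply/andP; split.
    have [/ltW ta|at_] := ltP t a; first by rewrite H0.
    by rewrite /H mulr_ge0 ?(ltW c0) // subr_ge0 Pmono.
  have [/ltW bt|tb] := ltP b t; first by rewrite H1.
  have -> : 1 = c * (P b - P a) by rewrite mulVf // gt_eqF.
  by rewrite /H ler_pM2l // lerB // Pmono.
- by move=> t tab; rewrite /be wout // mulr0.
Qed.

End SmoothStep.

(** * The regularized sawtooth *)

Section Sawtooth.
Context {R : realType}.
Variable d : R.
Hypothesis d0 : 0 < d.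
Implicit Types y : R.

(** For [d -> 0] this is the angle [y] itself, brought back to [0, 2 pi[ : the
    arctangent is the argument of [1 + d - exp (i y)] up to sign. *)
Definition saw y : R := pi - 2 * atan (sin y / (1 + d - cos y)).

Let den y : R := 1 + d - cos y.
Let wid y : R := 2 * (1 - cos y) * (1 + d) + d ^+ 2.

(* [wid] is the square of the modulus of [1 + d - exp (i y)]. *)
Lemma saw_den_gt0 y : 0 < den y.
Proof. by rewrite /den; have := cos_le1 y; move: d0; lra. Qed.

Lemma saw_wid_gt0 y : 0 < wid y.
Proof.
have c1 : 0 <= 1 - cos y by rewrite subr_ge0 cos_le1.
have d1 : 0 <= 1 + d by rewrite addr_ge0 ?(ltW d0).
rewrite /wid ltr_wpDl ?exprn_gt0 //.
by apply: mulr_ge0 => //; apply: mulr_ge0.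
Qed.

Lemma is_derive_saw y : is_derive y 1 saw (1 - d * (d + 2) / wid y).
Proof.
have D0 := saw_den_gt0 y; have W0 := saw_wid_gt0 y.
have dden : is_derive y 1 den (sin y).
  have := is_derive_sub (is_derive_cst (1 + d) y 1) (is_derive_cos y).
  by move/is_derive_eq; apply; rewrite sub0r opprK.
have dinv : is_derive y 1 (fun z => (den z)^-1) (- sin y / den y ^+ 2).
  have [dd dE] := dden; have dn0 : den y != 0 by rewrite gt_eqF.
  split; first exact: derivableV.
  by rewrite deriveV // dE [_ *: _]mulNr mulNr mulrC.
have dq := is_derive_mul (is_derive_sin y) dinv.
have da := is_derive_comp dq (is_derive1_atan _).
have ds := is_derive_sub (is_derive_cst (pi : R) y 1) (is_derive_mulc 2 da).
apply: (is_derive_eq ds); rewrite /= -/(den y).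
have cs := cos2Dsin2 y.
have DW : den y ^+ 2 + sin y ^+ 2 = wid y by rewrite /den /wid; nra.
have -> : 1 + (sin y / den y) ^+ 2 = wid y / den y ^+ 2.
  by rewrite -DW; field; rewrite gt_eqF.
have -> : cos y / den y + sin y * (- sin y / den y ^+ 2) =
    (cos y * den y - sin y ^+ 2) / den y ^+ 2 by field; rewrite gt_eqF.
have -> : cos y * den y - sin y ^+ 2 = (d * (d + 2) - wid y) / 2.
  by rewrite /den /wid; lra.
by field; rewrite !gt_eqF.
Qed.

Lemma smooth_saw : smooth saw.
Proof.
apply: smoothB; first exact: smooth_cst.
apply: smoothZ; apply: (smooth_comp smooth_atan); apply: smoothM.
  exact: smooth_sin.
apply: smooth_inv => [|y]; last by rewrite gt_eqF // saw_den_gt0.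
by apply: smoothB; [exact: smooth_cst | exact: smooth_cos].
Qed.

Lemma saw_periodic y : saw (y + pi *+ 2) = saw y.
Proof. by rewrite /saw sinD2pi cosD2pi. Qed.

Lemma saw_bound y : `|saw y| <= 2 * pi.
Proof.
rewrite /saw; set q := sin y / _.
have := atan_gtNpi2 q; have := atan_ltpi2 q; have := pi_gt0 R.
by rewrite ler_norml; lra.
Qed.

Lemma saw_defect_wid y : 1 - cos (y - saw y) <= d * (d * (d + 2) / wid y).
Proof.
have D0 := saw_den_gt0 y; have W0 := saw_wid_gt0 y.
pose q := sin y / den y; pose a := atan q.
have DW : den y ^+ 2 + sin y ^+ 2 = wid y.
  by rewrite /den /wid; have := cos2Dsin2 y; nra.
have c2 : cos a ^+ 2 = den y ^+ 2 / wid y.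
  rewrite /a cos_atan exprVn sqr_sqrtr; last by rewrite addr_ge0 ?sqr_ge0.
  have -> : 1 + q ^+ 2 = wid y / den y ^+ 2.
    by rewrite -DW /q; field; rewrite gt_eqF.
  by rewrite invf_div.
have sa : sin a = q * cos a.
  have ca0 : cos a != 0.
    rewrite /a cos_atan invr_eq0 sqrtr_eq0 -ltNge.
    by rewrite ltr_pwDl ?sqr_ge0.
  by rewrite -[in RHS](atanK q) -/a /tan; field.
have -> : cos (y - saw y) = - (cos y * (den y ^+ 2 - sin y ^+ 2) / wid y
    - 2 * sin y ^+ 2 * den y / wid y).
  (* [saw] is [pi] minus twice the angle [a], whose tangent is [q] *)
have -> : y - saw y = (y + (a + a)) - pi by rewrite /saw -/(den y) -/q -/a; lra.
  rewrite cosB cospi sinpi mulr0 addr0 mulrN1 cosD cosD sinD sa.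
  have -> : cos y * (cos a * cos a - q * cos a * (q * cos a)) -
     sin y * (q * cos a * cos a + cos a * (q * cos a)) =
     (cos y * (1 - q ^+ 2) - 2 * sin y * q) * cos a ^+ 2 by ring.
  by rewrite c2 /q; congr (- _); field; rewrite !gt_eqF.
rewrite -(ler_pM2r W0) !mulrA divfK ?gt_eqF //.
have -> : (1 - - (cos y * (den y ^+ 2 - sin y ^+ 2) / wid y
    - 2 * sin y * sin y * den y / wid y)) * wid y
    = wid y + cos y * (den y ^+ 2 - sin y ^+ 2) - 2 * sin y ^+ 2 * den y.
  by field; rewrite gt_eqF.
have -> : wid y + cos y * (den y ^+ 2 - sin y ^+ 2) - 2 * sin y ^+ 2 * den y
    = d * d * (1 + cos y) by rewrite sin2cos2 /wid /den; ring.
apply: ler_wpM2l; first by rewrite mulr_ge0 ?(ltW d0).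
by have := cos_le1 y; move: d0; lra.
Qed.

(** The mean of [saw'] over a period vanishes because [saw] is periodic, so the
    right-hand side integrates to [d] times the length of the period: this is
    how [exp (i saw)] approximates [exp (i y)] in mean square. *)
Lemma saw_defect y : 1 - cos (y - saw y) <= d * (1 - 'D_1 saw y).
Proof.
have [_ ->] := is_derive_saw y.
by rewrite subKr saw_defect_wid.
Qed.

End Sawtooth.

(** * Measurability of continuous functions and iterated integrals *)

Section Measurability.
Context {R : realType}.

(** Freezing the second variable on a grid of mesh [1/n] gives countably many
    measurable slices, and continuity lets the mesh go to zero. *)
Lemma measurable_caratheodory d (T : measurableType d) (f : T * R -> R) :
  (forall y, measurable_fun setT (fun x => f (x, y))) ->
  (forall x, continuous (fun y => f (x, y))) -> measurable_fun setT f.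
Proof.
move=> mf cf.
pose r n (y : R) : R := (Num.floor (n.+1%:R * y))%:~R / n.+1%:R.
pose g n (z : T * R) := f (z.1, r n z.2).
apply/measurable_EFinP; apply: (emeasurable_fun_cvg (fun n z => (g n z)%:E)).
  move=> n; apply/measurable_EFinP => _ A mA; rewrite setTI.
  have -> : g n @^-1` A = \bigcup_(k : int)
      ((fun x => f (x, k%:~R / n.+1%:R)) @^-1` A `*`
       [set y | k%:~R <= n.+1%:R * y < (k + 1)%:~R]).
    apply/seteqP; split=> [[x y] /= Ay|[x y] [k _] /= [Ak kE]].
      exists (Num.floor (n.+1%:R * y)) => //=; split=> //; exact: floor_itv.
    by rewrite /g /r /= (floor_def kE).
  apply: countable_bigcupT_measurable => // k; apply: measurableX.
    by have := mf (k%:~R / n.+1%:R) measurableT _ mA; rewrite setTI.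
  rewrite (_ : [set y | _] = `[k%:~R / n.+1%:R, (k + 1)%:~R / n.+1%:R[%classic) //.
  apply/seteqP; split=> y /=; rewrite in_itv /= ler_pdivrMr // ltr_pdivlMr //;
    by rewrite mulrC.
move=> [x y] _; apply/cvg_EFin; first by near=> n.
rewrite /comp /= /g /=.
apply: (@cvg_comp _ _ _ (fun n => r n y) (fun y => f (x, y)) _ (nbhs y)) => //; last exact: cf.
have rl n : y - n.+1%:R^-1 <= r n y <= y.
  have /andP[lo hi] := floor_itv (n.+1%:R * y).
  rewrite /r ler_pdivrMr // [y * _]mulrC lo andbT.
  rewrite ler_pdivlMr // mulrBl mulVf // [y * _]mulrC lerBlDr ltW //.
  by rewrite (lt_le_trans hi) // intrD.
apply: (squeeze_cvgr (f := fun n => y - n.+1%:R^-1) (h := fun=> y)).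
- by near=> n; exact: rl.
- rewrite -[X in _ --> X]subr0; apply: cvgB; first exact: cvg_cst.
  exact: cvg_harmonic.
- exact: cvg_cst.
Unshelve. all: by end_near. Qed.

Lemma continuous_pair (W U1 U2 : topologicalType) (f : W -> U1) (g : W -> U2) :
  continuous f -> continuous g -> continuous (fun w => (f w, g w)).
Proof.
move=> cf cg w.
have cfw : f @ w --> f w by exact: cf.
have cgw : g @ w --> g w by exact: cg.
exact: (cvg_pair cfw cgw).
Qed.

Lemma continuous_compose (W U1 U2 : topologicalType) (f : W -> U1)
  (g : U1 -> U2) : continuous f -> continuous g -> continuous (g \o f).
Proof. by move=> cf cg w; apply: continuous_comp; [exact: cf | exact: cg]. Qed.

Lemma continuous_measurable3 (g : R * R * R -> R) :
  continuous g -> measurable_fun setT g.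
Proof.
have idc (W : topologicalType) : continuous (fun w : W => w) by move=> w; exact: cvg_id.
have cc (W U : topologicalType) (u : U) : continuous (fun _ : W => u).
  by move=> w; exact: cvg_cst.
move=> cg; apply: measurable_caratheodory => [z|xy].
  apply: (measurable_caratheodory (f := fun xy => g (xy, z))) => [y|x].
    apply: continuous_measurable_fun.
    apply: (continuous_compose (f := fun x => ((x, y), z))) => //.
    by apply: continuous_pair => //; exact: continuous_pair.
  apply: (continuous_compose (f := fun y => ((x, y), z))) => //.
  by apply: continuous_pair => //; exact: continuous_pair.
by apply: (continuous_compose (f := fun z => (xy, z))) => //; exact: continuous_pair.
Qed.

End Measurability.

Section RectangleFubini.
Context {R : realType}.
Context d1 d2 (T1 : measurableType d1) (T2 : measurableType d2).
Variables (m1 : {sigma_finite_measure set T1 -> \bar R})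
          (m2 : {sigma_finite_measure set T2 -> \bar R}).
Variables (S1 : set T1) (S2 : set T2).
Hypotheses (mS1 : measurable S1) (mS2 : measurable S2).
Variable f : T1 * T2 -> \bar R.
Hypothesis fi : (m1 \x m2)%E.-integrable (S1 `*` S2) f.

Let mS : measurable (S1 `*` S2). Proof. exact: measurableX. Qed.
Let fp : (m1 \x m2)%E.-integrable setT (f \_ (S1 `*` S2)).
Proof. by apply/(integrable_mkcond f mS). Qed.

(** Extension by zero outside the rectangle reduces to the whole product. *)
Lemma Fubini_rectangle12 : (\int[m1 \x m2]_(z in S1 `*` S2) f z =
  \int[m1]_(x in S1) \int[m2]_(y in S2) f (x, y))%E.
Proof.
rewrite integral_mkcond -integral12_prod_meas1 //.
rewrite [RHS]integral_mkcond; apply: eq_integral => x _.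
rewrite /patch; case: ifPn => xS.
  rewrite [RHS]integral_mkcond; apply: eq_integral => y _.
  by rewrite /patch in_setX /= xS.
apply: integral0_eq => y _.
by rewrite in_setX /= (negbTE xS).
Qed.

Lemma Fubini_rectangle21 : (\int[m1 \x m2]_(z in S1 `*` S2) f z =
  \int[m2]_(y in S2) \int[m1]_(x in S1) f (x, y))%E.
Proof.
rewrite integral_mkcond -integral21_prod_meas1 //.
rewrite [RHS]integral_mkcond; apply: eq_integral => y _.
rewrite /patch; case: ifPn => yS.
  rewrite [RHS]integral_mkcond; apply: eq_integral => x _.
  by rewrite /patch in_setX /= yS andbT.
apply: integral0_eq => x _.
by rewrite in_setX /= (negbTE yS) andbF.
Qed.

End RectangleFubini.

(** * Integrals over the torus *)

Section PlaneMeasure.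
Context {R : realType}.
Local Notation mu := (@lebesgue_measure R).

(** A name for the product measure, so that it can be used as the first factor
    of a further product in Fubini's theorem. *)
Definition plane_measure : set (measurableTypeR R * measurableTypeR R) -> \bar R :=
  (mu \x mu)%E.

HB.instance Definition _ := Measure.copy plane_measure (mu \x mu)%E.

Lemma plane_measure_sigma_finite : sigma_finite setT plane_measure.
Proof.
pose B (n : nat) : set (measurableTypeR R) := `[- n%:R, n%:R]%classic.
have mB n : measurable (B n) by exact: measurable_itv.
have muB n : mu (B n) = (n%:R - - n%:R)%:E.
  rewrite lebesgue_measure_itv /= lte_fin; case: ltP => //= h.
  have n0 : 0 <= n%:R :> R by [].
  by congr EFin; move: h n0; lra.
exists (fun n => B n `*` B n) => [|n]; last first.
  split; first exact: measurableX.
  have E2 := etrans (product_measure1E mu mu (mB n) (mB n)) (f_equal2 mule (muB n) (muB n)).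
  by rewrite [ltLHS]E2 -EFinM ltry.
apply/seteqP; split=> // -[x y] _.
exists (Num.truncn (`|x| + `|y|)).+1 => //=.
have h := truncnS_gt (`|x| + `|y|).
rewrite /B /= !in_itv /= -!ler_norml; split; apply: ltW; apply: le_lt_trans h.
  by rewrite lerDl.
by rewrite lerDr.
Qed.

HB.instance Definition _ :=
  Measure_isSigmaFinite.Build _ _ _ plane_measure plane_measure_sigma_finite.

End PlaneMeasure.

Section TorusIntegral.
Context {R : realType}.
Variable l : R.
Hypothesis l0 : 0 < l.
Local Notation mu := (@lebesgue_measure R).
Local Notation mu3 := (mu \x mu \x mu)%E.
Local Notation V3 := (R * R * R)%type.
Implicit Types (g h : V3 -> R).

Lemma measurable_cube : measurable (cube l).
Proof. by apply: measurableX => //; exact: measurableX. Qed.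

Lemma cube_measure : mu3 (cube l) = (l ^+ 3)%:E.
Proof.
have muI : mu `[0, l]%classic = l%:E.
  by rewrite lebesgue_measure_itv /= lte_fin l0 oppr0 adde0.
have mI : measurable (`[0, l]%classic : set R) by [].
have sq : (mu \x mu)%E (`[0, l]%classic `*` `[0, l]%classic) = (l%:E * l%:E)%E.
  exact: (etrans (product_measure1E mu mu mI mI) (f_equal2 mule muI muI)).
have mS : measurable (`[0, l]%classic `*` `[0, l]%classic : set (R * R)) by exact: measurableX.
transitivity ((l%:E * l%:E) * l%:E)%E.
  exact: (etrans (product_measure1E (mu \x mu)%E mu mS mI) (f_equal2 mule sq muI)).
by rewrite -!EFinM; congr EFin; ring.
Qed.

Lemma compact_cube : compact (cube l).
Proof. by apply: compact_setX; [apply: compact_setX|]; exact: segment_compact. Qed.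

Lemma cube_nonempty : cube l !=set0.
Proof. by exists ((0, 0), 0); rewrite /cube /= !in_itv /= lexx ltW. Qed.

Lemma continuous_bounded_cube g : continuous g ->
  exists2 M, 0 <= M & forall x, cube l x -> `|g x| <= M.
Proof.
move=> cg.
have cn : continuous (fun x => `|g x|).
  by move=> x; apply: cvg_norm; exact: cg.
have [c _ Hc] := compact_EVT_max cube_nonempty compact_cube (continuous_subspaceT cn).
by exists `|g c| => // x xc; apply: Hc; rewrite inE.
Qed.

Lemma integrable_cube g : continuous g -> mu3.-integrable (cube l) (EFin \o g).
Proof.
move=> cg; apply: measurable_bounded_integrable.
- exact: measurable_cube.
- by rewrite [ltLHS]cube_measure ltry.
- exact: measurable_funS (continuous_measurable3 cg).
have [M M0 HM] := continuous_bounded_cube cg.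
by exists M; split; [exact: num_real | move=> N MN x xc; apply: (le_trans (HM x xc)); exact: ltW].
Qed.

(** The real-valued counterpart of [torus_integral]. *)
Definition torus_Rintegral g : R := \int[mu3]_(x in cube l) g x.

Local Notation I := torus_Rintegral.

Lemma torus_integralE g : continuous g -> torus_integral l g = (I g)%:E.
Proof.
move=> cg; rewrite /I /torus_integral /Rintegral fineK //.
by apply: integrable_fin_num; [exact: measurable_cube | exact: integrable_cube].
Qed.

Lemma torus_intD g h : continuous g -> continuous h ->
  I (fun x => g x + h x) = I g + I h.
Proof.
by move=> cg ch; apply: RintegralD;
  [exact: measurable_cube | exact: integrable_cube | exact: integrable_cube].
Qed.

Lemma torus_intZ (a : R) g : continuous g -> I (fun x => a * g x) = a * I g.
Proof.
by move=> cg; apply: RintegralZl; [exact: measurable_cube | exact: integrable_cube].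
Qed.

Lemma torus_int_cst (a : R) : I (fun=> a) = a * l ^+ 3.
Proof.
rewrite /I Rintegral_cst; last exact: measurable_cube.
by congr (_ * _); rewrite -[RHS]/(fine (l ^+ 3)%:E) -cube_measure.
Qed.

Lemma le_torus_int g h : continuous g -> continuous h ->
  (forall x, cube l x -> g x <= h x) -> I g <= I h.
Proof.
by move=> cg ch gh; apply: le_Rintegral => //;
  [exact: measurable_cube | exact: integrable_cube | exact: integrable_cube].
Qed.

Lemma torus_int_ge0 g : (forall x, 0 <= g x) -> 0 <= I g.
Proof. by move=> g0; exact: Rintegral_ge0. Qed.

Lemma torus_int_near g (a e : R) : continuous g ->
  (forall x, `|g x - a| <= e) -> `|I g - a * l ^+ 3| <= e * l ^+ 3.
Proof.
move=> cg ge; have l3 : 0 < l ^+ 3 by rewrite exprn_gt0.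
have lo : I (fun=> a - e) <= I g.
  apply: le_torus_int => //; first by move=> x; exact: cvg_cst.
  by move=> x _; have := ge x; rewrite ler_norml; lra.
have hi : I g <= I (fun=> a + e).
  apply: le_torus_int => //; first by move=> x; exact: cvg_cst.
  by move=> x _; have := ge x; rewrite ler_norml; lra.
move: lo hi; rewrite !torus_int_cst mulrBl mulrDl ler_norml; lra.
Qed.

(** The flows below do not depend on the third coordinate, so that their integrals
    become iterated integrals over the plane. *)
Lemma torus_int_plane (k : R * R -> R) : continuous k ->
  (I (fun x => k x.1))%:E =
    (l%:E * \int[mu]_(x in `[0%R, l]) \int[mu]_(y in `[0%R, l]) (k (x, y))%:E)%E /\
  (I (fun x => k x.1))%:E =
    (l%:E * \int[mu]_(y in `[0%R, l]) \int[mu]_(x in `[0%R, l]) (k (x, y))%:E)%E.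
Proof.
move=> ck.
have ck3 : continuous (fun x : V3 => k x.1).
  by apply: (continuous_compose (f := fst)) => // x; exact: cvg_fst.
have i3 := integrable_cube ck3.
have muI : mu `[0, l]%classic = l%:E.
  by rewrite lebesgue_measure_itv /= lte_fin l0 oppr0 adde0.
have mk : measurable_fun setT k.
  apply: measurable_caratheodory => [y|x].
    apply: continuous_measurable_fun; apply: (continuous_compose (f := fun x => (x, y))) => //.
    by apply: continuous_pair => x; [exact: cvg_id | exact: cvg_cst].
  apply: (continuous_compose (f := fun y => (x, y))) => //.
  by apply: continuous_pair => y; [exact: cvg_cst | exact: cvg_id].
have mI : measurable (`[0, l]%classic : set (measurableTypeR R)) by [].
have mS : measurable (`[0, l]%classic `*` `[0, l]%classic :
    set (measurableTypeR R * measurableTypeR R)) by exact: measurableX.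
have i2 : (mu \x mu)%E.-integrable (`[0, l] `*` `[0, l]) (EFin \o k).
  apply: measurable_bounded_integrable => //.
  - have := f_equal2 mule muI muI; rewrite -EFinM => mm.
    have := etrans (product_measure1E mu mu mI mI) mm => E2.
    by rewrite [ltLHS]E2 ltry.
  - exact: measurable_funS mk.
  have [M M0 HM] := continuous_bounded_cube ck3.
  exists M; split; [exact: num_real | move=> N MN x xc].
  apply: (le_trans (HM (x, 0) _)); last exact: ltW.
  by split=> //=; rewrite in_itv /= lexx ltW.
have E : (I (fun x => k x.1))%:E =
    (l%:E * \int[mu \x mu]_(x in (`[0%R, l]%classic `*` `[0%R, l]%classic)) (k x)%:E)%E.
  rewrite -torus_integralE //.
  have i3' : (plane_measure \x mu)%E.-integrable (cube l) (EFin \o (fun x : V3 => k x.1)).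
    exact: i3.
  transitivity (\int[plane_measure]_(x in (`[0%R, l]%classic `*` `[0%R, l]%classic))
     \int[mu]_(y in `[0%R, l]) (EFin \o (fun x : V3 => k x.1)) (x, y))%E.
    exact: (Fubini_rectangle12 mS mI i3').
  rewrite -(integralZl mS i2); apply: eq_integral => x _.
  transitivity (\int[mu]_(y in `[0%R, l]) cst (k x)%:E y)%E; first by [].
  by rewrite integral_cst // [X in (_ * X)%E]muI muleC.
rewrite E; split; congr (_ * _)%E.
  exact: (Fubini_rectangle12 mI mI i2).
exact: (Fubini_rectangle21 mI mI i2).
Qed.

End TorusIntegral.

(** * Integration of derivatives *)

Section TorusCalculus.
Context {R : realType}.
Variable l : R.
Hypothesis l0 : 0 < l.
Local Notation mu := (@lebesgue_measure R).
Local Notation V3 := (R * R * R)%type.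
Local Notation I := (torus_Rintegral l).

Lemma integral_derive (h dh : R -> R) (a b : R) : a < b ->
  (forall u : R, is_derive u 1 h (dh u)) -> continuous dh ->
  (\int[mu]_(u in `[a, b]) (dh u)%:E = (h b - h a)%:E)%E.
Proof.
move=> ab hd cd; have ch := is_derive_continuous hd.
rewrite EFinB; apply: continuous_FTC2 => //.
- exact: continuous_subspaceT.
- split=> [u _||]; first by have [] := hd u.
    exact: cvg_at_right_filter (ch a).
  exact: cvg_at_left_filter (ch b).
by move=> u _; rewrite derive1E; have [_ ->] := hd u.
Qed.

(** The horizontal coordinates are indexed by booleans because the shears of
    the construction alternate between the two. *)
Definition coord (b : bool) (x : V3) : R := if b then x.1.2 else x.1.1.

Lemma continuous_fst3 : continuous (fun x : V3 => x.1.1).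
Proof. by apply: (continuous_compose (f := fst)) => x; exact: cvg_fst. Qed.

Lemma continuous_snd3 : continuous (fun x : V3 => x.1.2).
Proof.
by apply: (continuous_compose (f := fst) (g := snd)) => x; [exact: cvg_fst | exact: cvg_snd].
Qed.

Lemma continuous_coord b : continuous (coord b).
Proof. by case: b; [exact: continuous_snd3 | exact: continuous_fst3]. Qed.

(** Integrating first in the differentiated coordinate leaves the difference of two
    values that periodicity makes equal. Zero means of oscillating functions are
    obtained in this way. *)
Lemma torus_int_derive (b : bool) (h dh : R -> R -> R) :
  (forall u v : R, is_derive u 1 (fun u => h u v) (dh u v)) ->
  continuous (fun p : R * R => dh p.1 p.2) ->
  (forall u v, h (u + l) v = h u v) ->
  I (fun x => dh (coord b x) (coord (~~ b) x)) = 0.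
Proof.
move=> hd cd hp; apply: EFin_inj.
have cdu v : continuous (fun u => dh u v).
  apply: (continuous_compose (f := fun u => (u, v))) cd.
  by apply: continuous_pair => u; [exact: cvg_id | exact: cvg_cst].
have inner v : (\int[mu]_(u in `[0%R, l]) (dh u v)%:E = 0)%E.
  rewrite (integral_derive l0 (fun u => hd u v) (cdu v)).
  by rewrite -[X in h X v](add0r l) hp subrr.
case: b.
  have cs : continuous (fun p : R * R => dh p.2 p.1).
    apply: (continuous_compose (f := fun p : R * R => (p.2, p.1))) cd.
    by apply: continuous_pair => p; [exact: cvg_snd | exact: cvg_fst].
  rewrite (torus_int_plane l0 cs).1 integral0_eq ?mule0 // => v _.
  exact: inner.
rewrite (torus_int_plane l0 cd).2 integral0_eq ?mule0 // => v _.
exact: inner.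
Qed.

(** A continuous function is uniformly close to its value at [t0] on the compact cube
    when the time is close to [t0]. *)
Lemma continuous_torus_int (g : R * V3 -> R) : continuous g ->
  continuous (fun t => I (fun x => g (t, x))).
Proof.
move=> cg t0.
have cgt t : continuous (fun x => g (t, x)).
  apply: (continuous_compose (f := fun x => (t, x))) cg.
  by apply: continuous_pair => x; [exact: cvg_cst | exact: cvg_id].
apply/cvgrPdist_le => e e0; have l3 : 0 < l ^+ 3 by rewrite exprn_gt0.
have el : 0 < e / l ^+ 3 by rewrite divr_gt0.
have unif : \forall t \near t0, cube l `<=` (fun x => `|g (t, x) - g (t0, x)| < e / l ^+ 3).
  have nc := iffLR (compact_near_coveringP _) (@compact_cube R l).
  apply: (nc R (nbhs t0) (fun t x => `|g (t, x) - g (t0, x)| < e / l ^+ 3)) => x _.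
  have cd : continuous (fun z : V3 * R => g (z.2, z.1) - g (t0, z.1)).
    move=> z; apply: cvgB.
      apply: (continuous_compose (f := fun z : V3 * R => (z.2, z.1)) _ cg).
      by apply: continuous_pair => y; [exact: cvg_snd | exact: cvg_fst].
    apply: (continuous_compose (f := fun z : V3 * R => (t0, z.1)) _ cg).
    by apply: continuous_pair => y; [exact: cvg_cst | exact: cvg_fst].
  have := cd (x, t0); rewrite /continuous_at subrr => /cvgr0Pnorm_lt /(_ _ el).
  by apply: filterS => -[y t].
near=> t.
have ut : forall x, cube l x -> `|g (t, x) - g (t0, x)| < e / l ^+ 3.
  by near: t.
rewrite distrC.
have -> : I (fun x => g (t, x)) - I (fun x => g (t0, x)) =
    I (fun x => g (t, x) + -1 * g (t0, x)).
  rewrite torus_intD // ?torus_intZ ?mulN1r // => x.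
  by apply: cvgM; [exact: cvg_cst | exact: cgt].
have cD : continuous (fun x => g (t, x) + -1 * g (t0, x)).
  by move=> x; apply: cvgD; [exact: cgt | apply: cvgM; [exact: cvg_cst | exact: cgt]].
have bnd : forall x, cube l x -> - (e / l ^+ 3) <= g (t, x) + -1 * g (t0, x) <= e / l ^+ 3.
  by move=> x /ut /ltW; rewrite mulN1r ler_norml.
rewrite ler_norml; apply/andP; split.
  have -> : - e = I (fun=> - (e / l ^+ 3)).
    by rewrite torus_int_cst // mulNr divfK // gt_eqF.
  apply: le_torus_int => //; first by move=> x; exact: cvg_cst.
  by move=> x /bnd /andP[].
have -> : e = I (fun=> e / l ^+ 3) by rewrite torus_int_cst // divfK // gt_eqF.
apply: le_torus_int => //; first by move=> x; exact: cvg_cst.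
by move=> x /bnd /andP[].
Unshelve. all: by end_near. Qed.

End TorusCalculus.

(** * Time-dependent fields in L^2 *)

Section L2Fields.
Context {R : realType}.
Variable l : R.
Hypothesis l0 : 0 < l.
Local Notation V3 := (R * R * R)%type.
Local Notation I := (torus_Rintegral l).
Implicit Types (v w : V3 -> 'rV[R]_3) (f g : R -> V3 -> 'rV[R]_3).

Definition sqnorm v (x : V3) : R := \sum_(i < 3) v x 0 i ^+ 2.

Definition continuous_field v := forall i : 'I_3, continuous (fun x => v x 0 i).

Definition jointly_continuous f :=
  forall i : 'I_3, continuous (fun z : R * V3 => f z.1 z.2 0 i).

Lemma continuous_ord_sum (T : topologicalType) n (a : 'I_n -> T -> R) :
  (forall i, continuous (a i)) -> continuous (fun x => \sum_(i < n) a i x).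
Proof.
elim: n a => [|n IH] a ca.
  by under eq_fun do rewrite big_ord0; move=> x; exact: cvg_cst.
under eq_fun do rewrite big_ord_recl.
by move=> x; apply: cvgD; [exact: ca | exact: IH].
Qed.

Lemma continuous_sq (T : topologicalType) (a : T -> R) :
  continuous a -> continuous (fun x => a x ^+ 2).
Proof.
move=> ca x; rewrite /continuous_at expr2.
under eq_fun do rewrite expr2.
by apply: cvgM; exact: ca.
Qed.

Lemma continuous_sqnorm v : continuous_field v -> continuous (sqnorm v).
Proof. by move=> cv; apply: continuous_ord_sum => i; apply: continuous_sq. Qed.

Lemma sqnorm_ge0 v x : 0 <= sqnorm v x.
Proof. by apply: sumr_ge0 => i _; exact: sqr_ge0. Qed.

Lemma continuous_fieldB v w : continuous_field v -> continuous_field w ->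
  continuous_field (v - w).
Proof.
move=> cv cw i; rewrite (_ : (fun x => _) = fun x => v x 0 i - w x 0 i).
  by move=> x; apply: cvgB; [exact: cv | exact: cw].
by apply/funext => x; rewrite !mxE.
Qed.

Lemma L2norm_sqE v : continuous_field v -> L2norm_sq l v = (I (sqnorm v))%:E.
Proof. by move=> cv; rewrite /L2norm_sq torus_integralE //; exact: continuous_sqnorm. Qed.

Lemma L2normE v : continuous_field v -> L2norm l v = (Num.sqrt (I (sqnorm v)))%:E.
Proof. by move=> cv; rewrite /L2norm L2norm_sqE. Qed.

Lemma in_L2_continuous v : torus_periodic l v -> continuous_field v -> in_L2 l v.
Proof.
move=> pv cv; split=> // [i|]; last by rewrite L2normE // ltry.
apply: measurable_funS (continuous_measurable3 (cv i)) => //; exact: measurableT.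
Qed.

Lemma sqnorm_triangle v w (z : V3 -> 'rV[R]_3) x :
  sqnorm (v - z) x <= 2 * sqnorm (v - w) x + 2 * sqnorm (w - z) x.
Proof.
rewrite /sqnorm !mulr_sumr -big_split /=; apply: ler_sum => i _.
rewrite !mxE; set a := v x 0 i; set b := w x 0 i; set c := z x 0 i.
have := sqr_ge0 ((a - b) - (b - c)); nra.
Qed.

Lemma L2_triangle v w (z : V3 -> 'rV[R]_3) : continuous_field v ->
  continuous_field w -> continuous_field z ->
  I (sqnorm (v - z)) <= 2 * I (sqnorm (v - w)) + 2 * I (sqnorm (w - z)).
Proof.
move=> cv cw cz.
have c1 := continuous_sqnorm (continuous_fieldB cv cw).
have c2 := continuous_sqnorm (continuous_fieldB cw cz).
have c3 := continuous_sqnorm (continuous_fieldB cv cz).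
have cc (a : V3 -> R) : continuous a -> continuous (fun x => 2 * a x).
  by move=> ca x; apply: cvgM; [exact: cvg_cst | exact: ca].
rewrite -!torus_intZ // -torus_intD //; [|exact: cc|exact: cc].
apply: le_torus_int => // [x|x _]; last exact: sqnorm_triangle.
by apply: cvgD; apply: cc.
Qed.

Lemma jointly_continuous_at f t : jointly_continuous f -> continuous_field (f t).
Proof.
move=> cf i; apply: (continuous_compose (f := fun x : V3 => (t, x)) _ (cf i)).
by apply: continuous_pair => x; [exact: cvg_cst | exact: cvg_id].
Qed.

Lemma cvg_sqrt0 (T : Type) (F : set_system T) {FF : Filter F} (J : T -> R) :
  J @ F --> (0 : R) -> (Num.sqrt (J t))%:E @[t --> F] --> 0%E.
Proof.
move=> J0.
have h : (Num.sqrt \o J) @ F --> (0 : R).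
  rewrite -(@sqrtr0 R); apply: (cvg_comp _ _ J0).
  exact: sqrt_continuous.
by apply/cvg_EFin; [near=> t | exact: h].
Unshelve. all: by end_near. Qed.

(** A uniform limit, in time, of continuous curves in L^2 is continuous. *)
Lemma in_C_L2_limit f : (forall t, torus_periodic l (f t)) ->
  (forall t, continuous_field (f t)) ->
  (forall e, 0 < e -> exists2 g, jointly_continuous g &
     forall t, I (sqnorm (g t - f t)) <= e) ->
  in_C_L2 l f.
Proof.
move=> pf cf appr; split=> [t|t0]; first exact: in_L2_continuous.
rewrite (_ : (fun t => L2norm l (f t - f t0)) =
    (fun t => (Num.sqrt (I (sqnorm (f t - f t0))))%:E)); last first.
  by apply/funext => t; rewrite L2normE //; exact: continuous_fieldB.
apply: cvg_sqrt0; apply/cvgr0Pnorm_lt => e e0.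
have e16 : 0 < e / 16%:R by rewrite divr_gt0.
have [g cg gf] := appr _ e16.
have cgt t := @jointly_continuous_at g t cg.
have cG : continuous (fun t => I (fun x => sqnorm (g t - g t0) x)).
  apply: (@continuous_torus_int _ _ l0 (fun z => sqnorm (g z.1 - g t0) z.2)).
  apply: continuous_ord_sum => i; apply: continuous_sq.
  rewrite (_ : (fun z => _) = fun z => g z.1 z.2 0 i - g t0 z.2 0 i).
    move=> z; apply: cvgB; first exact: cg.
    apply: (continuous_compose (f := snd) _ (cgt t0 i)) => y; exact: cvg_snd.
  by apply/funext => z; rewrite !mxE.
have G0 : I (sqnorm (g t0 - g t0)) = 0.
  rewrite (_ : sqnorm _ = fun=> 0); first by rewrite torus_int_cst ?mul0r.
  by apply/funext => x; rewrite /sqnorm big1 // => i _; rewrite !mxE subrr expr0n.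
have := cG t0; rewrite /continuous_at G0 => /cvgr0Pnorm_lt /(_ _ e16) gn.
near=> t.
have gt : `|I (sqnorm (g t - g t0))| < e / 16%:R by near: t.
rewrite ger0_norm; last by apply: torus_int_ge0 => x; exact: sqnorm_ge0.
have T1 := L2_triangle (cf t) (cgt t) (cf t0).
have T2 := L2_triangle (cgt t) (cgt t0) (cf t0).
have S1 : sqnorm (f t - g t) = sqnorm (g t - f t).
  by apply/funext => x; apply: eq_bigr => i _; rewrite !mxE -sqrrN opprB.
move: T1 T2 (gf t) (gf t0) gt; rewrite S1 ltr_norml => T1 T2 g1 g2 /andP[_ gt].
lra.
Unshelve. all: by end_near. Qed.

(** A jointly continuous field is its own approximation. *)
Lemma in_C_L2_continuous f : (forall t, torus_periodic l (f t)) ->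
  jointly_continuous f -> in_C_L2 l f.
Proof.
move=> pf cf; apply: in_C_L2_limit => // [t|e e0].
  exact: jointly_continuous_at.
exists f => // t; rewrite (_ : sqnorm _ = fun=> 0).
  by rewrite torus_int_cst // mul0r ltW.
by apply/funext => x; rewrite /sqnorm big1 // => i _; rewrite !mxE subrr expr0n.
Qed.

Lemma cvg_C_L2_bound (F : nat -> R -> V3 -> 'rV[R]_3) f (e : nat -> R) :
  (forall j t, continuous_field (F j t)) -> (forall t, continuous_field (f t)) ->
  (forall j t, I (sqnorm (F j t - f t)) <= e j) -> e j @[j --> \oo] --> (0 : R) ->
  cvg_C_L2 l F f.
Proof.
move=> cF cf Fe e0; rewrite /cvg_C_L2.
apply: (squeeze_cvge _ (cvg_cst 0%E) (cvg_sqrt0 e0)); near=> j.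
apply/andP; split.
  apply: (@le_trans _ _ (L2norm l (F j 0 - f 0))).
    by rewrite L2normE ?lee_fin ?sqrtr_ge0 //; exact: continuous_fieldB.
  by apply: ereal_sup_ubound; exists 0.
apply: ge_ereal_sup => _ [t _ <-].
rewrite L2normE; last exact: continuous_fieldB.
by rewrite lee_fin ler_wsqrtr.
Unshelve. all: by end_near. Qed.

End L2Fields.

(** * Periodization and time averages *)

Section Periodization.
Context {R : realType}.
Variable tau : R.
Hypothesis tau0 : 0 < tau.
Implicit Types (s t : R).

Definition period_start t : R := tau * (Num.floor (t / tau))%:~R.

(** Representative of [t] in the period [0, tau[. *)
Definition phase t : R := t - period_start t.

Lemma phase_itv t : 0 <= phase t < tau.
Proof.
rewrite /phase /period_start; have /andP[lo hi] := floor_itv (t / tau).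
have tE : tau * (t / tau) = t by rewrite mulrC divfK // gt_eqF.
rewrite subr_ge0 -[X in _ <= X]tE ler_pM2l // lo /= ltrBlDl.
by rewrite -[X in X < _]tE -[X in _ < _ + X]mulr1 -mulrDr ltr_pM2l // -intrD1.
Qed.

Lemma phase_eq t (m : int) : 0 <= t - tau * m%:~R < tau -> phase t = t - tau * m%:~R.
Proof.
move=> /andP[lo hi]; rewrite /phase /period_start (floor_def (m := m)) //.
apply/andP; split; first by rewrite ler_pdivlMr // mulrC -subr_ge0.
by rewrite ltr_pdivrMr // intrD mulrDl mul1r [_ * tau]mulrC -ltrBlDl.
Qed.

Lemma phaseD t : phase (t + tau) = phase t.
Proof.
have E : t + tau - tau * (Num.floor (t / tau) + 1)%:~R = phase t.
  by rewrite /phase /period_start intrD mulrDr mulr1; ring.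
by rewrite -E; apply: phase_eq; rewrite E; exact: phase_itv.
Qed.

Lemma phase_id t : 0 <= t < tau -> phase t = t.
Proof.
by move=> h; rewrite (@phase_eq t 0) mulr0 ?subr0.
Qed.

(** Since the pattern is at rest at both ends of the period, near each time the
    periodization is a single translate of the pattern. *)
Lemma phase_local (A : Type) (G : R -> A) (z : A) (a b : R) :
  0 < a -> b < tau -> (forall s, s <= a \/ b <= s -> G s = z) ->
  forall t, \forall s \near t, G (phase s) = G (s - period_start t).
Proof.
move=> a0 btau Gz t.
have /andP[lo hi] := phase_itv t.
have [r0|r0] := ltP 0 (phase t).
  near=> s; congr G; apply: phase_eq; apply/andP; split.
    rewrite subr_ge0 ltW //; near: s; apply: lt_nbhsr.
    by rewrite -/(period_start t) -subr_gt0.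
  rewrite ltrBlDr; near: s; apply: lt_nbhsl.
  by rewrite -/(period_start t) -ltrBlDr.
have tE : t = period_start t.
  by apply/eqP; rewrite -subr_eq0; apply/eqP/le_anti; rewrite r0 lo.
set m := Num.floor (t / tau).
near=> s.
have st : `|t - s| < Num.min tau (tau - b).
  near: s.
  apply/nbhs_ballP; exists (Num.min tau (tau - b)) => //=.
  by rewrite lt_min tau0 subr_gt0.
move: st; rewrite lt_min ltr_norml ltr_norml => /andP[/andP[s1 s2] /andP[s3 s4]].
have [ts|ts] := leP t s.
  by congr G; apply: phase_eq; rewrite -/(period_start t) -tE; apply/andP; split; lra.
have E : s - tau * (m - 1)%:~R = s - t + tau.
  by rewrite intrB mulrBr mulr1 -/(period_start t) -tE; ring.
rewrite (@phase_eq s (m - 1)) E; last by apply/andP; split; lra.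
rewrite !Gz //; first by left; rewrite -tE; lra.
by right; lra.
Unshelve. all: by end_near. Qed.

Lemma continuous_periodic_bounded (Q : R -> R) : continuous Q ->
  (forall t, Q (t + tau) = Q t) -> exists M, forall t, `|Q t| <= M.
Proof.
move=> cQ pQ.
have pn (n : nat) t : Q (t + tau * n%:R) = Q t.
  elim: n t => [|n IH] t; first by rewrite mulr0 addr0.
  by rewrite -[n.+1]addn1 natrD mulrDr mulr1 addrA pQ IH.
have pz t : Q (phase t) = Q t.
  rewrite /phase /period_start; case: (Num.floor _) => n /=.
    by rewrite -(pn n) subrK.
  by rewrite NegzE mulrNz mulrN opprK pn.
have [c _ Hc] := EVT_max (ltW tau0) (continuous_subspaceT (f := fun t => `|Q t|) (fun t => cvg_norm (cQ t))).
exists `|Q c| => t; rewrite -pz; apply: Hc.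
by have /andP[? ?] := phase_itv t; rewrite in_itv /=; apply/andP; split=> //; exact: ltW.
Qed.

End Periodization.

Section Shift.
Context {R : realType} {V : normedModType R}.
Implicit Types (g : V -> R) (w : V).

Lemma shift_quotient g w v x :
  (fun h : R => h^-1 *: (((fun z => g (z + w)) \o shift x) (h *: v) - g (x + w))) =
  (fun h : R => h^-1 *: ((g \o shift (x + w)) (h *: v) - g (x + w))).
Proof. by apply/funext => h /=; rewrite addrA. Qed.

Lemma derive_translate g w v x :
  'D_v (fun z => g (z + w)) x = 'D_v g (x + w).
Proof. by rewrite /derive shift_quotient. Qed.

Lemma smooth_translate g w : smooth g -> smooth (fun z => g (z + w)).
Proof.
have cw : continuous (fun z : V => z + w).
  move=> z; have ci : (fun z : V => z) @ z --> z by exact: cvg_id.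
  exact: (cvgD ci (cvg_cst w)).
move=> sg n; elim: n g sg => [|n IH] g sg.
  exact: continuous_compose cw (smooth_continuous sg).
split; first exact: continuous_compose cw (smooth_continuous sg).
move=> v; split=> [x|].
  have := smooth_derivable (x := x + w) (v := v) sg.
  by rewrite /derivable -shift_quotient.
rewrite (_ : 'D_v _ = fun z => 'D_v g (z + w)); last by apply/funext => z; exact: derive_translate.
exact: (IH ('D_v g) (@smooth_derive _ _ g v sg)).
Qed.

End Shift.

Section TimeAverage.
Context {R : realType}.
Local Notation mu := (@lebesgue_measure R).
Implicit Types (e P : R -> R) (s t : R).

(** A smooth cutoff splits [e] into a part that vanishes far to the left and one that
    vanishes far to the right; each is integrated from the side where it vanishes. *)
Lemma exists_primitive e : continuous e -> exists P, forall t, is_derive t 1 P (e t).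
Proof.
move=> ce; have [[chi be] [[schi _] _ _ [chi0 chi1] _]] := @exists_smooth_step R 0 1 ltr01.
move: schi chi0 chi1 => /= /smooth_continuous cchi chi0 chi1.
have [P1 dP1] : exists P, forall t, is_derive t 1 P (chi t * e t).
  apply: (@primitive_zero_left _ 0) => [t|t t0]; last by rewrite chi0 ?mul0r.
  by apply: cvgM; [exact: cchi | exact: ce].
have [P2 dP2] : exists P, forall t, is_derive t 1 P ((1 - chi (- t)) * e (- t)).
  apply: (@primitive_zero_left _ (-1)) => [|t t1]; last first.
    by rewrite chi1 ?subrr ?mul0r // lerNr.
  apply: (continuous_compose (f := -%R) (g := fun t => (1 - chi t) * e t)).
    by move=> t; apply: cvgN; exact: cvg_id.
  move=> t; apply: cvgM; last exact: ce.
  by apply: cvgB; [exact: cvg_cst | exact: cchi].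
exists (fun t => P1 t - P2 (- t)) => t.
have dN : is_derive t 1 (fun s : R => - s) (-1) by apply: is_derive_opp; exact: is_derive_id.
have := is_derive_sub (dP1 t) (is_derive_comp dN (dP2 (- t))).
by move/is_derive_eq; apply; rewrite opprK; ring.
Qed.

Variables (tau k : R).
Hypotheses (tau0 : 0 < tau) (k0 : 0 < k).

(** The deviation of the primitive from its linear growth is periodic, hence
    bounded, so time averages converge and the generalized limit is the mean
    over one period. *)
Lemma banach_limit_mean (Lim : (R -> R) -> R) (E : R -> \bar R) e P :
  banach_limit Lim -> continuous e -> (forall t, e (t + tau) = e t) ->
  (forall t, E t = (e t)%:E) -> (forall t, is_derive t 1 P (e t)) ->
  Lim (fun T => fine ((T * k)^-1%:E * \int[mu]_(t in `[0%R, T]) E t)%E) =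
  (P tau - P 0) / (tau * k).
Proof.
move=> hLim ce pe EE dP.
have J T : 0 < T -> fine ((T * k)^-1%:E * \int[mu]_(t in `[0%R, T]) E t)%E
    = (T * k)^-1 * (P T - P 0).
  move=> T0; under eq_integral do rewrite EE.
  by rewrite (integral_derive T0 dP ce).
(* over one period the primitive grows by a fixed amount *)
have step t : P (t + tau) = P t + (P tau - P 0).
  have dD s : is_derive s 1 (fun s => P (s + tau) - P s) 0.
    have ds : is_derive s 1 (fun s : R => s + tau) 1.
      by have := is_derive_add (is_derive_id s 1) (is_derive_cst tau s 1); rewrite addr0.
    have := is_derive_sub (is_derive_comp ds (dP _)) (dP s).
    by move/is_derive_eq; apply; rewrite pe mulr1 subrr.
  suff : P (t + tau) - P t = P (0 + tau) - P 0 by rewrite add0r => <-; ring.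
  have cst (a b : R) : a <= b -> P (b + tau) - P b = P (a + tau) - P a.
    move=> ab; have [c _ Ec] := mean_value dD ab.
    by apply/eqP; rewrite -subr_eq0 Ec mul0r.
  by have [t0|/ltW t0] := leP t 0; [apply/esym|]; exact: cst.
pose Q t := P t - P 0 - t * ((P tau - P 0) / tau).
have cP := is_derive_continuous dP.
have cQ : continuous Q.
  move=> t; apply: cvgB; first by apply: cvgB; [exact: cP | exact: cvg_cst].
  by apply: cvgM; [exact: cvg_id | exact: cvg_cst].
have pQ t : Q (t + tau) = Q t.
  by rewrite /Q step; field; rewrite gt_eqF.
have [M HM] := continuous_periodic_bounded tau0 cQ pQ.
have [B HB] := continuous_periodic_bounded tau0 ce pe.
have B0 : 0 <= B by rewrite (le_trans _ (HB 0)).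
apply: banach_limit_cvg => //.
  exists (B / k) => T T0; rewrite J //.
  have [c _ Ec] := mean_value dP (ltW T0).
  rewrite Ec subr0 invfM mulrC -!mulrA [T * _]mulrA mulfV ?gt_eqF // mul1r.
  by rewrite normrM [X in _ * X]gtr0_norm ?invr_gt0 // ler_wpM2r ?invr_ge0 ?(ltW k0).
have M0 : 0 <= M by rewrite (le_trans _ (HM 0)).
apply/cvgrPdist_le => d d0; near=> T.
have T0 : 0 < T by near: T; exact: nbhs_pinfty_gt.
have TM : M / (k * d) <= T by near: T; apply: nbhs_pinfty_ge; exact: num_real.
rewrite J //.
have -> : (P tau - P 0) / (tau * k) - (T * k)^-1 * (P T - P 0) = - (Q T / (T * k)).
  by rewrite /Q; field; rewrite !gt_eqF.
have Tk : 0 < T * k by rewrite mulr_gt0.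
rewrite normrN normrM [X in _ * X]gtr0_norm ?invr_gt0 // ler_pdivrMr //.
apply: le_trans (HM T) _; move: TM.
by rewrite ler_pdivrMr ?mulr_gt0 // => /le_trans; apply; rewrite le_eqVlt; apply/orP; left; apply/eqP; ring.
Unshelve. all: by end_near. Qed.

End TimeAverage.

(** * The force as a residual *)

Section Lines.
Context {R : realType}.

Lemma derive_line (V W : normedModType R) (f : V -> R) (g : W -> R) x v y w :
  (forall h : R, f (h *: v + x) = g (h *: w + y)) -> 'D_v f x = 'D_w g y.
Proof.
move=> fg; have f0 : f x = g y by have := fg 0; rewrite !scale0r !add0r.
rewrite /derive.
have -> : (fun h : R => h^-1 *: ((f \o shift x) (h *: v) - f x)) =
          (fun h : R => h^-1 *: ((g \o shift y) (h *: w) - g y)).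
  by apply/funext => h /=; rewrite fg f0.
by [].
Qed.

End Lines.

Section Residual.
Context {R : realType}.
Local Notation V3 := (R * R * R)%type.
Local Notation V4 := (R * V3)%type.
Implicit Types (u : R -> V3 -> 'rV[R]_3) (t : R) (x : V3) (i k : 'I_3).

(** The force for which [u], with zero pressure, solves the equations. *)
Definition ns_residual (nu : R) u t x i : R :=
  derive1 (fun s : R => u s x 0 i) t
  + \sum_(k < 3) u t x 0 k * partial k (component (u t) i) x
  - nu * laplacian (component (u t) i) x.

Definition joint (g : R -> V3 -> R) : V4 -> R := fun z => g z.1 z.2.

Lemma partial_joint (g : R -> V3 -> R) t k :
  partial k (g t) = fun x => 'D_((0, basis3 k) : V4) (joint g) (t, x).
Proof.
apply/funext => x; apply: derive_line => h.
by rewrite /joint /= [h *: 0]mulr0 add0r.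
Qed.

Lemma derive1_joint (g : R -> V3 -> R) t x :
  derive1 (g ^~ x) t = 'D_((1, 0) : V4) (joint g) (t, x).
Proof.
rewrite derive1E; apply: derive_line => h.
by rewrite /joint /= scaler0 add0r.
Qed.

(** The residual is a polynomial in the joint derivatives of the components of [u] as
    functions on space-time. *)
Lemma smooth_ns_residual nu u i : smooth_velocity u ->
  smooth (fun z : V4 => ns_residual nu u z.1 z.2 i).
Proof.
move=> su.
rewrite (_ : (fun z => _) = fun z => 'D_((1, 0) : V4) (joint (fun t x => u t x 0 i)) z
   + \sum_(k < 3) u z.1 z.2 0 k * 'D_((0, basis3 k) : V4) (joint (fun t x => u t x 0 i)) z
   - nu * \sum_(k < 3) 'D_((0, basis3 k) : V4) ('D_((0, basis3 k) : V4) (joint (fun t x => u t x 0 i))) z).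
  apply: smoothB; last first.
    apply: smoothZ; apply: smooth_sum => k.
    by apply: smooth_derive; apply: smooth_derive; exact: su.
  apply: smoothD; first by apply: smooth_derive; exact: su.
  apply: smooth_sum => k; apply: smoothM; first exact: su.
  by apply: smooth_derive; exact: su.
apply/funext => -[t x]; rewrite /ns_residual /laplacian [(t, x).1]/= [(t, x).2]/=.
pose J t x := u t x 0 i.
have E2 k : 'D_((0, basis3 k) : V4) (joint J) (t, x) = partial k (component (u t) i) x.
  by rewrite (partial_joint J).
have E3 k : 'D_((0, basis3 k) : V4) ('D_((0, basis3 k) : V4) (joint J)) (t, x) =
    partial k (partial k (component (u t) i)) x.
  rewrite (partial_joint J) (partial_joint (fun t x => 'D_((0, basis3 k) : V4) (joint J) (t, x))).
  by rewrite /joint; under [in RHS]eq_fun do rewrite -surjective_pairing.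
rewrite -(derive1_joint J t x); under [in RHS]eq_bigr do rewrite E2.
by under [X in _ = _ - _ * X]eq_bigr do rewrite E3.
Qed.

Lemma partial_periodic (l : R) (g : V3 -> R) k :
  torus_periodic l g -> torus_periodic l (partial k g).
Proof.
move=> pg i x.
have E : (fun z => g (z + l *: basis3 i)) = g by apply/funext => y; exact: pg.
by rewrite /partial -[LHS](derive_translate g) E.
Qed.

Lemma ns_residual_periodic (l nu : R) u i t :
  (forall s, torus_periodic l (u s)) ->
  torus_periodic l (fun x => ns_residual nu u t x i).
Proof.
move=> pu k x; rewrite /ns_residual.
have pc s j : torus_periodic l (component (u s) j) by move=> m y; rewrite /component pu.
have -> : (fun s => u s (x + l *: basis3 k) 0 i) = (fun s => u s x 0 i).
  by apply/funext => s; rewrite pu.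
have L : laplacian (component (u t) i) (x + l *: basis3 k) = laplacian (component (u t) i) x.
  by apply: eq_bigr => m _; exact: (partial_periodic m (partial_periodic m (pc t i)) k x).
rewrite pu L; congr (_ + _ - _); apply: eq_bigr => m _.
by congr (_ * _); exact: (partial_periodic m (pc t i) k x).
Qed.

Lemma ns_residual_solution (l nu : R) u : (forall t, torus_periodic l (u t)) ->
  (forall t x, divergence (u t) x = 0) ->
  NS_solution l nu (fun t x => \row_i ns_residual nu u t x i) u (fun _ _ => 0).
Proof.
move=> pu du; split=> // t x i.
rewrite mxE /ns_residual /partial derive_cst; ring.
Qed.

(** Time enters the residual only through its germ, hence the residual of a
    periodization is the periodized residual. *)
Lemma ns_residual_translate nu (U u : R -> V3 -> 'rV[R]_3) t c i x :
  (\forall s \near t, u s = U (s - c)) ->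
  ns_residual nu u t x i = ns_residual nu U (t - c) x i.
Proof.
move=> ut; have E : u t = U (t - c) := nbhs_singleton ut.
rewrite /ns_residual E; congr (_ + _ - _).
rewrite !derive1E -(derive_translate (fun s => U s x 0 i)).
by apply: near_eq_derive; apply: filterS ut => s ->.
Qed.

End Residual.

Section DirectionalRules.
Context {R : realType}.
Local Notation V3 := (R * R * R)%type.
Implicit Types (x : V3) (b : bool) (i : 'I_3).

(** Only the restriction to the line through [x] matters; along a coordinate direction
    it is a function of one coordinate. *)
Lemma is_derive_along (V : normedModType R) (g : V -> R) (x v : V) (G : R -> R) (c d : R) :
  (forall h : R, g (h *: v + x) = G (h + c)) -> is_derive c 1 G d ->
  is_derive x v g d.
Proof.
move=> gG [dG DG].
have gx : g x = G c by have := gG 0; rewrite scale0r !add0r.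
have Q : (fun h : R => h^-1 *: ((g \o shift x) (h *: v) - g x)) =
    (fun h : R => h^-1 *: ((G \o shift c) (h *: 1) - G c)).
  by apply/funext => h /=; rewrite gG gx [_%:A]mulr1.
by split; [move: dG; rewrite /derivable -Q | rewrite -DG /derive Q].
Qed.

(** The two horizontal directions, indexed like the coordinates. *)
Definition dir b : 'I_3 := if b then inord 1 else inord 0.

Lemma val_dir b : dir b = b :> nat.
Proof. by case: b; rewrite /dir inordK. Qed.

Lemma dir_eq b c : (dir b == dir c) = (b == c).
Proof.
by apply/eqP/eqP => [/(congr1 val)/=|->//]; rewrite !val_dir; case: b; case: c.
Qed.

Lemma dir_max b : (ord_max == dir b) = false.
Proof. by apply/negbTE/eqP => /(congr1 val)/=; rewrite val_dir; case: b. Qed.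

Lemma sum_ord3 (F : 'I_3 -> R) :
  \sum_(i < 3) F i = F (dir false) + F (dir true) + F ord_max.
Proof.
rewrite !big_ord_recl big_ord0 addr0 addrA.
by congr (F _ + F _ + F _); apply/val_inj; rewrite ?val_dir //= inordK.
Qed.

Lemma coord_line b i (h : R) x :
  coord b (h *: basis3 i + x) = h * (i == dir b)%:R + coord b x.
Proof. by rewrite /coord -val_eqE /= val_dir; case: b. Qed.

Lemma is_derive_planar b i x (F : R -> R -> R) (Fu Fv : R) :
  (i = dir b -> is_derive (coord b x) 1 (fun u => F u (coord (~~ b) x)) Fu) ->
  (i = dir (~~ b) -> is_derive (coord (~~ b) x) 1 (fun v => F (coord b x) v) Fv) ->
  is_derive x (basis3 i) (fun y => F (coord b y) (coord (~~ b) y))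
    ((i == dir b)%:R * Fu + (i == dir (~~ b))%:R * Fv).
Proof.
move=> dFu dFv.
have [ib|ib] := eqVneq i (dir b).
  have ib' : (i == dir (~~ b)) = false.
    by rewrite ib -val_eqE /= !val_dir; case: (b).
  rewrite ib' mul1r mul0r addr0; apply: is_derive_along (dFu ib) => h.
  by rewrite !coord_line ib' ib eqxx mulr1 mulr0 add0r.
rewrite mul0r add0r.
have [ib'|ib'] := eqVneq i (dir (~~ b)).
  rewrite mul1r; apply: is_derive_along (dFv ib') => h.
  by rewrite !coord_line (negbTE ib) ib' eqxx mulr1 mulr0 add0r.
rewrite mul0r.
apply: (is_derive_along (G := fun=> F (coord b x) (coord (~~ b) x)) (c := 0)).
by move=> h; rewrite !coord_line (negbTE ib) (negbTE ib') mulr0 !add0r.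
Qed.

Lemma is_derive_bigsum (V : normedModType R) (I : Type) (r : seq I) (P : pred I)
  (F : I -> V -> R) (dF : I -> R) (x v : V) :
  (forall j, is_derive x v (F j) (dF j)) ->
  is_derive x v (fun y => \sum_(j <- r | P j) F j y) (\sum_(j <- r | P j) dF j).
Proof.
move=> dFj; elim: r => [|j r IH].
  under eq_fun do rewrite big_nil; rewrite big_nil; exact: is_derive_cst.
under eq_fun do rewrite big_cons; rewrite big_cons.
by case: (P j) => //; exact: is_derive_add.
Qed.

End DirectionalRules.

(** * Alternating shears transporting a vertical velocity *)

Section ShearAnsatz.
Context {R : realType}.
Local Notation V3 := (R * R * R)%type.
Local Notation V4 := (R * V3)%type.
Variables (n : nat) (a a' s s' s'' : nat -> R -> R).
Variables (f ft fu fv fuu fvv : nat -> R -> R -> R -> R).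
Variables (mean nu : R).

(** Horizontal shears alternating in direction, active at different times, and
    a vertical velocity which they transport passively. *)
Definition shear_velocity (b : bool) (t : R) (x : V3) : R :=
  \sum_(q < n | odd q == b) a q t * s q (coord (~~ b) x).

Definition scalar_velocity (t : R) (x : V3) : R :=
  \sum_(q < n) f q t (coord (odd q) x) (coord (~~ odd q) x).

Definition shear_flow (t : R) (x : V3) : 'rV[R]_3 :=
  \row_i (if i == dir false then shear_velocity false t x
          else if i == dir true then shear_velocity true t x
          else mean + scalar_velocity t x).

Hypotheses (da : forall q (t : R), is_derive t 1 (a q) (a' q t))
  (ds : forall q (y : R), is_derive y 1 (s q) (s' q y))
  (ds' : forall q (y : R), is_derive y 1 (s' q) (s'' q y)).
Hypotheses
  (dft : forall q (t u v : R), is_derive t 1 (fun t => f q t u v) (ft q t u v))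
  (dfu : forall q (t u v : R), is_derive u 1 (fun u => f q t u v) (fu q t u v))
  (dfv : forall q (t u v : R), is_derive v 1 (fun v => f q t u v) (fv q t u v))
  (dfuu : forall q (t u v : R), is_derive u 1 (fun u => fu q t u v) (fuu q t u v))
  (dfvv : forall q (t u v : R), is_derive v 1 (fun v => fv q t u v) (fvv q t u v)).
Hypotheses
  (disj : forall q r t, (q < n)%N -> (r < n)%N -> q != r -> a q t * a r t = 0)
  (disju : forall q r t u v, (q < n)%N -> (r < n)%N -> q != r -> a q t * fu r t u v = 0)
  (disjv : forall q r t u v, (q < n)%N -> (r < n)%N -> q != r -> a q t * fv r t u v = 0).

Lemma shear_flow_dir b t x : shear_flow t x 0 (dir b) = shear_velocity b t x.
Proof. by rewrite mxE !dir_eq; case: b. Qed.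

Lemma shear_flow_max t x : shear_flow t x 0 ord_max = mean + scalar_velocity t x.
Proof. by rewrite mxE !dir_max. Qed.

Lemma ord3_case (P : 'I_3 -> Prop) : (forall b, P (dir b)) -> P ord_max -> forall i, P i.
Proof.
move=> Pd Pm i; case: (eqVneq i (dir false)) => [->//|i0].
case: (eqVneq i (dir true)) => [->//|i1].
suff -> : i = ord_max by [].
have n0 : (i : nat) <> 0%N by move=> h; case/eqP: i0; apply/val_inj; rewrite [RHS]val_dir.
have n1 : (i : nat) <> 1%N by move=> h; case/eqP: i1; apply/val_inj; rewrite [RHS]val_dir.
by apply/val_inj; move: n0 n1; case: i {i0 i1} => -[|[|[|m]]].
Qed.

Lemma sum_delta (j : 'I_3) (F : 'I_3 -> R) : \sum_(i < 3) F i * (i == j)%:R = F j.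
Proof.
rewrite (bigD1 j) //= eqxx mulr1 big1 ?addr0 // => i /negbTE ->.
by rewrite mulr0.
Qed.

Lemma is_derive_shear b i x t :
  is_derive x (basis3 i) (shear_velocity b t)
    ((i == dir (~~ b))%:R * \sum_(q < n | odd q == b) a q t * s' q (coord (~~ b) x)).
Proof.
have := @is_derive_planar R b i x (fun _ v => \sum_(q < n | odd q == b) a q t * s q v)
  0 (\sum_(q < n | odd q == b) a q t * s' q (coord (~~ b) x)).
rewrite mulr0 add0r; apply=> _.
by apply: is_derive_bigsum => q; exact: is_derive_mulc.
Qed.

Lemma is_derive_shear2 b i x t :
  is_derive x (basis3 i)
    (fun x => (i == dir (~~ b))%:R * \sum_(q < n | odd q == b) a q t * s' q (coord (~~ b) x))
    ((i == dir (~~ b))%:R * \sum_(q < n | odd q == b) a q t * s'' q (coord (~~ b) x)).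
Proof.
have [ib|_] := eqVneq i (dir (~~ b)); last first.
  by rewrite mul0r; under eq_fun do rewrite mul0r; exact: is_derive_cst.
apply: is_derive_mulc.
have := @is_derive_planar R b i x (fun _ v => \sum_(q < n | odd q == b) a q t * s' q v)
  0 (\sum_(q < n | odd q == b) a q t * s'' q (coord (~~ b) x)).
rewrite mulr0 add0r ib eqxx mul1r; apply=> _.
by apply: is_derive_bigsum => q; exact: is_derive_mulc.
Qed.

Lemma is_derive_scalar i x t :
  is_derive x (basis3 i) (fun y => mean + scalar_velocity t y)
    (\sum_(q < n) ((i == dir (odd q))%:R * fu q t (coord (odd q) x) (coord (~~ odd q) x) +
       (i == dir (~~ odd q))%:R * fv q t (coord (odd q) x) (coord (~~ odd q) x))).
Proof.
rewrite -[X in is_derive _ _ _ X]add0r; apply: is_derive_add.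
by apply: is_derive_bigsum => q; apply: is_derive_planar.
Qed.

Lemma is_derive_scalar2 i x t :
  is_derive x (basis3 i) (fun y =>
    \sum_(q < n) ((i == dir (odd q))%:R * fu q t (coord (odd q) y) (coord (~~ odd q) y) +
       (i == dir (~~ odd q))%:R * fv q t (coord (odd q) y) (coord (~~ odd q) y)))
    (\sum_(q < n) ((i == dir (odd q))%:R * fuu q t (coord (odd q) x) (coord (~~ odd q) x) +
       (i == dir (~~ odd q))%:R * fvv q t (coord (odd q) x) (coord (~~ odd q) x))).
Proof.
apply: is_derive_bigsum => q; set b := odd q.
have dirN : (dir b == dir (~~ b)) = false by rewrite dir_eq; case: (b).
have [ib|ib] := eqVneq i (dir b).
  rewrite ib dirN mul0r addr0.
  under eq_fun do rewrite mul0r addr0 mul1r.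
  have := @is_derive_planar R b (dir b) x (fu q t) (fuu q t (coord b x) (coord (~~ b) x)) 0.
  rewrite eqxx mulr0 addr0; apply=> //.
  by move/eqP; rewrite dirN.
rewrite mul0r add0r; under eq_fun do rewrite mul0r add0r.
have [ib'|ib'] := eqVneq i (dir (~~ b)); last first.
  by rewrite mul0r; under eq_fun do rewrite mul0r; exact: is_derive_cst.
under eq_fun do rewrite mul1r.
have := @is_derive_planar R b (dir (~~ b)) x (fv q t) 0 (fvv q t (coord b x) (coord (~~ b) x)).
rewrite eqxx mulr0 add0r ib'; apply=> //.
by move/eqP; rewrite eq_sym dirN.
Qed.

Lemma shear_flow_componentE b t :
  component (shear_flow t) (dir b) = shear_velocity b t.
Proof. by apply/funext => x; rewrite /component shear_flow_dir. Qed.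

Lemma shear_flow_component_max t :
  component (shear_flow t) ord_max = fun x => mean + scalar_velocity t x.
Proof. by apply/funext => x; rewrite /component shear_flow_max. Qed.

Lemma shear_flow_divergence t x : divergence (shear_flow t) x = 0.
Proof.
rewrite /divergence big1 // => k _; elim/ord3_case: k => [b|]; rewrite /partial.
  rewrite shear_flow_componentE; have [_ ->] := is_derive_shear b (dir b) x t.
  by rewrite dir_eq; case: b; rewrite mul0r.
rewrite shear_flow_component_max; have [_ ->] := is_derive_scalar ord_max x t.
by rewrite big1 // => q _; rewrite !dir_max !mul0r addr0.
Qed.

(** If the other shears are inactive wherever [g] does not vanish, the product keeps the
    shear [r] alone. *)
Lemma shear_velocity_mul b t x r (g : R) : (forall q, (q < n)%N -> q != r -> a q t * g = 0) ->
  shear_velocity b t x * g =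
  ((odd r == b) && (r < n)%N)%:R * (a r t * s r (coord (~~ b) x) * g).
Proof.
move=> ag; rewrite /shear_velocity mulr_suml.
have z (q : 'I_n) : (q : nat) != r -> a q t * s q (coord (~~ b) x) * g = 0.
  by move=> qr; rewrite mulrAC ag ?mul0r.
have [rb|rb] := eqVneq (odd r) b; last first.
  rewrite mul0r big1 // => q /eqP qb; apply: z; apply: contraNneq rb => <-.
  by rewrite qb.
have [rn|rn] := ltnP r n; last first.
  rewrite mul0r big1 // => q _; apply: z.
  by rewrite neq_ltn (leq_trans (ltn_ord q) rn).
rewrite (bigD1 (Ordinal rn)) //=; last exact/eqP.
by rewrite mul1r big1 ?addr0 // => q /andP[_ qr]; apply: z.
Qed.

(** A parallel shear does not advect itself, and the shears of the other direction are
    inactive at the same time: the nonlinearity vanishes. *)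
Lemma shear_flow_residual_horizontal b t x :
  ns_residual nu shear_flow t x (dir b) =
  \sum_(q < n | odd q == b)
     (a' q t * s q (coord (~~ b) x) - nu * (a q t * s'' q (coord (~~ b) x))).
Proof.
rewrite /ns_residual shear_flow_componentE.
have -> : derive1 (fun r : R => shear_flow r x 0 (dir b)) t =
    \sum_(q < n | odd q == b) a' q t * s q (coord (~~ b) x).
  under eq_fun do rewrite shear_flow_dir.
  rewrite derive1E; have := @is_derive_bigsum R _ _ (index_enum 'I_n) (fun q => odd q == b)
    (fun q t => a q t * s q (coord (~~ b) x)) (fun q => a' q t * s q (coord (~~ b) x)) t 1.
  case=> // q; under eq_fun do rewrite mulrC.
  by rewrite mulrC; exact: is_derive_mulc.
have P1 i : partial i (shear_velocity b t) =
    fun x => (i == dir (~~ b))%:R * \sum_(q < n | odd q == b) a q t * s' q (coord (~~ b) x).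
  by apply/funext => y; rewrite /partial; have [_ ->] := is_derive_shear b i y t.
have -> : \sum_(k < 3) shear_flow t x 0 k * partial k (shear_velocity b t) x = 0.
  transitivity (\sum_(k < 3) (shear_flow t x 0 k *
      \sum_(q < n | odd q == b) a q t * s' q (coord (~~ b) x)) * (k == dir (~~ b))%:R).
    by apply: eq_bigr => k _; rewrite P1 mulrCA mulrC.
  rewrite sum_delta shear_flow_dir mulr_sumr big1 // => q /eqP qb.
  rewrite mulrA (@shear_velocity_mul _ _ _ (q : nat)) => [|r rn rq]; last exact: disj.
  by rewrite qb; case: (b); rewrite !mul0r.
have -> : laplacian (shear_velocity b t) x =
    \sum_(q < n | odd q == b) a q t * s'' q (coord (~~ b) x).
  transitivity (\sum_(i < 3)
      (\sum_(q < n | odd q == b) a q t * s'' q (coord (~~ b) x)) * (i == dir (~~ b))%:R).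
    apply: eq_bigr => i _; rewrite P1 /partial.
    by have [_ ->] := is_derive_shear2 b i x t; rewrite mulrC.
  by rewrite sum_delta.
by rewrite addr0 mulr_sumr -sumrB.
Qed.

(** Each vertical component is advected by its own shear, the only one that is active
    while that component varies. *)
Lemma shear_flow_residual_vertical t x :
  ns_residual nu shear_flow t x ord_max =
  \sum_(q < n) let u := coord (odd q) x in let v := coord (~~ odd q) x in
     (ft q t u v + a q t * s q v * fu q t u v - nu * (fuu q t u v + fvv q t u v)).
Proof.
rewrite /ns_residual shear_flow_component_max.
have -> : derive1 (fun r : R => shear_flow r x 0 ord_max) t =
    \sum_(q < n) ft q t (coord (odd q) x) (coord (~~ odd q) x).
  under eq_fun do rewrite shear_flow_max.
  rewrite derive1E.
  have dS := @is_derive_bigsum R _ _ (index_enum 'I_n) xpredT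
    (fun q t => f q t (coord (odd q) x) (coord (~~ odd q) x)) _ t 1
    (fun q => dft q t (coord (odd q) x) (coord (~~ odd q) x)).
  have [_ ->] := is_derive_add (is_derive_cst mean t 1) dS.
  by rewrite add0r.
have P1 i : partial i (fun x => mean + scalar_velocity t x) = fun x =>
    \sum_(q < n) ((i == dir (odd q))%:R * fu q t (coord (odd q) x) (coord (~~ odd q) x) +
       (i == dir (~~ odd q))%:R * fv q t (coord (odd q) x) (coord (~~ odd q) x)).
  by apply/funext => y; rewrite /partial; have [_ ->] := is_derive_scalar i y t.
have -> : \sum_(k < 3) shear_flow t x 0 k * partial k (fun x => mean + scalar_velocity t x) x =
    \sum_(q < n) a q t * s q (coord (~~ odd q) x) * fu q t (coord (odd q) x) (coord (~~ odd q) x).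
  under eq_bigr do rewrite P1 mulr_sumr.
  rewrite exchange_big /=; apply: eq_bigr => q _.
  set Fu := fu q t _ _; set Fv := fv q t _ _.
  transitivity (\sum_(k < 3) (shear_flow t x 0 k * Fu) * (k == dir (odd q))%:R +
     \sum_(k < 3) (shear_flow t x 0 k * Fv) * (k == dir (~~ odd q))%:R).
    by rewrite -big_split; apply: eq_bigr => k _ /=; ring.
  rewrite !sum_delta !shear_flow_dir.
  rewrite (@shear_velocity_mul _ _ _ (q : nat)) => [|r rn rq]; last exact: disju.
  rewrite (@shear_velocity_mul _ _ _ (q : nat)) => [|r rn rq]; last exact: disjv.
  rewrite eqxx ltn_ord mul1r (_ : (odd q == ~~ odd q) = false) ?mul0r ?addr0 //.
  by case: (odd q).
have -> : laplacian (fun x => mean + scalar_velocity t x) x =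
    \sum_(q < n) (fuu q t (coord (odd q) x) (coord (~~ odd q) x) +
                  fvv q t (coord (odd q) x) (coord (~~ odd q) x)).
  rewrite /laplacian.
  transitivity (\sum_(i < 3) \sum_(q < n)
      ((i == dir (odd q))%:R * fuu q t (coord (odd q) x) (coord (~~ odd q) x) +
       (i == dir (~~ odd q))%:R * fvv q t (coord (odd q) x) (coord (~~ odd q) x))).
    by apply: eq_bigr => i _; rewrite P1 /partial; have [_ ->] := is_derive_scalar2 i x t.
  rewrite exchange_big /=; apply: eq_bigr => q _.
  rewrite big_split /=; congr (_ + _).
    by under eq_bigr do rewrite mulrC; rewrite sum_delta.
  by under eq_bigr do rewrite mulrC; rewrite sum_delta.
by rewrite mulr_sumr -big_split -sumrB.
Qed.

End ShearAnsatz.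

(** * Plane waves in a shear *)

Section TrigDerivatives.
Context {R : realType} {V : normedModType R}.
Implicit Types (g : V -> R) (x v : V).

Lemma is_derive_cosf g x v (dg : R) : is_derive x v g dg ->
  is_derive x v (fun y => cos (g y)) (- sin (g x) * dg).
Proof. by move=> gd; exact: (is_derive_comp gd (is_derive_cos (g x))). Qed.

Lemma is_derive_sinf g x v (dg : R) : is_derive x v g dg ->
  is_derive x v (fun y => sin (g y)) (cos (g x) * dg).
Proof. by move=> gd; exact: (is_derive_comp gd (is_derive_sin (g x))). Qed.

Lemma is_derive_expf g x v (dg : R) : is_derive x v g dg ->
  is_derive x v (fun y => expR (g y)) (expR (g x) * dg).
Proof. by move=> gd; exact: (is_derive_comp gd (is_derive_expR (g x))). Qed.

End TrigDerivatives.

Section Waves.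
Context {R : realType}.
Implicit Types (t u v x : R).

Lemma is_derive_affine (k m x : R) : is_derive x 1 (fun y => k * y + m) k.
Proof.
have := is_derive_add (is_derive_mulc k (is_derive_id x 1)) (is_derive_cst m x 1).
by rewrite mulr1 addr0.
Qed.

Variables (w w' phi phi' S S' S'' : R -> R) (A B : R).
Hypotheses (dw : forall t, is_derive t 1 w (w' t))
  (dphi : forall t, is_derive t 1 phi (phi' t))
  (dS : forall v, is_derive v 1 S (S' v)) (dS' : forall v, is_derive v 1 S' (S'' v)).

(** A plane wave with coordinate [u] along the shear [S] and [v] across it: transport by
    the shear only adds a multiple of [S v] to the phase. *)
Definition wave_phase t u v : R := A * u + B * v + phi t * S v.
Definition wave t u v : R := w t * cos (wave_phase t u v).
Definition wave_t t u v : R :=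
  w' t * cos (wave_phase t u v) - w t * sin (wave_phase t u v) * (phi' t * S v).
Definition wave_u t u v : R := - w t * A * sin (wave_phase t u v).
Definition wave_uu t u v : R := - w t * A ^+ 2 * cos (wave_phase t u v).
Definition wave_v t u v : R := - w t * (B + phi t * S' v) * sin (wave_phase t u v).
Definition wave_vv t u v : R :=
  - w t * ((B + phi t * S' v) ^+ 2 * cos (wave_phase t u v)
           + phi t * S'' v * sin (wave_phase t u v)).

Let dpt t u v : is_derive t 1 (fun t => wave_phase t u v) (phi' t * S v).
Proof.
have d := is_derive_add (is_derive_cst (A * u + B * v) t 1)
  (is_derive_mul (dphi t) (is_derive_cst (S v) t 1)).
by apply: (is_derive_eq d); rewrite /= mulr0 addr0 add0r.
Qed.

Let dpu t u v : is_derive u 1 (fun u => wave_phase t u v) A.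
Proof.
by rewrite /wave_phase; under eq_fun do rewrite -addrA; exact: is_derive_affine.
Qed.

Let dpv t u v : is_derive v 1 (fun v => wave_phase t u v) (B + phi t * S' v).
Proof.
have := is_derive_add (is_derive_affine B (A * u) v) (is_derive_mulc (phi t) (dS v)).
by rewrite (_ : (fun v => wave_phase t u v) = (fun y => B * y + A * u + phi t * S y)) //;
  apply/funext => y; rewrite /wave_phase [A * u + _]addrC.
Qed.

Lemma is_derive_wave_t t u v : is_derive t 1 (fun t => wave t u v) (wave_t t u v).
Proof.
apply: (is_derive_eq (is_derive_mul (dw t) (is_derive_cosf (dpt t u v)))).
by rewrite /wave_t; ring.
Qed.

Lemma is_derive_wave_u t u v : is_derive u 1 (fun u => wave t u v) (wave_u t u v).
Proof.
apply: (is_derive_eq (is_derive_mulc (w t) (is_derive_cosf (dpu t u v)))).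
by rewrite /wave_u; ring.
Qed.

Lemma is_derive_wave_uu t u v : is_derive u 1 (fun u => wave_u t u v) (wave_uu t u v).
Proof.
apply: (is_derive_eq (is_derive_mulc (- w t * A) (is_derive_sinf (dpu t u v)))).
by rewrite /wave_uu; ring.
Qed.

Lemma is_derive_wave_v t u v : is_derive v 1 (fun v => wave t u v) (wave_v t u v).
Proof.
apply: (is_derive_eq (is_derive_mulc (w t) (is_derive_cosf (dpv t u v)))).
by rewrite /wave_v; ring.
Qed.

Lemma is_derive_wave_vv t u v : is_derive v 1 (fun v => wave_v t u v) (wave_vv t u v).
Proof.
have dfac : is_derive v 1 (fun v => - w t * (B + phi t * S' v)) (- w t * (phi t * S'' v)).
  apply: is_derive_mulc.
  have := is_derive_add (is_derive_cst B v 1) (is_derive_mulc (phi t) (dS' v)).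
  by rewrite add0r.
apply: (is_derive_eq (is_derive_mul dfac (is_derive_sinf (dpv t u v)))).
by rewrite /wave_vv; ring.
Qed.

End Waves.

Section Packet.
Context {R : realType}.
Implicit Types (t u v x : R).
Variables (g g' e e' : R -> R) (A B kappa : R).
Hypotheses (dg : forall t, is_derive t 1 g (g' t)) (de : forall t, is_derive t 1 e (e' t)).

Let xi u v : R := A * u + B * v.
Let S v : R := sin (kappa * v).
Let C v : R := cos (kappa * v).
Let S2 v : R := sin (2 * kappa * v).
Let C2 v : R := cos (2 * kappa * v).

(** A plane wave together with its first two responses to the shear
    [sin (kappa v)]: the first carries the dissipation, the second cancels the
    second harmonic that the shear produces from the first. *)
Definition profile t u v : R :=
  cos (xi u v) + e t * S v * sin (xi u v) + e t ^+ 2 / 8 * C2 v * cos (xi u v).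
Definition packet t u v : R := g t * profile t u v.
Definition packet_t t u v : R := g' t * profile t u v +
  g t * (e' t * S v * sin (xi u v) + e t * e' t / 4 * C2 v * cos (xi u v)).
Definition packet_u t u v : R := g t * A * (- sin (xi u v) + e t * S v * cos (xi u v)
  - e t ^+ 2 / 8 * C2 v * sin (xi u v)).
Definition packet_uu t u v : R := - g t * A ^+ 2 * profile t u v.
Definition packet_v t u v : R := g t * (B * (- sin (xi u v) + e t * S v * cos (xi u v)
    - e t ^+ 2 / 8 * C2 v * sin (xi u v))
  + kappa * (e t * C v * sin (xi u v) - e t ^+ 2 / 4 * S2 v * cos (xi u v))).
Definition packet_vv t u v : R := g t * (- B ^+ 2 * profile t u v
  - kappa ^+ 2 * (e t * S v * sin (xi u v) + e t ^+ 2 / 2 * C2 v * cos (xi u v))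
  + 2 * kappa * B * (e t * C v * cos (xi u v) + e t ^+ 2 / 4 * S2 v * sin (xi u v))).

Let dxu u v : is_derive u 1 (fun u => xi u v) A. Proof. exact: is_derive_affine. Qed.
Let dxv u v : is_derive v 1 (fun v => xi u v) B.
Proof. by rewrite /xi; under eq_fun do rewrite addrC; exact: is_derive_affine. Qed.
Let dk (k v : R) : is_derive v 1 (fun v => k * v) k.
Proof. by have := is_derive_mulc k (is_derive_id v 1); rewrite mulr1. Qed.
Let dS v : is_derive v 1 S (kappa * C v).
Proof. by apply: (is_derive_eq (is_derive_sinf (dk kappa v))); rewrite /C mulrC. Qed.
Let dC v : is_derive v 1 C (- kappa * S v).
Proof. by apply: (is_derive_eq (is_derive_cosf (dk kappa v))); rewrite /S; ring. Qed.
Let dS2 v : is_derive v 1 S2 (2 * kappa * C2 v).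
Proof. by apply: (is_derive_eq (is_derive_sinf (dk (2 * kappa) v))); rewrite /C2 mulrC. Qed.
Let dC2 v : is_derive v 1 C2 (- (2 * kappa) * S2 v).
Proof. by apply: (is_derive_eq (is_derive_cosf (dk (2 * kappa) v))); rewrite /S2; ring. Qed.

Lemma is_derive_packet_t t u v : is_derive t 1 (fun t => packet t u v) (packet_t t u v).
Proof.
have d1 := is_derive_mulc (S v * sin (xi u v)) (de t).
have d2 := is_derive_mulc (C2 v * cos (xi u v) / 8) (is_derive_pow 2 (de t)).
have d := is_derive_mul (dg t)
  (is_derive_add (is_derive_add (is_derive_cst (cos (xi u v)) t 1) d1) d2).
rewrite (_ : (fun t => packet t u v) = fun y : R => g y * (cst (cos (xi u v)) y +
  S v * sin (xi u v) * e y + C2 v * cos (xi u v) / 8 * e y ^+ 2)).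
  by apply: (is_derive_eq d); rewrite /packet_t /profile /=; field.
by apply/funext => y; rewrite /packet /profile /=; field.
Qed.

Lemma is_derive_packet_u t u v : is_derive u 1 (fun u => packet t u v) (packet_u t u v).
Proof.
have dc := is_derive_cosf (dxu u v); have dsn := is_derive_sinf (dxu u v).
have d := is_derive_mulc (g t) (is_derive_add (is_derive_add dc
  (is_derive_mulc (e t * S v) dsn)) (is_derive_mulc (e t ^+ 2 / 8 * C2 v) dc)).
by apply: (is_derive_eq d); rewrite /packet_u; ring.
Qed.

Lemma is_derive_packet_uu t u v : is_derive u 1 (fun u => packet_u t u v) (packet_uu t u v).
Proof.
have dc := is_derive_cosf (dxu u v); have dsn := is_derive_sinf (dxu u v).
have d := is_derive_mulc (g t * A) (is_derive_sub (is_derive_add (is_derive_opp dsn)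
  (is_derive_mulc (e t * S v) dc)) (is_derive_mulc (e t ^+ 2 / 8 * C2 v) dsn)).
by apply: (is_derive_eq d); rewrite /packet_uu /profile; ring.
Qed.

Lemma is_derive_packet_v t u v : is_derive v 1 (fun v => packet t u v) (packet_v t u v).
Proof.
have dc := is_derive_cosf (dxv u v); have dsn := is_derive_sinf (dxv u v).
have d := is_derive_mulc (g t) (is_derive_add (is_derive_add dc
  (is_derive_mul (is_derive_mulc (e t) (dS v)) dsn))
  (is_derive_mul (is_derive_mulc (e t ^+ 2 / 8) (dC2 v)) dc)).
by apply: (is_derive_eq d); rewrite /packet_v; field.
Qed.

Lemma is_derive_packet_vv t u v : is_derive v 1 (fun v => packet_v t u v) (packet_vv t u v).
Proof.
have dc := is_derive_cosf (dxv u v); have dsn := is_derive_sinf (dxv u v).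
have d := is_derive_mulc (g t) (is_derive_add
  (is_derive_mulc B (is_derive_sub (is_derive_add (is_derive_opp dsn)
     (is_derive_mul (is_derive_mulc (e t) (dS v)) dc))
     (is_derive_mul (is_derive_mulc (e t ^+ 2 / 8) (dC2 v)) dsn)))
  (is_derive_mulc kappa (is_derive_sub
     (is_derive_mul (is_derive_mulc (e t) (dC v)) dsn)
     (is_derive_mul (is_derive_mulc (e t ^+ 2 / 4) (dS2 v)) dc)))).
by apply: (is_derive_eq d); rewrite /packet_vv /profile; field.
Qed.

(** With [nu * kappa ^+ 2 = L], the shear of amplitude [L * e / A] turns the
    first response into an eddy damping [L * e ^+ 2 / 2] of the plane wave; all
    other terms carry a factor [g' * e], [e'], [L * e ^+ 3] or [nu]. *)
Lemma packet_residual (nu L : R) t u v : A != 0 -> nu * kappa ^+ 2 = L ->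
  packet_t t u v + L * e t / A * S v * packet_u t u v
    - nu * (packet_uu t u v + packet_vv t u v) =
  (g' t + g t * (L * e t ^+ 2 / 2)) * cos (xi u v)
  + g' t * (e t * S v * sin (xi u v) + e t ^+ 2 / 8 * C2 v * cos (xi u v))
  + g t * (e' t * S v * sin (xi u v) + e t * e' t / 4 * C2 v * cos (xi u v))
  - g t * (L * e t ^+ 3 / 8) * (S v * C2 v * sin (xi u v))
  + g t * nu * ((A ^+ 2 + B ^+ 2) * profile t u v)
  - g t * (nu * kappa) * (2 * B * (e t * C v * cos (xi u v) + e t ^+ 2 / 4 * S2 v * sin (xi u v))).
Proof.
move=> A0 <-.
have C2E : C2 v = 1 - 2 * S v ^+ 2.
  rewrite /C2 /S (_ : 2 * kappa * v = kappa * v + kappa * v); last by ring.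
  by rewrite cosD -!expr2 cos2sin2; ring.
rewrite /packet_t /packet_u /packet_uu /packet_vv /profile C2E.
by field.
Qed.

End Packet.

(** * The schedule of the stages *)

Section Schedule.
Context {R : realType}.
Implicit Types (a b t : R).

(** A smooth step together with a smooth square root of its derivative. *)
Definition step_pair a b : (R -> R) * (R -> R) :=
  if pselect (a < b) is left ab then projT1 (cid (exists_smooth_step ab))
  else (fun=> 0, fun=> 0).
Definition smooth_step a b : R -> R := (step_pair a b).1.
Definition step_root a b : R -> R := (step_pair a b).2.

Lemma smooth_stepP a b : a < b ->
  [/\ smooth (smooth_step a b) /\ smooth (step_root a b),
      forall t, is_derive t 1 (smooth_step a b) (step_root a b t ^+ 2),
      forall t, 0 <= smooth_step a b t <= 1,
      (forall t, t <= a -> smooth_step a b t = 0) /\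
      (forall t, b <= t -> smooth_step a b t = 1) &
      forall t, t <= a \/ b <= t -> step_root a b t = 0].
Proof.
move=> ab; rewrite /smooth_step /step_root /step_pair.
by case: pselect => // ab'; case: cid.
Qed.

Lemma smooth_is_derive1 (g : R -> R) t : smooth g -> is_derive t 1 g ('D_1 g t).
Proof. by move=> sg; apply: derivableP; exact: smooth_derivable. Qed.

(** Strict inequalities appear in the conclusion because the derivative depends on a
    neighbourhood of [t]. *)
Lemma derive_vanish (g : R -> R) a b : smooth g ->
  (forall t, t <= a \/ b <= t -> g t = 0) ->
  forall t, t < a \/ b < t -> 'D_1 g t = 0.
Proof.
move=> sg g0 t tab.
have -> : 'D_1 g t = 'D_1 (fun=> 0 : R) t.
  apply: near_eq_derive; near=> s; apply: g0.
  by near: s; case: tab => h; [near=> s; left; apply: ltW; near: s; exact: lt_nbhsl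
    | near=> s; right; apply: ltW; near: s; exact: lt_nbhsr].
exact: derive_cst.
Unshelve. all: by end_near. Qed.

Lemma bounded_of_support (g : R -> R) a b : a <= b -> continuous g ->
  (forall t, t < a \/ b < t -> g t = 0) -> exists2 M, 1 <= M & forall t, `|g t| <= M.
Proof.
move=> ab cg g0.
have [c _ Hc] := EVT_max ab (continuous_subspaceT (f := fun t => `|g t|) (fun t => cvg_norm (cg t))).
exists (1 + `|g c|); first by rewrite lerDl.
move=> t; have [ta|at_] := ltP t a; first by rewrite g0 ?normr0 ?addr_ge0 //; left.
have [bt|tb] := ltP b t; first by rewrite g0 ?normr0 ?addr_ge0 //; right.
by apply: ler_wpDl => //; apply: Hc; rewrite in_itv /= at_ tb.
Qed.

Variable tau : R.
Hypothesis tau0 : 0 < tau.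

(** Infinitely many stages have to fit in half a period. *)
Definition stage_time (n : nat) : R := tau / 2 * (1 - n.+2%:R^-1).

Lemma stage_time_lt n : stage_time n < stage_time n.+1.
Proof.
rewrite /stage_time ltr_pM2l ?divr_gt0 // ltrD2l ltrN2.
by rewrite ltf_pV2 ?posrE ?ltr0n // ltr_nat.
Qed.

Lemma stage_time_le m n : (m <= n)%N -> stage_time m <= stage_time n.
Proof.
move=> /subnK <-; elim: (n - m)%N => [|k IH] //.
by rewrite addSn (le_trans IH) // ltW // stage_time_lt.
Qed.

Lemma stage_time_ge n : tau / 4 <= stage_time n.
Proof.
apply: (le_trans _ (stage_time_le (leq0n n))).
by rewrite /stage_time; move: tau0; lra.
Qed.

Lemma stage_time_half n : stage_time n < tau / 2.
Proof.
rewrite /stage_time -[X in _ < X]mulr1 ltr_pM2l ?divr_gt0 //.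
Qed.

Definition stage n : R -> R := smooth_step (stage_time n) (stage_time n.+1).
Definition stage' n (t : R) : R := step_root (stage_time n) (stage_time n.+1) t ^+ 2.
Definition stage'' n : R -> R := 'D_1 (stage' n).

Lemma smooth_stage n : smooth (stage n).
Proof. by have [[]] := smooth_stepP (stage_time_lt n). Qed.

Lemma smooth_stage' n : smooth (stage' n).
Proof. by have [[_ sr] _ _ _ _] := smooth_stepP (stage_time_lt n); exact: smoothX. Qed.

Lemma smooth_stage'' n : smooth (stage'' n).
Proof. exact/smooth_derive/smooth_stage'. Qed.

Lemma is_derive_stage n t : is_derive t 1 (stage n) (stage' n t).
Proof. by have [_ h _ _ _] := smooth_stepP (stage_time_lt n); exact: h. Qed.

Lemma is_derive_stage' n t : is_derive t 1 (stage' n) (stage'' n t).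
Proof. exact/smooth_is_derive1/smooth_stage'. Qed.

Lemma stage_itv n t : 0 <= stage n t <= 1.
Proof. by have [_ _ h _ _] := smooth_stepP (stage_time_lt n); exact: h. Qed.

Lemma stage_before n t : t <= stage_time n -> stage n t = 0.
Proof. by have [_ _ _ [h _] _] := smooth_stepP (stage_time_lt n); exact: h. Qed.

Lemma stage_after n t : stage_time n.+1 <= t -> stage n t = 1.
Proof. by have [_ _ _ [_ h] _] := smooth_stepP (stage_time_lt n); exact: h. Qed.

Lemma stage'_out n t : t <= stage_time n \/ stage_time n.+1 <= t -> stage' n t = 0.
Proof.
by have [_ _ _ _ r0] := smooth_stepP (stage_time_lt n); move=> /r0 E; rewrite /stage' E expr0n.
Qed.

Lemma stage''_out n t : t <= stage_time n \/ stage_time n.+1 <= t -> stage'' n t = 0.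
Proof.
have [[_ sr] _ _ _ r0] := smooth_stepP (stage_time_lt n); move=> /r0 E.
have [_ e] := is_derive_pow 2 (smooth_is_derive1 t sr).
by rewrite /stage'' [LHS]e E mulr0 mul0r.
Qed.

Lemma stage'_active n t : stage' n t != 0 -> stage_time n < t < stage_time n.+1.
Proof.
by move=> h; rewrite !ltNge; apply/andP; split; apply: contraNN h => h; apply/eqP/stage'_out;
  [left | right].
Qed.

Lemma stage''_active n t : stage'' n t != 0 -> stage_time n < t < stage_time n.+1.
Proof.
by move=> h; rewrite !ltNge; apply/andP; split; apply: contraNN h => h; apply/eqP/stage''_out;
  [left | right].
Qed.

Lemma stage_bounds n : exists2 M, 1 <= M &
  forall t, `|stage' n t| <= M /\ `|stage'' n t| <= M.
Proof.
have ab := ltW (stage_time_lt n).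
have [M1 M11 H1] := bounded_of_support ab (smooth_continuous (smooth_stage' n))
  (fun t h => @stage'_out n t (match h with or_introl h => or_introl (ltW h) | or_intror h => or_intror (ltW h) end)).
have [M2 M21 H2] := bounded_of_support ab (smooth_continuous (smooth_stage'' n))
  (fun t h => @stage''_out n t (match h with or_introl h => or_introl (ltW h) | or_intror h => or_intror (ltW h) end)).
exists (Num.max M1 M2); first by rewrite le_max M11.
by move=> t; split; [rewrite le_max H1 | rewrite le_max H2 orbT].
Qed.

(** After the cascade: a window in which the small scales are dissipated, then
    a window in which the remainder is brought to rest. *)
Definition decay : R -> R := smooth_step (tau / 2) (5 / 8 * tau).
Definition decay_root : R -> R := step_root (tau / 2) (5 / 8 * tau).
Definition decay_root' : R -> R := 'D_1 decay_root.
Definition ending : R -> R := smooth_step (5 / 8 * tau) (3 / 4 * tau).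
Definition ending' (t : R) : R := step_root (5 / 8 * tau) (3 / 4 * tau) t ^+ 2.

Let dw : tau / 2 < 5 / 8 * tau. Proof. by move: tau0; lra. Qed.
Let ew : 5 / 8 * tau < 3 / 4 * tau. Proof. by move: tau0; lra. Qed.

Lemma smooth_decay : smooth decay. Proof. by have [[]] := smooth_stepP dw. Qed.
Lemma smooth_decay_root : smooth decay_root. Proof. by have [[]] := smooth_stepP dw. Qed.
Lemma smooth_ending : smooth ending. Proof. by have [[]] := smooth_stepP ew. Qed.

Lemma is_derive_decay t : is_derive t 1 decay (decay_root t ^+ 2).
Proof. by have [_ h _ _ _] := smooth_stepP dw; exact: h. Qed.
Lemma is_derive_decay_root t : is_derive t 1 decay_root (decay_root' t).
Proof. exact/smooth_is_derive1/smooth_decay_root. Qed.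
Lemma is_derive_ending t : is_derive t 1 ending (ending' t).
Proof. by have [_ h _ _ _] := smooth_stepP ew; exact: h. Qed.

Lemma decay_itv t : 0 <= decay t <= 1.
Proof. by have [_ _ h _ _] := smooth_stepP dw; exact: h. Qed.
Lemma ending_itv t : 0 <= ending t <= 1.
Proof. by have [_ _ h _ _] := smooth_stepP ew; exact: h. Qed.

Lemma decay_before t : t <= tau / 2 -> decay t = 0.
Proof. by have [_ _ _ [h _] _] := smooth_stepP dw; exact: h. Qed.
Lemma decay_after t : 5 / 8 * tau <= t -> decay t = 1.
Proof. by have [_ _ _ [_ h] _] := smooth_stepP dw; exact: h. Qed.
Lemma ending_before t : t <= 5 / 8 * tau -> ending t = 0.
Proof. by have [_ _ _ [h _] _] := smooth_stepP ew; exact: h. Qed.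
Lemma ending_after t : 3 / 4 * tau <= t -> ending t = 1.
Proof. by have [_ _ _ [_ h] _] := smooth_stepP ew; exact: h. Qed.

Lemma decay_root_active t : decay_root t != 0 -> tau / 2 < t < 5 / 8 * tau.
Proof.
have [_ _ _ _ r0] := smooth_stepP dw.
by move=> h; rewrite !ltNge; apply/andP; split; apply: contraNN h => h; apply/eqP/r0;
  [left | right].
Qed.

Lemma ending'_active t : ending' t != 0 -> 5 / 8 * tau < t < 3 / 4 * tau.
Proof.
have [_ _ _ _ r0] := smooth_stepP ew.
by move=> h; rewrite !ltNge; apply/andP; split; apply: contraNN h => h; apply/eqP;
  rewrite /ending' r0 ?expr0n //; [left | right].
Qed.

Lemma final_bounds : exists2 M, 1 <= M & forall t,
  [/\ `|decay_root t| <= M, `|decay_root' t| <= M & `|ending' t| <= M].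
Proof.
have [_ _ _ _ r0] := smooth_stepP dw.
have [[_ se] _ _ _ e0] := smooth_stepP ew.
have [M1 M11 H1] := bounded_of_support (ltW dw) (smooth_continuous smooth_decay_root)
  (fun t h => r0 t (match h with or_introl h => or_introl (ltW h) | or_intror h => or_intror (ltW h) end)).
have [M2 M21 H2] := bounded_of_support (ltW dw)
  (smooth_continuous (smooth_derive (1 : R) smooth_decay_root))
  (derive_vanish smooth_decay_root r0).
have e0' t : t < 5 / 8 * tau \/ 3 / 4 * tau < t -> ending' t = 0.
  by move=> h; rewrite /ending' e0 ?expr0n //; case: h => /ltW; [left | right].
have [M3 M31 H3] := bounded_of_support (ltW ew) (smooth_continuous (smoothX 2 se)) e0'.
exists (Num.max M1 (Num.max M2 M3)); first by rewrite le_max M11.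
by move=> t; split; [rewrite le_max H1 | rewrite !le_max H2 !orbT | rewrite !le_max H3 !orbT].
Qed.

End Schedule.

(** * The inviscid cascade *)

Section Cascade.
Context {R : realType}.
Local Notation V3 := (R * R * R)%type.
Local Notation I := (torus_Rintegral _).
Implicit Types (t u v : R) (x : V3) (q : nat).
Variables (l tau amplitude : R) (k : nat -> nat) (d : nat -> R).
Hypotheses (l0 : 0 < l) (tau0 : 0 < tau) (amp0 : 0 < amplitude).
Hypotheses (k0 : (0 < k 0)%N) (kS : forall q, (k q < k q.+1)%N) (d0 : forall q, 0 < d q).

(** The wave of stage [q] has this wavenumber along the shear and, across it, that of
    the preceding wave. A shear by the angle [shear_wavenumber q * v] turns this
    phase into that of stage [q.+1], with the two directions exchanged; the sawtooth
    is a bounded substitute for that angle. *)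
Definition wavenumber q : R := pi *+ 2 / l * (k q)%:R.
Definition cross_wavenumber q : R := if q is p.+1 then wavenumber p else 0.
Definition shear_wavenumber q : R := wavenumber q.+1 - cross_wavenumber q.

Definition shear q v : R := saw (d q) (shear_wavenumber q * v).
Definition shear' q : R -> R := 'D_1 (shear q).
Definition shear'' q : R -> R := 'D_1 (shear' q).

(** Over the stage the shear displaces by [- shear q / wavenumber q], which adds
    [shear q] to the phase of the transported wave. *)
Definition shear_rate q t : R := - (wavenumber q)^-1 * stage' tau q.*2.+1 t.
Definition shear_rate' q t : R := - (wavenumber q)^-1 * stage'' tau q.*2.+1 t.

Definition weight q t : R := amplitude * (stage tau q.*2 t - stage tau q.+1.*2 t).
Definition weight' q t : R := amplitude * (stage' tau q.*2 t - stage' tau q.+1.*2 t).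

Definition plane_wave q x : R :=
  cos (wavenumber q * coord (odd q) x + cross_wavenumber q * coord (~~ odd q) x).
Definition sheared_wave q x : R :=
  cos (wavenumber q * coord (odd q) x + cross_wavenumber q * coord (~~ odd q) x
       + shear q (coord (~~ odd q) x)).
(** What the force has to supply at the beginning of stage [q]: the difference between
    the plane wave of that stage and the sheared wave left by the preceding one. *)
Definition mismatch q x : R :=
  plane_wave q x - (if q is p.+1 then sheared_wave p x else 0).

Definition vertical_force q t x : R := amplitude * stage' tau q.*2 t * mismatch q x.
Definition horizontal_force q b t x : R :=
  if odd q == b then shear_rate' q t * shear q (coord (~~ b) x) else 0.
Definition force_term q t x : 'rV[R]_3 :=
  \row_i (if i == dir false then horizontal_force q false t x
          else if i == dir true then horizontal_force q true t x
          else vertical_force q t x).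

Lemma unit_wavenumber_gt0 : 0 < pi *+ 2 / l :> R.
Proof. by rewrite divr_gt0 // mulrn_wgt0 // pi_gt0. Qed.

Lemma wavenumber_gt0 q : 0 < wavenumber q.
Proof.
rewrite /wavenumber mulr_gt0 ?unit_wavenumber_gt0 // ltr0n.
by elim: q => // q IH; exact: leq_trans (kS q).
Qed.

Lemma cross_wavenumber_ge0 q : 0 <= cross_wavenumber q.
Proof. by case: q => //= q; exact/ltW/wavenumber_gt0. Qed.

Lemma wavenumber_lt q : wavenumber q < wavenumber q.+1.
Proof. by rewrite /wavenumber ltr_pM2l ?ltr_nat // unit_wavenumber_gt0. Qed.

Lemma shear_wavenumber_gt0 q : 0 < shear_wavenumber q.
Proof.
rewrite /shear_wavenumber subr_gt0; case: q => [|q] /=; first exact: wavenumber_gt0.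
exact: lt_trans (wavenumber_lt _) (wavenumber_lt _).
Qed.

(** The integrality of [k q] makes all waves periodic on the torus. *)
Lemma wavenumber_period q : exists n : nat, wavenumber q * l = pi *+ 2 *+ n.
Proof.
exists (k q); rewrite /wavenumber mulrAC divfK ?gt_eqF //.
by rewrite mulr_natr.
Qed.

Lemma cross_wavenumber_period q : exists n : nat, cross_wavenumber q * l = pi *+ 2 *+ n.
Proof.
case: q => [|q] /=; last exact: wavenumber_period.
by exists 0%N; rewrite mul0r.
Qed.

Lemma shear_wavenumber_period q : exists n : nat, shear_wavenumber q * l = pi *+ 2 *+ n.
Proof.
rewrite /shear_wavenumber.
have [kp kpk ->] : exists2 kp, (kp <= k q.+1)%N & cross_wavenumber q = pi *+ 2 / l * kp%:R.
  case: q => [|p] /=; first by exists 0%N; rewrite ?mulr0.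
  by exists (k p) => //; exact: leq_trans (ltnW (kS _)) (ltnW (kS _)).
exists (k q.+1 - kp)%N.
rewrite /wavenumber -mulrBr -natrB // mulrAC divfK ?gt_eqF //.
by rewrite mulr_natr.
Qed.

Lemma periodic_mul (g : R -> R) (m : R) : (forall y, g (y + pi *+ 2) = g y) ->
  (exists n : nat, m * l = pi *+ 2 *+ n) -> forall v, g (m * (v + l)) = g (m * v).
Proof.
move=> pg [n E] v; rewrite mulrDr E.
elim: n {E} => [|n IH]; first by rewrite mulr0n addr0.
by rewrite mulrSr addrA pg IH.
Qed.

Lemma shear_periodic q v : shear q (v + l) = shear q v.
Proof.
exact: (periodic_mul (@saw_periodic _ (d q)) (shear_wavenumber_period q)).
Qed.

Lemma smooth_shear q : smooth (shear q).
Proof.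
by apply: smooth_comp; [exact: smooth_saw | apply: smoothZ; exact: smooth_id].
Qed.

Lemma smooth_shear' q : smooth (shear' q).
Proof. exact/smooth_derive/smooth_shear. Qed.

Lemma smooth_shear'' q : smooth (shear'' q).
Proof. exact/smooth_derive/smooth_shear'. Qed.

Lemma is_derive_shear_profile q v : is_derive v 1 (shear q) (shear' q v).
Proof. exact/smooth_is_derive1/smooth_shear. Qed.

Lemma is_derive_shear_profile' q v : is_derive v 1 (shear' q) (shear'' q v).
Proof. exact/smooth_is_derive1/smooth_shear'. Qed.

Lemma shear_bound q v : `|shear q v| <= 2 * pi.
Proof. exact: saw_bound. Qed.

Lemma derive_periodic (g : R -> R) : (forall v, g (v + l) = g v) ->
  forall v, 'D_1 g (v + l) = 'D_1 g v.
Proof.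
move=> pg v; have E : (fun z => g (z + l)) = g by apply/funext.
by rewrite -[LHS](derive_translate g) E.
Qed.

Lemma shear_derivative_bounds q : exists2 M, 0 <= M &
  forall v, `|shear' q v| <= M /\ `|shear'' q v| <= M.
Proof.
have p1 := derive_periodic (shear_periodic q).
have [M1 H1] := continuous_periodic_bounded l0 (smooth_continuous (smooth_shear' q)) p1.
have [M2 H2] := continuous_periodic_bounded l0 (smooth_continuous (smooth_shear'' q))
  (derive_periodic p1).
exists (Num.max M1 M2); last by move=> v; split; [rewrite le_max H1 | rewrite le_max H2 orbT].
by rewrite le_max (le_trans _ (H1 0)).
Qed.

(** Both waves are cosines, of angles that differ by [y - saw y]. The squared distance
    of the corresponding points of the circle is [2 (1 - cos (y - saw y))], bounded
    by [2 d (1 - saw' y)], and [saw'] has mean zero. *)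
Lemma mismatch_mean_square q : torus_Rintegral l (fun x => mismatch q.+1 x ^+ 2) <= 2 * d q * l ^+ 3.
Proof.
set b := odd q; set M := shear_wavenumber q.
have M0 : 0 < M := shear_wavenumber_gt0 q.
have cS : continuous (fun v => 'D_1 (saw (d q)) (M * v)).
  have cM : continuous (fun v => M * v).
    by move=> v; apply: cvgM; [exact: cvg_cst | exact: cvg_id].
  exact: (continuous_compose cM (smooth_continuous (smooth_derive (1 : R) (smooth_saw (d0 q))))).
have cD : continuous (fun x : V3 => 'D_1 (saw (d q)) (M * coord (~~ b) x)).
  exact: continuous_compose (@continuous_coord R (~~ b)) cS.
have zero : torus_Rintegral l (fun x => 'D_1 (saw (d q)) (M * coord (~~ b) x)) = 0.
  have := @torus_int_derive R l l0 (~~ b) (fun u _ => M^-1 * shear q u)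
    (fun u _ => 'D_1 (saw (d q)) (M * u)).
  apply=> [u v||u v]; last by rewrite shear_periodic.
  - have dM : is_derive u 1 (fun u => M * u) M.
      by have := is_derive_mulc M (is_derive_id u 1); rewrite mulr1.
    have := is_derive_mulc M^-1 (is_derive_comp dM (smooth_is_derive1 (M * u) (smooth_saw (d0 q)))).
    by move/is_derive_eq; apply; rewrite mulrCA mulVf ?mulr1 // gt_eqF.
  - exact: (continuous_compose (f := fst)) (fun p => cvg_fst) cS.
have cco c : continuous (fun x : V3 => coord c x) by exact: continuous_coord.
have cmul (m : R) (g : V3 -> R) : continuous g -> continuous (fun x => m * g x).
  by move=> cg x; apply: cvgM; [exact: cvg_cst | exact: cg].
have cadd (g h : V3 -> R) : continuous g -> continuous h -> continuous (fun x => g x + h x).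
  by move=> cg ch x; apply: cvgD; [exact: cg | exact: ch].
have ccos (g : V3 -> R) : continuous g -> continuous (fun x => cos (g x)).
  by move=> cg; apply: continuous_compose cg _; exact: continuous_cos.
have csub (g h : V3 -> R) : continuous g -> continuous h -> continuous (fun x => g x - h x).
  by move=> cg ch x; apply: cvgB; [exact: cg | exact: ch].
have cxi p : continuous (fun x : V3 => wavenumber p * coord (odd p) x
    + cross_wavenumber p * coord (~~ odd p) x).
  exact: cadd (cmul _ _ (cco _)) (cmul _ _ (cco _)).
have csh : continuous (fun x : V3 => shear q (coord (~~ odd q) x)).
  exact: continuous_compose (cco _) (smooth_continuous (smooth_shear q)).
have cmis : continuous (mismatch q.+1).
  exact: csub (ccos _ (cxi q.+1)) (ccos _ (cadd _ _ (cxi q) csh)).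
have -> : 2 * d q * l ^+ 3 =
    torus_Rintegral l (fun x => 2 * d q + (- (2 * d q)) * 'D_1 (saw (d q)) (M * coord (~~ b) x)).
  rewrite torus_intD //; [|by move=> x; exact: cvg_cst | exact: cmul].
  by rewrite torus_int_cst // [X in _ + X]torus_intZ // zero mulr0 addr0.
apply: le_torus_int => //.
- exact: continuous_sq.
- by apply: cadd; [move=> x; exact: cvg_cst | exact: cmul].
move=> x _; rewrite /mismatch /plane_wave /sheared_wave.
set a := cos _; set c := cos _.
set y := M * coord (~~ b) x.
pose D := 'D_1 (saw (d q)) y.
have hd : 1 - cos (y - saw (d q) y) <= d q * (1 - D) := saw_defect (d0 q) y.
rewrite -/D.
set X := wavenumber q * coord (odd q) x + cross_wavenumber q * coord (~~ odd q) x.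
have aE : a = cos (X + y).
  rewrite /a /= negbK /X /y /M /shear_wavenumber; congr cos; ring.
have cE : c = cos (X + saw (d q) y) by [].
have := sqr_ge0 (sin (X + y) - sin (X + saw (d q) y)).
have e1 := cos2Dsin2 (X + y); have e2 := cos2Dsin2 (X + saw (d q) y).
(* the difference of the angles [X + y] and [X + saw y] *)
have e3 : cos (y - saw (d q) y) = cos (X + y) * cos (X + saw (d q) y) +
    sin (X + y) * sin (X + saw (d q) y).
  by rewrite -cosB; congr cos; ring.
move: hd; rewrite e3 aE cE; move: e1 e2.
move: (cos (X + y)) (cos (X + saw (d q) y)) (sin (X + y)) (sin (X + saw (d q) y)) => c1 c2 s1 s2.
move=> e1 e2 hd' hs; lra.
Qed.

End Cascade.

(** * The forces of the cascade *)

Section CascadeForce.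
Context {R : realType}.
Local Notation V3 := (R * R * R)%type.
Implicit Types (t u v : R) (x : V3) (q r : nat).
Variables (l tau amplitude : R) (k : nat -> nat) (d : nat -> R).
Hypotheses (l0 : 0 < l) (tau0 : 0 < tau) (amp0 : 0 < amplitude).
Hypotheses (k0 : (0 < k 0)%N) (kS : forall q, (k q < k q.+1)%N) (d0 : forall q, 0 < d q).

Local Notation A := (wavenumber l k).
Local Notation B := (cross_wavenumber l k).
Local Notation s := (shear l k d).
Local Notation rate := (shear_rate l tau k).
Local Notation rate' := (shear_rate' l tau k).
Local Notation wgt := (weight tau amplitude).
Local Notation wgt' := (weight' tau amplitude).
Local Notation T := (stage_time tau).
Local Notation force := (force_term l tau amplitude k d).
Local Notation fv := (vertical_force l tau amplitude k d).
Local Notation fh := (horizontal_force l tau k d).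

Definition active q t : bool := T q.*2 < t < T q.+1.*2.

Lemma stage_time_inj_active q r t : active q t -> active r t -> q = r.
Proof.
move=> /andP[q1 q2] /andP[r1 r2]; apply/eqP; rewrite eqn_leq; apply/andP; split.
  rewrite leqNgt; apply/negP => rq; move: (lt_trans q1 r2).
  by rewrite ltNge stage_time_le // leq_double.
rewrite leqNgt; apply/negP => rq; move: (lt_trans r1 q2).
by rewrite ltNge stage_time_le // leq_double.
Qed.

Lemma rate_support q t : rate q t != 0 -> T q.*2.+1 < t < T q.+1.*2.
Proof.
rewrite /shear_rate mulf_eq0 => /norP[_] /(stage'_active tau0).
by rewrite doubleS.
Qed.

Lemma rate'_support q t : rate' q t != 0 -> T q.*2.+1 < t < T q.+1.*2.
Proof.
rewrite /shear_rate' mulf_eq0 => /norP[_] /(stage''_active tau0).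
by rewrite doubleS.
Qed.

Lemma weight_support q t : wgt q t != 0 -> T q.*2 < t < T q.+1.*2.+1.
Proof.
move=> h; rewrite !ltNge; apply/andP; split; apply: contraNN h => h.
  rewrite /weight !stage_before ?subrr ?mulr0 //.
  by apply: (le_trans h); rewrite stage_time_le // leq_double.
rewrite /weight !stage_after ?subrr ?mulr0 //.
by apply: le_trans h; rewrite stage_time_le // ltnS leq_double.
Qed.

Lemma rate_rate0 q r t : q != r -> rate q t * rate r t = 0.
Proof.
move=> qr; apply/eqP; rewrite mulf_eq0; apply: contraNT qr => /norP[/rate_support hq /rate_support hr].
apply/eqP; apply: (@stage_time_inj_active q r t); rewrite /active.
  by case/andP: hq => h ->; rewrite andbT (le_lt_trans _ h) // stage_time_le.
by case/andP: hr => h ->; rewrite andbT (le_lt_trans _ h) // stage_time_le.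
Qed.

Lemma rate_weight0 q r t : q != r -> rate q t * wgt r t = 0.
Proof.
move=> qr; apply/eqP; rewrite mulf_eq0.
apply: contraNT qr => /norP[/rate_support/andP[q1 q2] /weight_support/andP[r1 r2]].
rewrite eqn_leq; apply/andP; split; rewrite leqNgt; apply/negP => h.
  move: (lt_trans q1 r2); rewrite ltNge stage_time_le //.
  by rewrite ltnS leq_double.
move: (lt_trans r1 q2); rewrite ltNge stage_time_le //.
by rewrite leq_double.
Qed.

Lemma vertical_inactive q t x : ~~ active q t -> fv q t x = 0.
Proof.
move=> na; rewrite /vertical_force; suff -> : stage' tau q.*2 t = 0 by rewrite mulr0 mul0r.
apply/eqP; apply: contraNT na => /(stage'_active tau0)/andP[h1 h2].
by rewrite /active h1 (lt_le_trans h2) // stage_time_le // doubleS.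
Qed.

Lemma horizontal_inactive q b t x : ~~ active q t -> fh q b t x = 0.
Proof.
move=> na; rewrite /horizontal_force; case: eqP => // _.
suff -> : rate' q t = 0 by rewrite mul0r.
apply/eqP; apply: contraNT na => /rate'_support/andP[h1 h2].
by rewrite /active h2 andbT (le_lt_trans _ h1) // stage_time_le.
Qed.

Lemma force_inactive q t x i : ~~ active q t -> force q t x 0 i = 0.
Proof.
move=> na; rewrite mxE !horizontal_inactive // vertical_inactive //.
by do 2?case: ifP.
Qed.

(** At each time at most one stage is active, so the infinite sum of the stage
    forces reduces to one term. *)
Definition active_stage t : nat := xget 0%N [set q | active q t].
Definition limit_force t x : 'rV[R]_3 := force (active_stage t) t x.

Lemma active_stageE q t : active q t -> active_stage t = q.
Proof.
move=> aq; rewrite /active_stage; case: xgetP => [r _ ar|/(_ q)//].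
exact: stage_time_inj_active ar aq.
Qed.

Lemma sum_force j t x i : \sum_(q < j) force q t x 0 i =
  if (active_stage t < j)%N then limit_force t x 0 i else 0.
Proof.
case: ifPn => [lt|ge].
  rewrite (bigD1 (Ordinal lt)) //= big1 ?addr0 // => q qa.
  apply: force_inactive; apply: contraNN qa => /active_stageE E.
  by apply/eqP/val_inj; rewrite /= E.
rewrite big1 // => q _; apply: force_inactive; apply: contraNN ge => /active_stageE ->.
exact: ltn_ord.
Qed.

(** In the derivative of the blended wave the end of each stage meets the beginning of
    the next one, which leaves the mismatches. The weights vary only while the
    shears are at rest, so that the phases take their initial or final values. *)
Lemma weight_telescope j t x :
  \sum_(q < j) wgt' q t * cos (wave_phase (stage tau q.*2.+1) (s q) (A q) (B q)
      t (coord (odd q) x) (coord (~~ odd q) x))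
  + amplitude * stage' tau j.*2 t * plane_wave l k j x = \sum_(q < j.+1) fv q t x.
Proof.
elim: j => [|j IH].
  rewrite big_ord0 add0r big_ord_recr big_ord0 /= add0r.
  by rewrite /vertical_force /mismatch subr0.
rewrite big_ord_recr /= [RHS]big_ord_recr /= -IH -!addrA; congr (_ + _).
rewrite /vertical_force /mismatch /weight' mulrBr.
set c := cos _; set P := plane_wave _ _ j x; set Q := plane_wave _ _ _ x.
(* while the wave is introduced its shear has not started *)
have e1 : stage' tau j.*2 t * c = stage' tau j.*2 t * P.
  have [->|/(stage'_active tau0)/andP[_ h]] := eqVneq (stage' tau j.*2 t) 0.
    by rewrite !mul0r.
  by rewrite /c /wave_phase stage_before ?(ltW h) // mul0r addr0.
(* while the wave is replaced its shear has ended *)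
have e2 : stage' tau j.+1.*2 t * c = stage' tau j.+1.*2 t * sheared_wave l k d j x.
  have [->|/(stage'_active tau0)/andP[h _]] := eqVneq (stage' tau j.+1.*2 t) 0.
    by rewrite !mul0r.
  by rewrite /c /wave_phase stage_after ?mul1r // -doubleS ltW.
rewrite mulrBl -mulrA e1 -[X in _ - X]mulrA e2; ring.
Qed.

(** The shear rate is chosen for the advection to cancel the time derivative of the
    phase; what is left comes from the weight. *)
Lemma cascade_transport q t u v :
  wave_t (wgt q) (wgt' q) (stage tau q.*2.+1) (stage' tau q.*2.+1) (s q) (A q) (B q) t u v
  + rate q t * s q v * wave_u (wgt q) (stage tau q.*2.+1) (s q) (A q) (B q) t u v
  = wgt' q t * cos (wave_phase (stage tau q.*2.+1) (s q) (A q) (B q) t u v).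
Proof.
rewrite /wave_t /wave_u /shear_rate; field.
by rewrite gt_eqF // wavenumber_gt0.
Qed.

Variable (C : nat -> R).
Hypothesis C1 : forall n, 1 <= C n.
Hypothesis HC : forall n t, `|stage' tau n t| <= C n /\ `|stage'' tau n t| <= C n.
Hypothesis Abig : forall q, 2 * pi * C q.*2.+1 * q.+1%:R <= A q.
Hypothesis dsmall : forall q,
  2 * d q * (amplitude * C q.+1.*2) ^+ 2 * l ^+ 3 * q.+1%:R <= 1.

Lemma horizontal_bound q b t x : `|fh q b t x| <= q.+1%:R^-1.
Proof.
rewrite /horizontal_force; case: eqP => _; last by rewrite normr0 invr_ge0.
have A0 : 0 < A q by apply: wavenumber_gt0.
rewrite /shear_rate' !normrM normrN normfV (gtr0_norm A0).
rewrite -mulrA ler_pdivrMl // -ler_pdivrMr ?invr_gt0 // invrK.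
apply: le_trans (Abig q); rewrite ler_pM2r //.
rewrite [X in _ <= X]mulrC; apply: ler_pM => //; first by have [] := HC q.*2.+1 t.
exact: shear_bound.
Qed.

Lemma continuous_mismatch q : continuous (mismatch l k d q).
Proof.
have cco c : continuous (fun x : V3 => coord c x) by exact: continuous_coord.
have cmul (m : R) (g : V3 -> R) : continuous g -> continuous (fun x => m * g x).
  by move=> cg x; apply: cvgM; [exact: cvg_cst | exact: cg].
have cadd (g h : V3 -> R) : continuous g -> continuous h -> continuous (fun x => g x + h x).
  by move=> cg ch x; apply: cvgD; [exact: cg | exact: ch].
have csub (g h : V3 -> R) : continuous g -> continuous h -> continuous (fun x => g x - h x).
  by move=> cg ch x; apply: cvgB; [exact: cg | exact: ch].
have ccos (g : V3 -> R) : continuous g -> continuous (fun x => cos (g x)).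
  by move=> cg; apply: continuous_compose cg _; exact: continuous_cos.
have cxi p : continuous (fun x : V3 => A p * coord (odd p) x + B p * coord (~~ odd p) x).
  exact: cadd (cmul _ _ (cco _)) (cmul _ _ (cco _)).
have cpw p : continuous (plane_wave l k p) := ccos _ (cxi p).
case: q => [|q]; first exact: csub (cpw 0%N) (fun x => cvg_cst (0 : R)).
have csh : continuous (fun x : V3 => s q (coord (~~ odd q) x)).
  exact: continuous_compose (cco _) (smooth_continuous (smooth_shear l k d0 q)).
exact: csub (ccos _ (cxi q.+1)) (ccos _ (cadd _ _ (cxi q) csh)).
Qed.

Lemma continuous_force q t : continuous_field (force q t).
Proof.
have ch b : continuous (fun x => fh q b t x).
  rewrite /horizontal_force; case: eqP => _; last by move=> x; exact: cvg_cst.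
  move=> x; apply: cvgM; first exact: cvg_cst.
  exact: continuous_compose (@continuous_coord R (~~ b)) (smooth_continuous (smooth_shear l k d0 q)) x.
move=> i; rewrite (_ : (fun x => _) = fun x => if i == dir false then fh q false t x
          else if i == dir true then fh q true t x else fv q t x); last first.
  by apply/funext => x; rewrite mxE.
case: (i == dir false); first exact: ch.
case: (i == dir true); first exact: ch.
by move=> x; apply: cvgM; [exact: cvg_cst | exact: continuous_mismatch].
Qed.

Lemma coordD b (i : 'I_3) x : coord b (x + l *: basis3 i) = coord b x + l * (i == dir b)%:R.
Proof. by rewrite addrC coord_line addrC. Qed.

Lemma coord_periodic (g : R -> R) b : (forall v, g (v + l) = g v) ->
  torus_periodic l (fun x : V3 => g (coord b x)).
Proof. by move=> pg i x; rewrite coordD; case: eqP => _; rewrite ?mulr1 ?mulr0 ?addr0. Qed.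

(** All wavenumbers are multiples of [2 pi / l], so translating either coordinate by [l]
    adds a multiple of [2 pi] to the phase. *)
Lemma phase_shift (g : R -> R) q u v w (m n : bool) : (forall y, g (y + pi *+ 2) = g y) ->
  g (A q * (u + l * m%:R) + B q * (v + l * n%:R) + w) = g (A q * u + B q * v + w).
Proof.
move=> pg.
have pgw z y : g (y + pi *+ 2 + z) = g (y + z) by rewrite addrAC pg.
have gA z u' : g (A q * (u' + l) + z) = g (A q * u' + z).
  exact: (periodic_mul (pgw z) (wavenumber_period k l0 q)).
have gB z v' : g (B q * (v' + l) + z) = g (B q * v' + z).
  exact: (periodic_mul (pgw z) (cross_wavenumber_period k l0 q)).
have -> : g (A q * (u + l * m%:R) + B q * (v + l * n%:R) + w) =
    g (A q * u + (B q * (v + l * n%:R) + w)).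
  by rewrite -addrA; case: m; rewrite ?mulr1 ?gA // mulr0 addr0.
rewrite addrCA -addrA.
by case: n; rewrite ?mulr1 ?gB ?mulr0 ?addr0; congr g; ring.
Qed.

Lemma plane_wave_periodic q : torus_periodic l (plane_wave l k q).
Proof.
move=> i x; rewrite /plane_wave !coordD.
by have := phase_shift q (coord (odd q) x) (coord (~~ odd q) x) 0 (i == dir (odd q))
  (i == dir (~~ odd q)) (@cosD2pi R); rewrite !addr0.
Qed.

Lemma sheared_wave_periodic q : torus_periodic l (sheared_wave l k d q).
Proof.
move=> i x; rewrite /sheared_wave.
rewrite (coord_periodic (~~ odd q) (shear_periodic d l0 kS q) i x) !coordD.
exact: phase_shift (@cosD2pi R).
Qed.

Lemma force_periodic q t : torus_periodic l (force q t).
Proof.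
have ph b i x : fh q b t (x + l *: basis3 i) = fh q b t x.
  rewrite /horizontal_force; case: eqP => // _.
  by rewrite (coord_periodic (~~ b) (shear_periodic d l0 kS q) i x).
have pv i x : fv q t (x + l *: basis3 i) = fv q t x.
  rewrite /vertical_force /mismatch plane_wave_periodic; case: (q) => // p.
  by rewrite sheared_wave_periodic.
by move=> i x; apply/rowP => m; rewrite !mxE !ph pv.
Qed.

(** The forces of the late stages are uniformly small: the horizontal ones
    because the shears have small amplitude, the vertical ones because the
    sheared wave almost coincides with the next plane wave. *)
Lemma force_small q t :
  torus_Rintegral l (sqnorm (force q.+1 t)) <= (l ^+ 3 + 1) * q.+1%:R^-1.
Proof.
have cv : continuous (fv q.+1 t).
  by move=> x; apply: cvgM; [exact: cvg_cst | exact: continuous_mismatch].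
have i0 : 0 <= q.+1%:R^-1 :> R by rewrite invr_ge0.
have i1 : q.+1%:R^-1 <= 1 :> R by rewrite invf_le1 ?ler1n // ltr0n.
have hsq b x : fh q.+1 b t x ^+ 2 <= q.+1%:R^-1.
  rewrite -real_normK ?num_real //.
  have h : `|fh q.+1 b t x| <= q.+1%:R^-1.
    apply: le_trans (horizontal_bound _ _ _ _) _.
    by rewrite lef_pV2 ?posrE ?ltr0n // ler_nat.
  rewrite expr2; apply: le_trans (ler_pM _ _ h h) _ => //.
  by rewrite -[X in _ <= X]mulr1 ler_wpM2l.
have sq x : sqnorm (force q.+1 t) x <= q.+1%:R^-1 + fv q.+1 t x ^+ 2.
  have -> : sqnorm (force q.+1 t) x =
      fh q.+1 false t x ^+ 2 + fh q.+1 true t x ^+ 2 + fv q.+1 t x ^+ 2.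
    by rewrite /sqnorm sum_ord3 !mxE !dir_eq !dir_max.
  rewrite lerD2r.
  have z b : odd q.+1 != b -> fh q.+1 b t x = 0.
    by move=> /negbTE h; rewrite /horizontal_force h.
  have [oq|oq] := boolP (odd q.+1).
    by rewrite (z false) ?oq // expr0n add0r; exact: hsq.
  by rewrite (z true) ?(negbTE oq) // expr0n addr0; exact: hsq.
have cm2 : continuous (fun x => mismatch l k d q.+1 x ^+ 2).
  by apply: continuous_sq; exact: continuous_mismatch.
have cv2 : continuous (fun x => fv q.+1 t x ^+ 2) by exact: continuous_sq.
have e1 : torus_Rintegral l (fun x => fv q.+1 t x ^+ 2) <= q.+1%:R^-1.
  rewrite (_ : (fun x => _) = fun x => (amplitude * stage' tau q.+1.*2 t) ^+ 2 * mismatch l k d q.+1 x ^+ 2);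
    last by apply/funext => x; rewrite /vertical_force exprMn.
  rewrite torus_intZ //.
  have m2 := mismatch_mean_square l0 k0 kS d0 q.
  have m0 : 0 <= torus_Rintegral l (fun x => mismatch l k d q.+1 x ^+ 2).
    by apply: torus_int_ge0 => x; exact: sqr_ge0.
  have c2 : (amplitude * stage' tau q.+1.*2 t) ^+ 2 <= (amplitude * C q.+1.*2) ^+ 2.
    rewrite !exprMn ler_pM2l ?exprn_gt0 // -[X in X <= _]real_normK ?num_real //.
    have [h1 _] := HC q.+1.*2 t.
    apply: lerXn2r => //; rewrite nnegrE //; exact: le_trans ler01 (C1 _).
  apply: (le_trans (ler_pM _ _ c2 m2)) => //; first exact: sqr_ge0.
  rewrite -[X in _ <= X]mul1r ler_pdivlMr ?ltr0n //.
  by apply: le_trans (dsmall q); rewrite le_eqVlt; apply/orP; left; apply/eqP; ring.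
have ci : continuous (fun _ : V3 => q.+1%:R^-1 : R) by move=> x; exact: cvg_cst.
apply: (@le_trans _ _ (torus_Rintegral l (fun x => q.+1%:R^-1 + fv q.+1 t x ^+ 2))).
  apply: le_torus_int => //; first by apply: continuous_sqnorm; exact: continuous_force.
  by move=> x; apply: cvgD; [exact: ci | exact: cv2].
rewrite torus_intD // torus_int_cst // mulrDl mul1r [l ^+ 3 * _]mulrC.
by rewrite lerD2l.
Qed.


End CascadeForce.

(** * The flow with finitely many stages *)

Section SmoothAtoms.
Context {R : realType}.
Local Notation V3 := (R * R * R)%type.
Local Notation V4 := (R * V3)%type.

Lemma smooth_time : smooth (fun z : V4 => z.1).
Proof.
have c : continuous (fun z : V4 => z.1) by move=> z; exact: cvg_fst.
by have [] := smooth_linear c (fun t x y => erefl).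
Qed.

Lemma smooth_coord b : smooth (fun z : V4 => coord b z.2).
Proof.
have c : continuous (fun z : V4 => coord b z.2).
  by apply: (continuous_compose (f := snd)) (@continuous_coord R b) => z; exact: cvg_snd.
have lin (t : R) (x y : V4) : coord b (t *: x + y).2 = t * coord b x.2 + coord b y.2.
  by rewrite /coord; case: b {c}.
by have [] := smooth_linear c lin.
Qed.

Lemma smooth_of_time (g : R -> R) : smooth g -> smooth (fun z : V4 => g z.1).
Proof. by move=> sg; exact: smooth_comp sg smooth_time. Qed.

Lemma smooth_of_coord (g : R -> R) b : smooth g -> smooth (fun z : V4 => g (coord b z.2)).
Proof. by move=> sg; exact: smooth_comp sg (smooth_coord b). Qed.

Lemma smooth_wave (w phi S : R -> R) (A B : R) b : smooth w -> smooth phi -> smooth S ->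
  smooth (fun z : V4 => wave w phi S A B z.1 (coord b z.2) (coord (~~ b) z.2)).
Proof.
move=> sw sp sS; apply: smoothM; first exact: smooth_of_time.
apply: (smooth_comp smooth_cos); apply: smoothD.
  by apply: smoothD; apply: smoothZ; exact: smooth_coord.
by apply: smoothM; [exact: smooth_of_time | exact: smooth_of_coord].
Qed.

Lemma smooth_packet (g e : R -> R) (A B kappa : R) b : smooth g -> smooth e ->
  smooth (fun z : V4 => packet g e A B kappa z.1 (coord b z.2) (coord (~~ b) z.2)).
Proof.
move=> sg se.
have sxi : smooth (fun z : V4 => A * coord b z.2 + B * coord (~~ b) z.2).
  by apply: smoothD; apply: smoothZ; exact: smooth_coord.
have sm (m : R) : smooth (fun y : R => m * y) by apply: smoothZ; exact: smooth_id.
have st : smooth (fun z : V4 => e z.1) by exact: smooth_of_time.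
have s8 : smooth (fun _ : V4 => 8^-1 : R) by exact: smooth_cst.
have scx := smooth_comp smooth_cos sxi; have ssx := smooth_comp smooth_sin sxi.
apply: smoothM; first exact: smooth_of_time.
apply: smoothD; first apply: smoothD => //.
  apply: smoothM => //; apply: smoothM => //.
  exact: smooth_of_coord (smooth_comp smooth_sin (sm kappa)).
apply: smoothM => //; apply: smoothM; first by apply: smoothM => //; exact: smoothX.
exact: smooth_of_coord (smooth_comp smooth_cos (sm (2 * kappa))).
Qed.

End SmoothAtoms.

Section Flow.
Context {R : realType}.
Local Notation V3 := (R * R * R)%type.
Local Notation V4 := (R * V3)%type.
Implicit Types (t u v : R) (x : V3) (q r : nat).
Variables (l tau amplitude : R) (k : nat -> nat) (d : nat -> R).
Hypotheses (l0 : 0 < l) (tau0 : 0 < tau) (amp0 : 0 < amplitude).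
Hypotheses (k0 : (0 < k 0)%N) (kS : forall q, (k q < k q.+1)%N) (d0 : forall q, 0 < d q).
Variables (j : nat) (kappa mean : R).
Hypotheses (kappa0 : 0 < kappa) (kappal : exists n : nat, kappa * l = pi *+ 2 *+ n).

Local Notation A := (wavenumber l k).
Local Notation B := (cross_wavenumber l k).
Local Notation s := (shear l k d).
Local Notation rate := (shear_rate l tau k).
Local Notation rate' := (shear_rate' l tau k).
Local Notation wgt := (weight tau amplitude).
Local Notation wgt' := (weight' tau amplitude).
Local Notation T := (stage_time tau).
Local Notation phi q := (stage tau q.*2.+1).
Local Notation phi' q := (stage' tau q.*2.+1).

(** The eddy damping has rate [2 * rank ^+ 2] and the response has relative size
    [rank ^- 3]: the first must tend to infinity for the wave to disappear, and
    their product to zero for the expansion of the packet to be accurate. *)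
Definition rank : R := j.+1%:R.
Definition response : R := rank ^- 3.
(** The square of [root_damping] is [viscosity * kappa ^+ 2], the rate at which the
    first response relaxes; the eddy damping of the wave is half of that rate times
    the square of the response, hence [2 * rank ^+ 2] where [decay] grows at unit
    rate. *)
Definition root_damping : R := 2 * rank ^+ 4.
Definition viscosity : R := (root_damping / kappa) ^+ 2.

Definition final_response t : R := response * decay_root tau t.
Definition final_response' t : R := response * decay_root' tau t.
(** The wave appears in the last stage, is damped at the rate of the eddy damping, and
    what then remains is switched off. *)
Definition final_envelope t : R :=
  amplitude * (stage tau j.*2 t * (expR (- (2 * rank ^+ 2) * decay tau t) * (1 - ending tau t))).
Definition final_envelope' t : R :=
  amplitude * (stage' tau j.*2 t * (expR (- (2 * rank ^+ 2) * decay tau t) * (1 - ending tau t))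
   + stage tau j.*2 t * (expR (- (2 * rank ^+ 2) * decay tau t)
      * (- (2 * rank ^+ 2) * decay_root tau t ^+ 2) * (1 - ending tau t)
      - expR (- (2 * rank ^+ 2) * decay tau t) * ending' tau t)).
(** With this amplitude the shear, balanced by viscosity, sustains a first response of
    size [final_response]. *)
Definition final_rate t : R := root_damping ^+ 2 / A j * final_response t.
Definition final_rate' t : R := root_damping ^+ 2 / A j * final_response' t.

Local Notation pk F := (F final_envelope final_response (A j) (B j) kappa).

(** Stages before [j] belong to the cascade; the last one is the packet with its
    high-frequency shear. *)
Definition flow_rate q : R -> R := if (q < j)%N then rate q else final_rate.
Definition flow_rate' q : R -> R := if (q < j)%N then rate' q else final_rate'.
Definition flow_shear q : R -> R := if (q < j)%N then s q else fun v => sin (kappa * v).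
Definition flow_shear' q : R -> R :=
  if (q < j)%N then shear' l k d q else fun v => kappa * cos (kappa * v).
Definition flow_shear'' q : R -> R :=
  if (q < j)%N then shear'' l k d q else fun v => - kappa ^+ 2 * sin (kappa * v).
Definition flow_scalar q : R -> R -> R -> R :=
  if (q < j)%N then wave (wgt q) (phi q) (s q) (A q) (B q) else pk packet.
Definition flow_scalar_t q : R -> R -> R -> R :=
  if (q < j)%N then wave_t (wgt q) (wgt' q) (phi q) (phi' q) (s q) (A q) (B q)
  else packet_t final_envelope final_envelope' final_response final_response' (A j) (B j) kappa.
Definition flow_scalar_u q : R -> R -> R -> R :=
  if (q < j)%N then wave_u (wgt q) (phi q) (s q) (A q) (B q) else pk packet_u.
Definition flow_scalar_uu q : R -> R -> R -> R :=
  if (q < j)%N then wave_uu (wgt q) (phi q) (s q) (A q) (B q) else pk packet_uu.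
Definition flow_scalar_v q : R -> R -> R -> R :=
  if (q < j)%N then wave_v (wgt q) (phi q) (s q) (shear' l k d q) (A q) (B q) else pk packet_v.
Definition flow_scalar_vv q : R -> R -> R -> R :=
  if (q < j)%N then wave_vv (wgt q) (phi q) (s q) (shear' l k d q) (shear'' l k d q) (A q) (B q)
  else pk packet_vv.

Definition flow : R -> V3 -> 'rV[R]_3 :=
  shear_flow j.+1 flow_rate flow_shear flow_scalar mean.

Lemma rank_ge1 : 1 <= rank. Proof. by rewrite ler1n. Qed.

Lemma is_derive_kappa v : is_derive v 1 (fun v => kappa * v) kappa.
Proof. by have := is_derive_mulc kappa (is_derive_id v 1); rewrite mulr1. Qed.

Lemma is_derive_flow_rate q t : is_derive t 1 (flow_rate q) (flow_rate' q t).
Proof.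
rewrite /flow_rate /flow_rate'; case: ifP => _; apply: is_derive_mulc.
  exact: is_derive_stage'.
by apply: is_derive_mulc; exact: is_derive_decay_root.
Qed.

Lemma is_derive_flow_shear q v : is_derive v 1 (flow_shear q) (flow_shear' q v).
Proof.
rewrite /flow_shear /flow_shear'; case: ifP => _; first exact: is_derive_shear_profile.
by apply: (is_derive_eq (is_derive_sinf (is_derive_kappa v))); rewrite mulrC.
Qed.

Lemma is_derive_flow_shear' q v : is_derive v 1 (flow_shear' q) (flow_shear'' q v).
Proof.
rewrite /flow_shear' /flow_shear''; case: ifP => _; first exact: is_derive_shear_profile'.
apply: (is_derive_eq (is_derive_mulc kappa (is_derive_cosf (is_derive_kappa v)))); ring.
Qed.

Lemma is_derive_weight q t : is_derive t 1 (wgt q) (wgt' q t).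
Proof. by apply: is_derive_mulc; apply: is_derive_sub; exact: is_derive_stage. Qed.

Lemma is_derive_final_response t : is_derive t 1 final_response (final_response' t).
Proof. by apply: is_derive_mulc; exact: is_derive_decay_root. Qed.

Lemma is_derive_final_envelope t : is_derive t 1 final_envelope (final_envelope' t).
Proof.
apply: is_derive_mulc.
have dE := is_derive_expf (is_derive_mulc (- (2 * rank ^+ 2)) (is_derive_decay tau0 t)).
have d1 := is_derive_sub (is_derive_cst (1 : R) t 1) (is_derive_ending tau0 t).
apply: (is_derive_eq (is_derive_mul (is_derive_stage tau0 j.*2 t) (is_derive_mul dE d1))).
by rewrite /=; ring.
Qed.

Lemma is_derive_flow_scalar_t q t u v :
  is_derive t 1 (fun t => flow_scalar q t u v) (flow_scalar_t q t u v).
Proof.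
rewrite /flow_scalar /flow_scalar_t; case: ifP => _.
  by apply: is_derive_wave_t => ?; [exact: is_derive_weight | exact: is_derive_stage].
by apply: is_derive_packet_t => ?;
  [exact: is_derive_final_envelope | exact: is_derive_final_response].
Qed.

Lemma is_derive_flow_scalar_u q t u v :
  is_derive u 1 (fun u => flow_scalar q t u v) (flow_scalar_u q t u v).
Proof.
rewrite /flow_scalar /flow_scalar_u; case: ifP => _; first exact: is_derive_wave_u.
exact: is_derive_packet_u.
Qed.

Lemma is_derive_flow_scalar_uu q t u v :
  is_derive u 1 (fun u => flow_scalar_u q t u v) (flow_scalar_uu q t u v).
Proof.
rewrite /flow_scalar_u /flow_scalar_uu; case: ifP => _; first exact: is_derive_wave_uu.
exact: is_derive_packet_uu.
Qed.

Lemma is_derive_flow_scalar_v q t u v :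
  is_derive v 1 (fun v => flow_scalar q t u v) (flow_scalar_v q t u v).
Proof.
rewrite /flow_scalar /flow_scalar_v; case: ifP => _; last exact: is_derive_packet_v.
by apply: is_derive_wave_v => ?; exact: is_derive_shear_profile.
Qed.

Lemma is_derive_flow_scalar_vv q t u v :
  is_derive v 1 (fun v => flow_scalar_v q t u v) (flow_scalar_vv q t u v).
Proof.
rewrite /flow_scalar_v /flow_scalar_vv; case: ifP => _; last exact: is_derive_packet_vv.
by apply: is_derive_wave_vv => ?; [exact: is_derive_shear_profile | exact: is_derive_shear_profile'].
Qed.

Lemma final_rate_support t : final_rate t != 0 -> tau / 2 < t < 5 / 8 * tau.
Proof.
by rewrite /final_rate /final_response !mulf_eq0 => /norP[_ /norP[_]] /(decay_root_active tau0).
Qed.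

Lemma rate_envelope0 q t : (q < j)%N -> rate q t * final_envelope t = 0.
Proof.
move=> qj; apply/eqP; rewrite mulf_eq0; apply/orP.
have [_|/(rate_support tau0)/andP[_ h]] := eqVneq (rate q t) 0; first by left.
right; rewrite /final_envelope stage_before ?mul0r ?mulr0 //.
by rewrite (le_trans (ltW h)) // stage_time_le // leq_double.
Qed.

Lemma final_rate_weight0 q t : final_rate t * wgt q t = 0.
Proof.
apply/eqP; rewrite mulf_eq0; apply/orP.
have [_|/final_rate_support/andP[h _]] := eqVneq (final_rate t) 0; first by left.
right; apply: contraTT h => /(weight_support tau0)/andP[_ h'].
by rewrite -leNgt ltW // (lt_trans h') // stage_time_half.
Qed.

Lemma rate_final_rate0 q t : rate q t * final_rate t = 0.
Proof.
apply/eqP; rewrite mulf_eq0; apply/orP.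
have [_|/final_rate_support/andP[h _]] := eqVneq (final_rate t) 0; first by right.
left; apply: contraTT h => /(rate_support tau0)/andP[_ h'].
by rewrite -leNgt ltW // (lt_trans h') // stage_time_half.
Qed.

Lemma flow_rate_disjoint q r t : (q < j.+1)%N -> (r < j.+1)%N -> q != r ->
  flow_rate q t * flow_rate r t = 0.
Proof.
rewrite !ltnS /flow_rate => qj rj qr.
case: (ltnP q j) => hq; case: (ltnP r j) => hr.
- exact: rate_rate0.
- exact: rate_final_rate0.
- by rewrite mulrC rate_final_rate0.
- by case/eqP: qr; apply/eqP; rewrite eqn_leq (leq_trans qj hr) (leq_trans rj hq).
Qed.

(** The last shear acts after the cascade is over, and the shears of the cascade act
    before the packet appears. *)
Lemma flow_rate_scalar q r t (X Y : R) : (q < j.+1)%N -> (r < j.+1)%N -> q != r ->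
  flow_rate q t * (if (r < j)%N then wgt r t * X else final_envelope t * Y) = 0.
Proof.
rewrite !ltnS /flow_rate => qj rj qr.
case: (ltnP q j) => hq; case: (ltnP r j) => hr; rewrite mulrA.
- by rewrite rate_weight0 ?mul0r.
- by rewrite rate_envelope0 ?mul0r.
- by rewrite final_rate_weight0 mul0r.
- by case/eqP: qr; apply/eqP; rewrite eqn_leq (leq_trans qj hr) (leq_trans rj hq).
Qed.

Lemma flow_disjoint_u q r t u v : (q < j.+1)%N -> (r < j.+1)%N -> q != r ->
  flow_rate q t * flow_scalar_u r t u v = 0.
Proof.
move=> qj rj qr; rewrite /flow_scalar_u.
have := flow_rate_scalar t
  (- A r * sin (wave_phase (phi r) (s r) (A r) (B r) t u v))
  (A j * (- sin (A j * u + B j * v) + final_response t * sin (kappa * v) * cos (A j * u + B j * v)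
  - final_response t ^+ 2 / 8 * cos (2 * kappa * v) * sin (A j * u + B j * v))) qj rj qr.
move=> <-; congr (_ * _); case: ifP => _; rewrite /wave_u /packet_u; ring.
Qed.

Lemma flow_disjoint_v q r t u v : (q < j.+1)%N -> (r < j.+1)%N -> q != r ->
  flow_rate q t * flow_scalar_v r t u v = 0.
Proof.
move=> qj rj qr; rewrite /flow_scalar_v /packet_v.
case E : (r < j)%N; last first.
  by have := flow_rate_scalar t 0 (packet_v (fun=> 1) final_response (A j) (B j) kappa t u v)
    qj rj qr; rewrite E /packet_v mul1r.
have := flow_rate_scalar t (- (B r + phi r t * shear' l k d r v) *
  sin (wave_phase (phi r) (s r) (A r) (B r) t u v)) 0 qj rj qr; rewrite E => <-.
by rewrite /wave_v; congr (_ * _); ring.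
Qed.

Lemma smooth_final_envelope : smooth final_envelope.
Proof.
apply: smoothZ; apply: smoothM; first exact: smooth_stage.
apply: smoothM; last by apply: smoothB; [exact: smooth_cst | exact: smooth_ending].
by apply: (smooth_comp smooth_expR); apply: smoothZ; exact: smooth_decay.
Qed.

Lemma smooth_final_response : smooth final_response.
Proof. by apply: smoothZ; exact: smooth_decay_root. Qed.

Lemma smooth_flow_rate q : smooth (flow_rate q).
Proof.
rewrite /flow_rate; case: ifP => _; apply: smoothZ; first exact: smooth_stage'.
exact: smooth_final_response.
Qed.

Lemma smooth_flow_shear q : smooth (flow_shear q).
Proof.
rewrite /flow_shear; case: ifP => _; first exact: smooth_shear.
by apply: (smooth_comp smooth_sin); apply: smoothZ; exact: smooth_id.
Qed.

Lemma smooth_flow_velocity b : smooth (fun z : V4 =>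
  shear_velocity j.+1 flow_rate flow_shear b z.1 z.2).
Proof.
apply: smooth_sum => q; apply: smoothM.
  exact: smooth_of_time (smooth_flow_rate _).
exact: smooth_of_coord (smooth_flow_shear _).
Qed.

Lemma smooth_flow_scalar : smooth (fun z : V4 => scalar_velocity j.+1 flow_scalar z.1 z.2).
Proof.
apply: smooth_sum => q; rewrite /flow_scalar; case: ifP => _.
  apply: smooth_wave; [|exact: smooth_stage|exact: smooth_shear].
  by apply: smoothZ; apply: smoothB; exact: smooth_stage.
by apply: smooth_packet; [exact: smooth_final_envelope | exact: smooth_final_response].
Qed.

Lemma smooth_flow : smooth_velocity flow.
Proof.
move=> i; rewrite (_ : (fun z => _) = fun z : V4 =>
    if i == dir false then shear_velocity j.+1 flow_rate flow_shear false z.1 z.2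
    else if i == dir true then shear_velocity j.+1 flow_rate flow_shear true z.1 z.2
    else mean + scalar_velocity j.+1 flow_scalar z.1 z.2); last first.
  by apply/funext => z; rewrite /flow mxE.
case: (i == dir false); first exact: smooth_flow_velocity.
case: (i == dir true); first exact: smooth_flow_velocity.
by apply: smoothD; [exact: smooth_cst | exact: smooth_flow_scalar].
Qed.

Lemma flow_shear_periodic q v : flow_shear q (v + l) = flow_shear q v.
Proof.
rewrite /flow_shear; case: ifP => _; first exact: shear_periodic.
exact: (periodic_mul (@sinD2pi R) kappal).
Qed.

Lemma flow_scalar_periodic q t u v (m n : bool) : (q < j.+1)%N ->
  flow_scalar q t (u + l * m%:R) (v + l * n%:R) = flow_scalar q t u v.
Proof.
rewrite ltnS /flow_scalar => qj; case: ifPn => [_|nq].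
  rewrite /wave /wave_phase; congr (_ * _).
  have -> : s q (v + l * n%:R) = s q v.
    by case: n; rewrite ?mulr1 ?shear_periodic // mulr0 addr0.
  exact: (phase_shift k l0 q _ _ _ m n (@cosD2pi R)).
rewrite /packet /profile.
have c := phase_shift k l0 j u v 0 m n (@cosD2pi R).
have sn := phase_shift k l0 j u v 0 m n (@sinD2pi R).
have kap2 : exists p : nat, 2 * kappa * l = pi *+ 2 *+ p.
  by case: kappal => p E; exists (p * 2)%N; rewrite -mulrA E mulr_natl -mulrnA.
have ks := periodic_mul (@sinD2pi R) kappal v.
have kc := periodic_mul (@cosD2pi R) kap2 v.
have ks' : sin (kappa * (v + l * n%:R)) = sin (kappa * v).
  by case: n {c sn}; rewrite ?mulr1 ?ks // mulr0 addr0.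
have kc' : cos (2 * kappa * (v + l * n%:R)) = cos (2 * kappa * v).
  by case: n {c sn ks'}; rewrite ?mulr1 ?kc // mulr0 addr0.
by move: c sn; rewrite !addr0 => -> ->; rewrite ks' kc'.
Qed.

Lemma flow_periodic t : torus_periodic l (flow t).
Proof.
have pv b i x : shear_velocity j.+1 flow_rate flow_shear b t (x + l *: basis3 i) =
    shear_velocity j.+1 flow_rate flow_shear b t x.
  apply: eq_bigr => q _; congr (_ * _).
  exact: (coord_periodic (~~ b) (flow_shear_periodic q) i x).
have ps i x : scalar_velocity j.+1 flow_scalar t (x + l *: basis3 i) =
    scalar_velocity j.+1 flow_scalar t x.
  by apply: eq_bigr => q _; rewrite !coordD flow_scalar_periodic.
by move=> i x; apply/rowP => m; rewrite !mxE !pv ps.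
Qed.

(** All stages lie in the middle half of the period. *)
Lemma flow_rest t : t <= tau / 4 \/ 3 / 4 * tau <= t ->
  flow t = fun=> \row_i (if i == dir false then 0 else if i == dir true then 0 else mean).
Proof.
move=> tt.
have Tq q : tau / 4 <= T q by exact: stage_time_ge.
have Th q : T q < tau / 2 by exact: stage_time_half.
have rest q : (forall y, flow_rate q t * y = 0).
  move=> y; suff -> : flow_rate q t = 0 by rewrite mul0r.
  rewrite /flow_rate; case: ifP => _; apply/eqP/negPn/negP.
    move=> /(rate_support tau0)/andP[h1 h2].
    by case: tt => h; have := Tq q.*2.+1; have := Th q.+1.*2; move: tau0; lra.
  by move=> /final_rate_support/andP[h1 h2]; case: tt => h; move: tau0; lra.
have srest q u v : flow_scalar q t u v = 0.
  rewrite /flow_scalar; case: ifP => _; [rewrite /wave | rewrite /packet].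
    suff -> : wgt q t = 0 by rewrite mul0r.
    apply/eqP/negPn/negP => /(weight_support tau0)/andP[h1 h2].
    by case: tt => h; have := Tq q.*2; have := Th q.+1.*2.+1; move: tau0; lra.
  suff -> : final_envelope t = 0 by rewrite mul0r.
  rewrite /final_envelope; case: tt => h.
    by rewrite stage_before ?mul0r ?mulr0 // (le_trans h).
  by rewrite ending_after // subrr !mulr0.
apply/funext => x; apply/rowP => i; rewrite !mxE.
have z b : shear_velocity j.+1 flow_rate flow_shear b t x = 0.
  by rewrite /shear_velocity big1 // => q _; rewrite rest.
have -> : scalar_velocity j.+1 flow_scalar t x = 0.
  by rewrite /scalar_velocity big1 // => q _; rewrite srest.
by rewrite !z addr0.
Qed.

End Flow.

(** * Elementary bounds *)

Section NormBounds.
Context {R : realType}.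
Implicit Types a b X Y : R.

Lemma normM_le a b X Y : `|a| <= X -> `|b| <= Y -> `|a * b| <= X * Y.
Proof. by move=> aX bY; rewrite normrM ler_pM. Qed.

Lemma normD_le a b X Y : `|a| <= X -> `|b| <= Y -> `|a + b| <= X + Y.
Proof. by move=> aX bY; rewrite (le_trans (ler_normD _ _)) // lerD. Qed.

Lemma normB_le a b X Y : `|a| <= X -> `|b| <= Y -> `|a - b| <= X + Y.
Proof. by move=> aX bY; rewrite (le_trans (ler_normB _ _)) // lerD. Qed.

Lemma norm_sum_le n (P : pred 'I_n) (F G : 'I_n -> R) :
  (forall i, `|F i| <= G i) -> `|\sum_(i < n | P i) F i| <= \sum_(i < n) G i.
Proof.
move=> FG; apply: le_trans (ler_norm_sum _ _ _) _.
rewrite big_mkcond /=; apply: ler_sum => i _; case: ifP => _ //.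
exact: le_trans (FG i).
Qed.

Lemma norm_cos_le1 a : `|cos a| <= 1.
Proof. by rewrite ler_norml cos_geN1 cos_le1. Qed.

Lemma norm_sin_le1 a : `|sin a| <= 1.
Proof. by rewrite ler_norml sin_geN1 sin_le1. Qed.

Lemma norm_scaled (r a y : R) (m : nat) : 0 < r -> 0 < a ->
  `|r ^+ m * (r ^+ 2 / a * y)| * a = r ^+ m * r ^+ 2 * `|y|.
Proof.
move=> r0 a0; have rm (i : nat) : `|r ^+ i| = r ^+ i by rewrite gtr0_norm ?exprn_gt0.
rewrite (normrM (r ^+ m)) (normrM (r ^+ 2 / a)) (normrM (r ^+ 2)) !rm normfV (gtr0_norm a0).
by field; rewrite gt_eqF.
Qed.

Lemma norm_itv_le1 a : 0 <= a <= 1 -> `|a| <= 1.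
Proof. by move=> /andP[a0 a1]; rewrite ger0_norm. Qed.

End NormBounds.

(** * Estimates for the force and the dissipation *)

Section GradientSquare.
Context {R : realType}.
Local Notation V4 := (R * (R * R * R))%type.

Lemma continuous_gradient_square (u : R -> R * R * R -> 'rV[R]_3) : smooth_velocity u ->
  continuous (fun z : V4 => \sum_(i < 3) \sum_(m < 3) partial i (component (u z.1) m) z.2 ^+ 2).
Proof.
move=> su; apply: continuous_ord_sum => i; apply: continuous_ord_sum => m; apply: continuous_sq.
rewrite (_ : (fun z => _) = 'D_((0, basis3 i) : V4) (joint (fun t x => u t x 0 m))).
  exact/smooth_continuous/smooth_derive/su.
apply/funext => -[t x] /=.
exact: (congr1 (fun h => h x) (partial_joint (fun t x => u t x 0 m) t i)).
Qed.

End GradientSquare.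

Section FlowEstimates.
Context {R : realType}.
Local Notation V3 := (R * R * R)%type.
Local Notation V4 := (R * V3)%type.
Implicit Types (t u v : R) (x : V3) (q r : nat).
Variables (l tau amplitude : R) (k : nat -> nat) (d : nat -> R).
Hypotheses (l0 : 0 < l) (tau0 : 0 < tau) (amp0 : 0 < amplitude).
Hypotheses (k0 : (0 < k 0)%N) (kS : forall q, (k q < k q.+1)%N) (d0 : forall q, 0 < d q).
Variables (j : nat) (kappa mean : R).
Hypotheses (kappa0 : 0 < kappa) (kappal : exists n : nat, kappa * l = pi *+ 2 *+ n).

Local Notation A := (wavenumber l k).
Local Notation B := (cross_wavenumber l k).
Local Notation s := (shear l k d).
Local Notation s' := (shear' l k d).
Local Notation s'' := (shear'' l k d).
Local Notation rate := (shear_rate l tau k).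
Local Notation rate' := (shear_rate' l tau k).
Local Notation wgt := (weight tau amplitude).
Local Notation wgt' := (weight' tau amplitude).
Local Notation T := (stage_time tau).
Local Notation phi q := (stage tau q.*2.+1).
Local Notation N := (rank (R := R) j).
Local Notation eta := (response (R := R) j).
Local Notation rd := (root_damping (R := R) j).
Local Notation nu := (viscosity j kappa).
Local Notation e := (final_response tau j).
Local Notation e' := (final_response' tau j).
Local Notation g := (final_envelope tau amplitude j).
Local Notation g' := (final_envelope' tau amplitude j).
Local Notation fr := (final_rate l tau k j).
Local Notation fr' := (final_rate' l tau k j).
Local Notation beta := (decay_root tau).
Local Notation flw := (flow l tau amplitude k d j kappa mean).
Local Notation fv := (vertical_force l tau amplitude k d).
Local Notation fh := (horizontal_force l tau k d).

Variables (C D : nat -> R) (Cb v0 : R).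
Hypothesis C1 : forall n, 1 <= C n.
Hypothesis HC : forall n t, `|stage' tau n t| <= C n /\ `|stage'' tau n t| <= C n.
Hypothesis D0 : forall q, 0 <= D q.
Hypothesis HD : forall q v, `|s' q v| <= D q /\ `|s'' q v| <= D q.
Hypothesis Cb1 : 1 <= Cb.
Hypothesis HCb : forall t,
  [/\ `|decay_root tau t| <= Cb, `|decay_root' tau t| <= Cb & `|ending' tau t| <= Cb].
(* The wavenumbers are large compared with the derivatives of the schedule: each pair
   of conditions makes first the accelerations and then the velocities of the shears
   small, in the cascade and at the final stage. *)
Hypothesis Abig : forall q, 2 * pi * C q.*2.+1 * q.+1%:R <= A q.
Hypothesis Avel : forall q, 2 * pi * C q.*2.+1 <= v0 * A q.
Hypothesis Afin : rd ^+ 4 * Cb * N <= A j.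
Hypothesis Afvel : rd ^+ 4 * Cb <= v0 * A j.
Hypothesis CbN : Cb <= N.

(** A bound for all derivatives of the waves of the first [j] stages. *)
Definition cascade_size : R := 1 + A j + A j ^+ 2 + 2 * B j + B j ^+ 2 +
  \sum_(q < j) (amplitude * (A q ^+ 2 + (B q + D q) ^+ 2 + D q + A q + B q + D q) + D q).
Local Notation X := cascade_size.
(** The final shear has a wavenumber so large, and therefore the viscosity is so small,
    that viscosity is negligible on all scales of the cascade. *)
Hypothesis kappa_big : rd * (1 + rd) * X * N ^+ 2 <= kappa.

Local Notation mu := (rd / kappa).

Lemma N_ge1 : 1 <= N. Proof. exact: rank_ge1. Qed.
Lemma rank_gt0 : 0 < N. Proof. exact: lt_le_trans ltr01 N_ge1. Qed.

Lemma response_size_bounds : [/\ 0 < eta, eta <= N^-1, eta * N = N ^- 2, eta * Cb <= N^-1 & eta <= 1].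
Proof.
have N0 := rank_gt0; have N1 := N_ge1.
have i1 : N^-1 <= 1 by rewrite invf_le1.
have i0 : 0 < N^-1 by rewrite invr_gt0.
have E : eta = N^-1 ^+ 3 by rewrite /response exprVn.
have e0 : 0 < eta by rewrite E exprn_gt0.
have e2 : eta <= N^-1 ^+ 2.
  by rewrite E exprS -[X in _ <= X]mul1r ler_pM2r ?exprn_gt0.
have e1 : eta <= N^-1.
  by apply: le_trans e2 _; rewrite expr2 -[X in _ <= X]mul1r ler_pM2r.
split=> //; last exact: le_trans e1 i1.
- by rewrite /response; field; rewrite gt_eqF.
apply: (@le_trans _ _ (N^-1 ^+ 2 * N)).
  by rewrite ler_pM ?(ltW e0) // (le_trans ler01).
by rewrite expr2 -mulrA mulVf ?mulr1 // gt_eqF.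
Qed.

Lemma root_damping_ge1 : 1 <= rd.
Proof.
have N1 := N_ge1; rewrite /root_damping.
have : 1 <= N ^+ 4 by rewrite exprn_ege1.
lra.
Qed.

Lemma cascade_sum_ge0 : 0 <= \sum_(q < j) (amplitude *
  (A q ^+ 2 + (B q + D q) ^+ 2 + D q + A q + B q + D q) + D q).
Proof.
apply: sumr_ge0 => q _; have Aq : 0 <= A q by exact/ltW/wavenumber_gt0.
have Bq : 0 <= B q by exact: cross_wavenumber_ge0.
by apply: addr_ge0 => //; apply: mulr_ge0; [exact: ltW | rewrite !addr_ge0 ?sqr_ge0].
Qed.

Lemma cascade_size_ge1 : 1 <= X.
Proof.
have A0 : 0 <= A j by exact/ltW/wavenumber_gt0.
have B0 : 0 <= B j by exact: cross_wavenumber_ge0.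
have S0 := cascade_sum_ge0.
by rewrite /cascade_size; have := sqr_ge0 (A j); have := sqr_ge0 (B j); lra.
Qed.

Lemma root_viscosity_bounds : [/\ 0 < mu, mu * X <= N ^- 2, rd * mu * X <= N ^- 2, mu <= 1 & nu = mu ^+ 2].
Proof.
have N0 := rank_gt0; have X1 := cascade_size_ge1; have r1 := root_damping_ge1.
have X0 : 0 < X := lt_le_trans ltr01 X1; have r0 : 0 < rd := lt_le_trans ltr01 r1.
have m0 : 0 < mu by rewrite divr_gt0.
have N2 : 0 < N ^+ 2 by rewrite exprn_gt0.
have mk : mu * kappa = rd by rewrite divfK // gt_eqF.
have big y : 0 <= y -> y * rd * X * N ^+ 2 <= kappa -> y * mu * X <= N ^- 2.
  move=> y0 h; rewrite -[X in _ <= X]mul1r ler_pdivlMr //.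
  rewrite -(ler_pM2r kappa0) mul1r.
  by apply: le_trans h; rewrite -{2}mk le_eqVlt; apply/orP; left; apply/eqP; ring.
have XN : 0 < X * N ^+ 2 by rewrite mulr_gt0.
have p1 : 0 <= rd * X * N ^+ 2 by rewrite -mulrA mulr_ge0 ?(ltW r0) ?(ltW XN).
have p2 : 0 <= rd * rd * X * N ^+ 2.
  rewrite (_ : rd * rd * X * N ^+ 2 = rd * (rd * X * N ^+ 2)); last by ring.
  by apply: mulr_ge0 => //; exact: ltW.
have h1 : 1 * mu * X <= N ^- 2.
  apply: big => //; apply: le_trans kappa_big; rewrite mul1r; move: p2; lra.
have h2 : rd * mu * X <= N ^- 2.
  apply: big; first exact: ltW.
  apply: le_trans kappa_big; move: p1; lra.
rewrite mul1r in h1.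
split=> //; apply: (@le_trans _ _ (mu * X)); first by rewrite ler_peMr // ltW.
by apply: le_trans h1 _; rewrite invf_le1 // exprn_ege1 // N_ge1.
Qed.

Lemma weight_bound q t : `|wgt q t| <= amplitude.
Proof.
rewrite /weight normrM gtr0_norm // ler_piMr ?(ltW amp0) //.
have /andP[a0 a1] := stage_itv tau0 q.*2 t; have /andP[b0 b1] := stage_itv tau0 q.+1.*2 t.
by rewrite ler_norml; apply/andP; split; lra.
Qed.

Lemma weight_ge0 q t : 0 <= wgt q t.
Proof.
rewrite /weight mulr_ge0 ?(ltW amp0) // subr_ge0.
have [h|h] := leP t (T q.+1.*2).
  by rewrite (stage_before tau0 h); have /andP[] := stage_itv tau0 q.*2 t.
rewrite (@stage_after _ _ tau0 q.*2); first by have /andP[] := stage_itv tau0 q.+1.*2 t.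
by apply: le_trans (ltW h); rewrite stage_time_le // doubleS.
Qed.

Lemma stage_norm_le1 q t : `|phi q t| <= 1.
Proof. exact/norm_itv_le1/stage_itv. Qed.

Lemma envelope_bound t : `|g t| <= amplitude * stage tau j.*2 t.
Proof.
have /andP[a0 a1] := stage_itv tau0 j.*2 t.
rewrite /final_envelope normrM gtr0_norm // ler_pM2l // normrM (ger0_norm a0).
rewrite ler_piMr // -[X in _ <= X]mul1r; apply: normM_le.
  rewrite gtr0_norm ?expR_gt0 // -[X in _ <= X]expR0 ler_expR mulNr oppr_le0.
  have /andP[? _] := decay_itv tau0 t.
  by rewrite mulr_ge0 // mulr_ge0 // sqr_ge0.
have /andP[b0 b1] := ending_itv tau0 t.
by rewrite ler_norml; apply/andP; split; lra.
Qed.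

Lemma envelope_bound1 t : `|g t| <= amplitude.
Proof.
apply: le_trans (envelope_bound t) _; rewrite ler_piMr ?(ltW amp0) //.
by have /andP[] := stage_itv tau0 j.*2 t.
Qed.

Lemma response_bounds t : [/\ `|e t| <= eta * Cb, `|e t| <= N^-1, `|e' t| <= eta * Cb & `|e t| <= 1].
Proof.
have [e0 _ _ eC _] := response_size_bounds; have [b1 b2 _] := HCb t.
have h1 : `|e t| <= eta * Cb by rewrite /final_response normrM gtr0_norm // ler_pM2l.
have h2 : `|e' t| <= eta * Cb by rewrite /final_response' normrM gtr0_norm // ler_pM2l.
have h3 := le_trans h1 eC.
by split=> //; apply: le_trans h3 _; rewrite invf_le1 ?N_ge1 ?rank_gt0.
Qed.

(** Only boundedness matters: the rate multiplies derivatives of the shear, which are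
    compared with [cascade_size]. *)
Lemma rate_bound q t : `|rate q t| <= 1.
Proof.
have A0 : 0 < A q by apply: wavenumber_gt0.
rewrite /shear_rate normrM normrN normfV (gtr0_norm A0) ler_pdivrMl // mulr1.
have [h _] := HC q.*2.+1 t; apply: le_trans h _; apply: le_trans (Abig q).
have C0 : 0 <= C q.*2.+1 := le_trans ler01 (C1 _).
have p1 : 1 <= 2 * pi :> R by have := pi_ge2 R; lra.
have q1 : 1 <= q.+1%:R :> R by rewrite ler1n.
rewrite mulrAC ler_peMl // -[X in X <= _]mul1r; exact: ler_pM.
Qed.

(** The exponential cancels the eddy damping: only the introduction of the wave and
    the removal of its remainder are left. *)
Lemma envelope_damped t : g' t + g t * (rd ^+ 2 * e t ^+ 2 / 2) =
  amplitude * (stage' tau j.*2 t - expR (- (2 * N ^+ 2)) * ending' tau t).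
Proof.
have Nn : N != 0 by rewrite gt_eqF // rank_gt0.
have E : rd ^+ 2 * e t ^+ 2 / 2 = 2 * N ^+ 2 * beta t ^+ 2.
  by rewrite /root_damping /final_response /response; field.
rewrite E /final_envelope' /final_envelope.
have z1 : stage' tau j.*2 t * (expR (- (2 * N ^+ 2) * decay tau t) * (1 - ending tau t)) =
    stage' tau j.*2 t.
  have [->|/(stage'_active tau0)/andP[_ h]] := eqVneq (stage' tau j.*2 t) 0; first by rewrite mul0r.
  have th := lt_trans h (stage_time_half tau0 _).
  rewrite (decay_before tau0 (ltW th)) mulr0 expR0 (ending_before tau0) ?subr0 ?mulr1 //.
  by move: th tau0; lra.
have z2 : stage tau j.*2 t * (expR (- (2 * N ^+ 2) * decay tau t) * ending' tau t) =
    expR (- (2 * N ^+ 2)) * ending' tau t.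
  have [->|/(ending'_active tau0)/andP[h _]] := eqVneq (ending' tau t) 0; first by rewrite !mulr0.
  rewrite (decay_after tau0 (ltW h)) mulr1 (stage_after tau0) ?mul1r //.
  by apply: ltW; apply: lt_trans (stage_time_half tau0 _) _; move: h tau0; lra.
by rewrite -z2 -{2}z1; ring.
Qed.

(** Where the response is active the only variation of the envelope is the eddy damping. *)
Lemma envelope_derivative_response t : g' t * e t = - (2 * N ^+ 2) * beta t ^+ 2 * g t * e t.
Proof.
have [E|h] := eqVneq (e t) 0; first by rewrite E !mulr0.
have b0 : beta t != 0 by apply: contraNN h => /eqP b; rewrite /final_response b mulr0.
have /andP[b1 b2] := decay_root_active tau0 b0.
have s0 : stage' tau j.*2 t = 0.
  by rewrite (stage'_out tau0) //; right; rewrite ltW // (lt_trans (stage_time_half tau0 _)).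
have e0 : ending' tau t = 0.
  by apply/eqP/negPn/negP => /(ending'_active tau0)/andP[h' _]; move: h' b2; lra.
by rewrite /final_envelope' /final_envelope s0 e0; ring.
Qed.

(** The amplitude that survives the damping is smaller than any power of the rank; a
    single power is enough. *)
Lemma damping_small : expR (- (2 * N ^+ 2)) <= N^-1.
Proof.
rewrite expRN lef_pV2 ?posrE ?expR_gt0 ?rank_gt0 //.
apply: le_trans (expR_ge1Dx _); have := N_ge1; rewrite expr2; nra.
Qed.

Lemma cascade_terms_bound q t u v :
  [/\ `|wave_u (wgt q) (phi q) (s q) (A q) (B q) t u v| <= amplitude * A q,
      `|wave_v (wgt q) (phi q) (s q) (s' q) (A q) (B q) t u v| <= amplitude * (B q + D q),
      `|wave_uu (wgt q) (phi q) (s q) (A q) (B q) t u v +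
        wave_vv (wgt q) (phi q) (s q) (s' q) (s'' q) (A q) (B q) t u v| <=
        amplitude * (A q ^+ 2 + (B q + D q) ^+ 2 + D q) &
      `|rate q t * s' q v| <= D q /\ `|rate q t * s'' q v| <= D q].
Proof.
have A0 : 0 <= A q by exact/ltW/wavenumber_gt0.
have B0 : 0 <= B q by exact: cross_wavenumber_ge0.
have w1 := weight_bound q t; have p1 := stage_norm_le1 q t; have [d1 d2] := HD q v.
have nA : `|A q| <= A q by rewrite ger0_norm.
have nB : `|B q| <= B q by rewrite ger0_norm.
have r1 := rate_bound q t.
have cs y := norm_cos_le1 (R := R) y; have sn y := norm_sin_le1 (R := R) y.
have pd : `|B q + phi q t * s' q v| <= B q + D q.
  by apply: normD_le => //; rewrite -[D q]mul1r; exact: normM_le.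
split.
- by rewrite /wave_u -[X in _ <= X]mulr1; apply: normM_le => //; apply: normM_le => //; rewrite normrN.
- by rewrite /wave_v -[X in _ <= X]mulr1; apply: normM_le => //; apply: normM_le => //; rewrite normrN.
- rewrite /wave_uu /wave_vv.
  set c := cos _; set sg := sin _.
  have -> : - wgt q t * A q ^+ 2 * c + - wgt q t * ((B q + phi q t * s' q v) ^+ 2 * c + phi q t * s'' q v * sg)
     = - wgt q t * (A q ^+ 2 * c + (B q + phi q t * s' q v) ^+ 2 * c + phi q t * s'' q v * sg) by ring.
  apply: normM_le; first by rewrite normrN.
  apply: normD_le; first apply: normD_le.
  + by rewrite -[A q ^+ 2]mulr1 !mulr1 -[X in _ <= X]mulr1 !expr2; apply: normM_le; [exact: normM_le | exact: cs].
  + by rewrite -[X in _ <= X]mulr1 !expr2; apply: normM_le; [exact: normM_le | exact: cs].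
  + rewrite -[X in _ <= X]mulr1; apply: normM_le; last exact: sn.
    by rewrite -[D q]mul1r; exact: normM_le.
by split; rewrite -[D q]mul1r; exact: normM_le.
Qed.

Lemma cascade_sum_bound (P : pred 'I_j) (F : 'I_j -> R) :
  (forall q : 'I_j, `|F q| <= amplitude *
     (A q ^+ 2 + (B q + D q) ^+ 2 + D q + A q + B q + D q) + D q) ->
  `|\sum_(q < j | P q) F q| <= X.
Proof.
move=> FW; apply: le_trans (norm_sum_le P FW) _.
have A0 : 0 <= A j by exact/ltW/wavenumber_gt0.
have B0 : 0 <= B j by exact: cross_wavenumber_ge0.
by rewrite /cascade_size lerDr; have := sqr_ge0 (A j); have := sqr_ge0 (B j); lra.
Qed.

Lemma cascade_sums t x (P : pred 'I_j) :
  [/\ `|\sum_(q < j | P q) rate q t * s' q (coord (~~ odd q) x)| <= X,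
      forall b, `|\sum_(q < j | P q) rate q t * s'' q (coord b x)| <= X,
      forall b, `|\sum_(q < j | P q) rate q t * s' q (coord b x)| <= X,
      forall c, `|\sum_(q < j | P q) (if odd q == c
         then wave_u (wgt q) (phi q) (s q) (A q) (B q) t (coord (odd q) x) (coord (~~ odd q) x)
         else wave_v (wgt q) (phi q) (s q) (s' q) (A q) (B q) t (coord (odd q) x) (coord (~~ odd q) x))| <= X &
      `|\sum_(q < j | P q) (wave_uu (wgt q) (phi q) (s q) (A q) (B q) t (coord (odd q) x) (coord (~~ odd q) x) +
        wave_vv (wgt q) (phi q) (s q) (s' q) (s'' q) (A q) (B q) t (coord (odd q) x) (coord (~~ odd q) x))| <= X].
Proof.
have pos q : [/\ 0 <= A q, 0 <= B q, 0 <= A q ^+ 2 & 0 <= (B q + D q) ^+ 2].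
  by split; [exact/ltW/wavenumber_gt0 | exact: cross_wavenumber_ge0 | exact: sqr_ge0 | exact: sqr_ge0].
have big q y : 0 <= y <= A q ^+ 2 + (B q + D q) ^+ 2 + D q + A q + B q + D q ->
    amplitude * y <= amplitude * (A q ^+ 2 + (B q + D q) ^+ 2 + D q + A q + B q + D q) + D q.
  move=> /andP[_ h]; apply: ler_wpDr => //; rewrite ler_pM2l //.
have dbig q : D q <= amplitude * (A q ^+ 2 + (B q + D q) ^+ 2 + D q + A q + B q + D q) + D q.
  have [p1 p2 p3 p4] := pos q; rewrite lerDr mulr_ge0 ?(ltW amp0) //.
  by have := D0 q; lra.
split=> [|b|b|c|]; apply: cascade_sum_bound => q.
- have [_ _ _ [h _]] := cascade_terms_bound q t 0 (coord (~~ odd q) x).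
  exact: le_trans h (dbig q).
- have [_ _ _ [_ h]] := cascade_terms_bound q t 0 (coord b x); exact: le_trans h (dbig q).
- have [_ _ _ [h _]] := cascade_terms_bound q t 0 (coord b x); exact: le_trans h (dbig q).
- have [h1 h2 _ _] := cascade_terms_bound q t (coord (odd q) x) (coord (~~ odd q) x).
  have [p1 p2 p3 p4] := pos q; have := D0 q.
  by case: ifP => _ Dq; [apply: le_trans h1 _ | apply: le_trans h2 _]; apply: big; lra.
have [_ _ h _] := cascade_terms_bound q t (coord (odd q) x) (coord (~~ odd q) x).
have [p1 p2 p3 p4] := pos q; have := D0 q => Dq.
by apply: le_trans h _; apply: big; lra.
Qed.

Lemma viscosity_small y : `|y| <= X -> `|nu * y| <= N^-1.
Proof.
move=> yX; have [m0 m1 _ m2 ->] := root_viscosity_bounds; have N1 := N_ge1; have N0 := rank_gt0.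
rewrite expr2 -mulrA normrM (gtr0_norm m0) -[X in _ <= X]mul1r.
apply: ler_pM => //; first exact: ltW.
rewrite normrM (gtr0_norm m0); apply: (@le_trans _ _ (mu * X)); first by rewrite ler_pM2l.
apply: le_trans m1 _; rewrite lef_pV2 ?posrE ?exprn_gt0 //.
by rewrite expr2 ler_peMl // ltW.
Qed.

Lemma root_viscosity_small y : `|y| <= X -> `|mu * y| <= N ^- 2.
Proof.
move=> yX; have [m0 m1 _ _ _] := root_viscosity_bounds.
rewrite normrM (gtr0_norm m0); apply: le_trans m1; by rewrite ler_pM2l.
Qed.

Lemma final_rate_bounds t : [/\ `|fr t| <= N^-1, `|fr' t| <= N^-1,
   `|rd * fr t| <= N^-1, `|rd ^+ 2 * fr t| <= N^-1 & `|fr t| <= v0].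
Proof.
have N0 := rank_gt0; have N1 := N_ge1; have r1 := root_damping_ge1.
have [e0 _ _ eC e1] := response_size_bounds; have [h1 _ h2 _] := response_bounds t.
have A0 : 0 < A j by exact: wavenumber_gt0.
have r0 : 0 < rd := lt_le_trans ltr01 r1.
have Cb0 : 0 < Cb := lt_le_trans ltr01 Cb1.
have key (m : nat) y : (m <= 2)%N -> `|y| <= eta * Cb ->
    `|rd ^+ m * (rd ^+ 2 / A j * y)| * A j <= rd ^+ 4 * Cb.
  move=> m2 hy.
  have -> : `|rd ^+ m * (rd ^+ 2 / A j * y)| * A j = rd ^+ m * rd ^+ 2 * `|y|.
    exact: norm_scaled.
  rewrite -exprD; apply: ler_pM => //; first by rewrite exprn_ge0 // ltW.
    by apply: ler_weXn2l => //; rewrite addnC; case: m m2 => [|[|[|]]].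
  by apply: le_trans hy _; rewrite ler_piMl // ltW.
have kN (m : nat) y : (m <= 2)%N -> `|y| <= eta * Cb -> `|rd ^+ m * (rd ^+ 2 / A j * y)| <= N^-1.
  move=> m2 hy; rewrite -(ler_pM2r A0); apply: le_trans (key m y m2 hy) _.
  by rewrite ler_pdivlMl // mulrC.
split.
- by have := kN 0%N (e t) isT h1; rewrite expr0 mul1r.
- by have := kN 0%N (e' t) isT h2; rewrite expr0 mul1r.
- by have := kN 1%N (e t) isT h1; rewrite expr1.
- exact: kN 2%N (e t) isT h1.
rewrite -(ler_pM2r A0); apply: le_trans Afvel.
by have := key 0%N (e t) isT h1; rewrite expr0 mul1r.
Qed.

(** The cascade contributes its forces and a viscous term that is negligible; the final
    shear contributes its acceleration and its own viscous friction, both small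
    because its amplitude is divided by the wavenumber of the wave it acts on. *)
Lemma horizontal_residual_bound b t x :
  `|ns_residual nu flw t x (dir b) - \sum_(q < j) fh q b t x| <= 3 * N^-1.
Proof.
have Nn : kappa != 0 by rewrite gt_eqF.
have J1 q (r : R) : is_derive r 1 (flow_rate l tau k j q) (flow_rate' l tau k j q r).
  exact: is_derive_flow_rate.
have J2 q (y : R) : is_derive y 1 (flow_shear l k d j kappa q) (flow_shear' l k d j kappa q y).
  exact: is_derive_flow_shear.
have J3 q (y : R) : is_derive y 1 (flow_shear' l k d j kappa q) (flow_shear'' l k d j kappa q y).
  exact: is_derive_flow_shear'.
have J4 q r y : (q < j.+1)%N -> (r < j.+1)%N -> q != r ->
    flow_rate l tau k j q y * flow_rate l tau k j r y = 0.
  by move=> qj rj qr; exact: flow_rate_disjoint.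
rewrite /flow (shear_flow_residual_horizontal _ mean nu J1 J2 J3 J4).
rewrite big_mkcond big_ord_recr /= /flow_rate /flow_rate' /flow_shear /flow_shear'' ltnn.
have -> : \sum_(q < j) (if odd q == b then
     (if (q < j)%N then rate' q else fr') t * (if (q < j)%N then s q else fun v => sin (kappa * v)) (coord (~~ b) x)
     - nu * ((if (q < j)%N then rate q else fr) t *
        (if (q < j)%N then s'' q else fun v => - kappa ^+ 2 * sin (kappa * v)) (coord (~~ b) x)) else 0) =
   \sum_(q < j) fh q b t x - nu * \sum_(q < j | odd q == b) rate q t * s'' q (coord (~~ b) x).
  rewrite [X in _ - nu * X]big_mkcond mulr_sumr -sumrB; apply: eq_bigr => q _.
  by rewrite ltn_ord /horizontal_force; case: eqP => // _; rewrite mulr0 subr0.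
set S := \sum_(q < j | odd q == b) _.
have hS : `|nu * S| <= N^-1 by apply: viscosity_small; have [_ h _ _ _] := cascade_sums t x (fun q : 'I_j => odd q == b); exact: (h (~~ b)).
have [_ f1 _ f2 _] := final_rate_bounds t.
have hF : `|if odd j == b then fr' t * sin (kappa * coord (~~ b) x) -
     nu * (fr t * (- kappa ^+ 2 * sin (kappa * coord (~~ b) x))) else 0| <= 2 * N^-1.
  case: eqP => _; last by rewrite normr0 mulr_ge0 // invr_ge0 ltW // rank_gt0.
  have -> : fr' t * sin (kappa * coord (~~ b) x) -
     nu * (fr t * (- kappa ^+ 2 * sin (kappa * coord (~~ b) x))) =
     (fr' t + rd ^+ 2 * fr t) * sin (kappa * coord (~~ b) x).
    by rewrite /viscosity; field.
  rewrite -[X in _ <= X]mulr1; apply: normM_le; last exact: norm_sin_le1.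
  by rewrite mulrDl mul1r; exact: normD_le.
set F := if _ then _ else _ in hF *; set Z := \sum_(q < j) _.
have -> : Z - nu * S + F - Z = F - nu * S by ring.
have -> : 3 * N^-1 = 2 * N^-1 + N^-1 by ring.
exact: normB_le.
Qed.

Lemma profile_bound t u v : `|profile e (A j) (B j) kappa t u v| <= 17 / 8.
Proof.
have [_ _ _ e1] := response_bounds t.
rewrite /profile.
have -> : 17 / 8 = 1 + 1 + 1 / 8 :> R by field.
apply: normD_le; first apply: normD_le; first exact: norm_cos_le1.
  rewrite -[X in _ <= X]mulr1; apply: normM_le; last exact: norm_sin_le1.
  rewrite -[X in _ <= X]mulr1; apply: normM_le => //; exact: norm_sin_le1.
rewrite -[X in _ <= X]mulr1; apply: normM_le; last exact: norm_cos_le1.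
rewrite -[X in _ <= X]mulr1; apply: normM_le; last exact: norm_cos_le1.
rewrite normrM [X in _ * X]ger0_norm // ler_pM2r // -[X in _ <= X]mulr1 expr2.
exact: normM_le.
Qed.

Lemma cross_damping_bound : `|nu * kappa * (2 * B j)| <= N^-1.
Proof.
have [m0 _ m1 _ nuE] := root_viscosity_bounds; have N1 := N_ge1; have N0 := rank_gt0.
have B0 : 0 <= B j by exact: cross_wavenumber_ge0.
have r0 : 0 < rd := lt_le_trans ltr01 root_damping_ge1.
have -> : nu * kappa * (2 * B j) = rd * mu * (2 * B j).
  by rewrite nuE; field; rewrite gt_eqF.
have rm0 : 0 < rd * mu by exact: mulr_gt0.
have B2 : 0 <= 2 * B j by exact: mulr_ge0.
rewrite ger0_norm; last by apply: mulr_ge0 => //; exact: ltW.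
apply: (@le_trans _ _ (rd * mu * X)).
  rewrite ler_pM2l //.
  have A0 : 0 <= A j by exact/ltW/wavenumber_gt0.
  have S0 := cascade_sum_ge0.
  by rewrite /cascade_size; have := sqr_ge0 (A j); have := sqr_ge0 (B j); lra.
apply: le_trans m1 _; rewrite lef_pV2 ?posrE ?exprn_gt0 //.
by rewrite expr2 ler_peMl // ltW.
Qed.

Lemma wavenumber_size : `|A j ^+ 2 + B j ^+ 2| <= X /\ `|A j| <= X /\ `|B j| <= X.
Proof.
have A0 : 0 <= A j by exact/ltW/wavenumber_gt0.
have B0 : 0 <= B j by exact: cross_wavenumber_ge0.
have S0 := cascade_sum_ge0.
have := sqr_ge0 (A j); have := sqr_ge0 (B j) => b2 a2.
by rewrite /cascade_size !ger0_norm ?addr_ge0 //; split; [|split]; lra.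
Qed.

(** The leading term of the residual is the introduction of the wave. Each of the others
    is a product of factors of known size: the powers of the rank in [response] and
    [root_damping] are balanced so that all of them are at most [1 / rank]. *)
Lemma packet_residual_bound t u v :
  `|packet_t g g' e e' (A j) (B j) kappa t u v
    + fr t * sin (kappa * v) * packet_u g e (A j) (B j) kappa t u v
    - nu * (packet_uu g e (A j) (B j) kappa t u v + packet_vv g e (A j) (B j) kappa t u v)
    - amplitude * stage' tau j.*2 t * cos (A j * u + B j * v)| <= 13 * amplitude * Cb ^+ 4 * N^-1.
Proof.
have N0 := rank_gt0; have N1 := N_ge1.
have Nn : N != 0 by rewrite gt_eqF.
have A0 : A j != 0 by rewrite gt_eqF // wavenumber_gt0.
have kn : kappa != 0 by rewrite gt_eqF.
have nuk : nu * kappa ^+ 2 = rd ^+ 2 by rewrite /viscosity; field.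
have frE : fr t = rd ^+ 2 * e t / A j by rewrite /final_rate; field.
rewrite frE (packet_residual g g' e e' (B j) t u v A0 nuk) envelope_damped.
set P := cos (A j * u + B j * v); set Q := sin (A j * u + B j * v).
set S := sin (kappa * v); set Cc := cos (kappa * v).
set S2 := sin (2 * kappa * v); set C2 := cos (2 * kappa * v).
have [hP hQ] := (norm_cos_le1 (A j * u + B j * v), norm_sin_le1 (A j * u + B j * v)).
have [hS hC] := (norm_sin_le1 (kappa * v), norm_cos_le1 (kappa * v)).
have [hS2 hC2] := (norm_sin_le1 (2 * kappa * v), norm_cos_le1 (2 * kappa * v)).
rewrite -/P in hP; rewrite -/Q in hQ; rewrite -/S in hS; rewrite -/Cc in hC.
rewrite -/S2 in hS2; rewrite -/C2 in hC2.
have [e1 eN e2 e3] := response_bounds t; have g1 := envelope_bound1 t.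
have [b1 b2 b3] := HCb t.
have [eta0 _ etaN etaC eta1] := response_size_bounds.
have Cb0 : 0 <= Cb := le_trans ler01 Cb1.
have i0 : 0 < N^-1 by rewrite invr_gt0.
have CbM (m : nat) : (m <= 4)%N -> Cb ^+ m <= Cb ^+ 4 by move=> m4; exact: ler_weXn2l.
have etaX : eta <= N^-1 by have [_ ? _ _ _] := response_size_bounds.
have q1 : `|S * Q| <= 1 by rewrite -[X in _ <= X]mulr1; exact: normM_le.
have q2 : `|C2 * P| <= 1 by rewrite -[X in _ <= X]mulr1; exact: normM_le.
have r1 : `|e t * S * Q + e t ^+ 2 / 8 * C2 * P| <= 2 * (eta * Cb).
  have -> : e t * S * Q + e t ^+ 2 / 8 * C2 * P = e t * (S * Q + e t / 8 * (C2 * P)) by field.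
  rewrite mulrC; apply: normM_le => //.
  have -> : 2 = 1 + 1 * 1 :> R by ring.
  apply: normD_le => //; apply: normM_le => //.
  by rewrite normrM [X in _ * X]ger0_norm // ler_pdivrMr // (le_trans e3) // mul1r ler1n.
have t1 : `|- (amplitude * (expR (- (2 * N ^+ 2)) * ending' tau t) * P)| <= amplitude * Cb ^+ 4 * N^-1.
  rewrite normrN -[X in _ <= X]mulr1; apply: normM_le => //.
  rewrite -mulrA; apply: normM_le; first by rewrite gtr0_norm.
  rewrite mulrC; apply: normM_le.
    by apply: le_trans b3 _; rewrite -[X in X <= _]expr1; exact: CbM.
  by rewrite gtr0_norm ?expR_gt0 //; exact: damping_small.
have t2 : `|g' t * (e t * S * Q + e t ^+ 2 / 8 * C2 * P)| <= 4 * amplitude * Cb ^+ 4 * N^-1.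
  have -> : g' t * (e t * S * Q + e t ^+ 2 / 8 * C2 * P) =
      (g' t * e t) * (S * Q + e t / 8 * (C2 * P)) by field.
  rewrite envelope_derivative_response.
  have -> : - (2 * N ^+ 2) * beta t ^+ 2 * g t * e t * (S * Q + e t / 8 * (C2 * P)) =
      - (g t * (2 * N ^+ 2 * beta t ^+ 2 * (e t * S * Q + e t ^+ 2 / 8 * C2 * P))) by field.
  rewrite normrN.
  have -> : 4 * amplitude * Cb ^+ 4 * N^-1 = amplitude * (4 * Cb ^+ 4 * N^-1) by ring.
  apply: normM_le => //.
  apply: (@le_trans _ _ (2 * N ^+ 2 * Cb ^+ 2 * (2 * (eta * Cb)))).
    apply: normM_le => //; apply: normM_le; first by rewrite ger0_norm ?mulr_ge0 ?sqr_ge0.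
    by rewrite !expr2; exact: normM_le.
  have -> : 2 * N ^+ 2 * Cb ^+ 2 * (2 * (eta * Cb)) = 4 * Cb ^+ 3 * N^-1.
    by rewrite /response; field.
  by rewrite ler_pM2r // ler_pM2l // CbM.
have t3 : `|g t * (e' t * S * Q + e t * e' t / 4 * C2 * P)| <= 2 * amplitude * Cb ^+ 4 * N^-1.
  have -> : 2 * amplitude * Cb ^+ 4 * N^-1 = amplitude * (2 * Cb ^+ 4 * N^-1) by ring.
  apply: normM_le => //.
  have -> : e' t * S * Q + e t * e' t / 4 * C2 * P = (S * Q + e t / 4 * (C2 * P)) * e' t by field.
  apply: (@le_trans _ _ (2 * (eta * Cb))).
    apply: normM_le => //; have -> : 2 = 1 + 1 * 1 :> R by ring.
    apply: normD_le => //; apply: normM_le => //.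
    by rewrite normrM [X in _ * X]ger0_norm // ler_pdivrMr // (le_trans e3) // mul1r ler1n.
  rewrite -mulrA ler_pM2l // mulrC; apply: ler_pM => //; first exact: ltW.
  by rewrite -[X in X <= _]expr1; exact: CbM.
(* the third power of the response is the worst term that the damping rate multiplies *)
have t4 : `|g t * (rd ^+ 2 * e t ^+ 3 / 8) * (S * C2 * Q)| <= amplitude * Cb ^+ 4 * N^-1.
  rewrite -[X in _ <= X]mulr1; apply: normM_le; last first.
    rewrite -[X in _ <= X]mulr1; apply: normM_le => //.
    by rewrite -[X in _ <= X]mulr1; exact: normM_le.
  rewrite -[X in _ <= X]mulrA; apply: normM_le => //.
  have -> : rd ^+ 2 * e t ^+ 3 / 8 = beta t ^+ 3 * (N^-1 / 2).
    by rewrite /final_response /root_damping /response; field.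
  apply: normM_le; last by rewrite gtr0_norm ?divr_gt0 // ler_pdivrMr // ler_peMr ?ler1n // ltW.
  by rewrite normrX; apply: (@le_trans _ _ (Cb ^+ 3)); [exact: lerXn2r | exact: CbM].
have t5 : `|g t * nu * ((A j ^+ 2 + B j ^+ 2) * profile e (A j) (B j) kappa t u v)| <=
    3 * amplitude * Cb ^+ 4 * N^-1.
  have -> : g t * nu * ((A j ^+ 2 + B j ^+ 2) * profile e (A j) (B j) kappa t u v) =
    g t * (profile e (A j) (B j) kappa t u v * (nu * (A j ^+ 2 + B j ^+ 2))) by ring.
  have -> : 3 * amplitude * Cb ^+ 4 * N^-1 = amplitude * (3 * Cb ^+ 4 * N^-1) by ring.
  apply: normM_le => //; apply: normM_le; last first.
    by apply: viscosity_small; have [] := wavenumber_size.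
  apply: le_trans (profile_bound t u v) _.
  by have : 1 <= Cb ^+ 4 by [rewrite exprn_ege1]; lra.
have t6 : `|g t * (nu * kappa) * (2 * B j * (e t * Cc * P + e t ^+ 2 / 4 * S2 * Q))| <=
    2 * amplitude * Cb ^+ 4 * N^-1.
  have -> : g t * (nu * kappa) * (2 * B j * (e t * Cc * P + e t ^+ 2 / 4 * S2 * Q)) =
    g t * (((Cc * P) + e t / 4 * (S2 * Q)) * e t * (nu * kappa * (2 * B j))) by field.
  have -> : 2 * amplitude * Cb ^+ 4 * N^-1 = amplitude * (2 * Cb ^+ 4 * N^-1) by ring.
  apply: normM_le => //; apply: normM_le; last exact: cross_damping_bound.
  have C41 : 1 <= Cb ^+ 4 by rewrite exprn_ege1.
  apply: (@le_trans _ _ ((1 + 1 * 1) * 1)); last by lra.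
  apply: normM_le => //; apply: normD_le.
    by rewrite -[X in _ <= X]mul1r; exact: normM_le.
  apply: normM_le; last by rewrite -[X in _ <= X]mul1r; exact: normM_le.
  by rewrite normrM [X in _ * X]ger0_norm // ler_pdivrMr // (le_trans e3) // mul1r ler1n.
set T1 := - (amplitude * _ * P) in t1.
set T2 := g' t * (_ + _) in t2 *; set T3 := g t * (_ + _) in t3 *.
set T4 := g t * _ * _ in t4 *; set T5 := g t * nu * _ in t5 *; set T6 := g t * _ * (2 * _ * _) in t6 *.
have -> : amplitude * (stage' tau j.*2 t - expR (- (2 * N ^+ 2)) * ending' tau t) * P
   + T2 + T3 - T4 + T5 - T6 - amplitude * stage' tau j.*2 t * P = T1 + T2 + T3 - T4 + T5 - T6.
  by rewrite /T1; ring.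
have -> : 13 * amplitude * Cb ^+ 4 * N^-1 = amplitude * Cb ^+ 4 * N^-1 + 4 * amplitude * Cb ^+ 4 * N^-1
  + 2 * amplitude * Cb ^+ 4 * N^-1 + amplitude * Cb ^+ 4 * N^-1 + 3 * amplitude * Cb ^+ 4 * N^-1
  + 2 * amplitude * Cb ^+ 4 * N^-1 by ring.
exact: (normB_le (normD_le (normB_le (normD_le (normD_le t1 t2) t3) t4) t5) t6).
Qed.

(** After exact transport the cascade leaves the mismatches, and viscosity is negligible
    on it. *)
Lemma vertical_residual_bound t x :
  `|ns_residual nu flw t x ord_max - \sum_(q < j.+1) fv q t x| <= (1 + 13 * amplitude * Cb ^+ 4) * N^-1.
Proof.
rewrite /flow (shear_flow_residual_vertical (flow_shear l k d j kappa) mean nu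
  (is_derive_flow_scalar_t l amplitude k d tau0 j kappa)
  (is_derive_flow_scalar_u l tau amplitude k d j kappa)
  (is_derive_flow_scalar_v l tau amplitude k d0 j kappa)
  (is_derive_flow_scalar_uu l tau amplitude k d j kappa)
  (is_derive_flow_scalar_vv l tau amplitude k d0 j kappa)); first last.
- by move=> q r y u v qj rj qr; exact: flow_disjoint_v.
- by move=> q r y u v qj rj qr; exact: flow_disjoint_u.
rewrite big_ord_recr /= -weight_telescope //.
pose W (q : 'I_j) := wave_uu (wgt q) (phi q) (s q) (A q) (B q) t (coord (odd q) x) (coord (~~ odd q) x) +
  wave_vv (wgt q) (phi q) (s q) (s' q) (s'' q) (A q) (B q) t (coord (odd q) x) (coord (~~ odd q) x).
under eq_bigr => q _.
  rewrite /flow_scalar_t /flow_scalar_u /flow_scalar_uu /flow_scalar_vv /flow_rate /flow_shear !ltn_ord.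
  rewrite cascade_transport // -/(W q); over.
rewrite /flow_scalar_t /flow_scalar_u /flow_scalar_uu /flow_scalar_vv /flow_rate /flow_shear !ltnn.
rewrite sumrB -mulr_sumr.
have hW : `|nu * \sum_(q < j) W q| <= N^-1.
  by apply: viscosity_small; have [_ _ _ _] := cascade_sums t x xpredT.
have hP := packet_residual_bound t (coord (odd j) x) (coord (~~ odd j) x).
rewrite -/(plane_wave l k j x) in hP.
rewrite mulrDl mul1r [X in _ <= X]addrC; apply: le_trans (normB_le hP hW).
by rewrite le_eqVlt; apply/orP; left; apply/eqP; congr `|_|; ring.
Qed.

Local Notation vel := (shear_velocity j.+1 (flow_rate l tau k j) (flow_shear l k d j kappa)).
Local Notation sca := (scalar_velocity j.+1 (flow_scalar l tau amplitude k d j kappa)).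

Lemma velocity_bound b t x : `|vel b t x| <= v0.
Proof.
have A0 q : 0 < A q by apply: wavenumber_gt0.
have v00 : 0 <= v0.
  rewrite -(pmulr_lge0 _ (A0 0%N)); apply: le_trans (Avel 0%N).
  by rewrite !mulr_ge0 ?pi_ge0 // (le_trans ler01).
have one r y : `|flow_rate l tau k j r t * flow_shear l k d j kappa r y| <= v0.
  rewrite /flow_rate /flow_shear; case: ifP => _; last first.
    have [_ _ _ _ h] := final_rate_bounds t.
    by rewrite -[X in _ <= X]mulr1; apply: normM_le => //; exact: norm_sin_le1.
  rewrite /shear_rate (normrM _ (s r y)) (normrM _ (stage' tau r.*2.+1 t)).
  rewrite normrN normfV (gtr0_norm (A0 r)) -mulrA ler_pdivrMl //.
  rewrite [X in _ <= X]mulrC; apply: le_trans (Avel r); rewrite mulrC; apply: ler_pM => //.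
    exact: shear_bound.
  by have [] := HC r.*2.+1 t.
have [[r rj rn]|none] := pselect (exists2 r, (r < j.+1)%N & flow_rate l tau k j r t != 0).
  rewrite -[X in `|X|]mulr1 (@shear_velocity_mul _ _ _ _ b t x r 1); last first.
    move=> q qj qr; rewrite mulr1; apply/eqP.
    have /eqP := flow_rate_disjoint l k tau0 t qj rj qr.
    by rewrite mulf_eq0 (negbTE rn) orbF.
  by rewrite mulr1; case: (_ && _); rewrite ?mul1r ?mul0r ?normr0.
rewrite /shear_velocity big1 ?normr0 // => q _.
have -> : flow_rate l tau k j q t = 0; last by rewrite mul0r.
by apply/eqP; apply: contra_notT none => h; exists (q : nat).
Qed.

Lemma sum_weight n t : \sum_(q < n) wgt q t = amplitude * (stage tau 0 t - stage tau n.*2 t).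
Proof.
elim: n => [|n IH]; first by rewrite big_ord0 subrr mulr0.
by rewrite big_ord_recr /= IH /weight; ring.
Qed.

(** The weights are a partition of the amplitude, so that the waves present at any time
    do not add up. *)
Lemma scalar_bound t x : `|sca t x| <= amplitude * (17 / 8).
Proof.
rewrite /scalar_velocity big_ord_recr /= {2}/flow_scalar ltnn.
have h1 : `|\sum_(q < j) flow_scalar l tau amplitude k d j kappa q t (coord (odd q) x) (coord (~~ odd q) x)|
   <= amplitude * (1 - stage tau j.*2 t).
  apply: (@le_trans _ _ (\sum_(q < j) wgt q t)).
    apply: le_trans (ler_norm_sum _ _ _) _; apply: ler_sum => q _.
    rewrite /flow_scalar ltn_ord -[X in _ <= X]mulr1; apply: normM_le; last exact: norm_cos_le1.
    by rewrite ger0_norm // weight_ge0.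
  rewrite sum_weight ler_pM2l // lerD2r.
  by have /andP[] := stage_itv tau0 0 t.
have h2 : `|packet g e (A j) (B j) kappa t (coord (odd j) x) (coord (~~ odd j) x)|
   <= amplitude * stage tau j.*2 t * (17 / 8).
  by apply: normM_le; [exact: envelope_bound | exact: profile_bound].
apply: le_trans (normD_le h1 h2) _.
have /andP[s0 s1] := stage_itv tau0 j.*2 t.
rewrite -mulrA -mulrDr ler_pM2l //; lra.
Qed.

Local Notation gra q c := (fun t x => if odd q == c
  then flow_scalar_u l tau amplitude k d j kappa q t (coord (odd q) x) (coord (~~ odd q) x)
  else flow_scalar_v l tau amplitude k d j kappa q t (coord (odd q) x) (coord (~~ odd q) x)).
Local Notation shg b t x := (\sum_(q < j.+1 | odd q == b)
  flow_rate l tau k j q t * flow_shear' l k d j kappa q (coord (~~ b) x)).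

(** The nine squares in terms of four entries; stated for an arbitrary [F] so that the
    entries can be substituted as variables. *)
Lemma sum_square3 (F : 'I_3 -> 'I_3 -> R) (S0 S1 G0 G1 : R) :
  F (dir false) (dir false) = 0 -> F (dir true) (dir false) = S0 -> F ord_max (dir false) = 0 ->
  F (dir false) (dir true) = S1 -> F (dir true) (dir true) = 0 -> F ord_max (dir true) = 0 ->
  F (dir false) ord_max = G0 -> F (dir true) ord_max = G1 -> F ord_max ord_max = 0 ->
  \sum_(i < 3) \sum_(m < 3) F i m ^+ 2 = S0 ^+ 2 + S1 ^+ 2 + G0 ^+ 2 + G1 ^+ 2.
Proof.
rewrite !sum_ord3; move: (dir false) (dir true) (ord_max : 'I_3) => a b c.
by move=> -> -> -> -> -> -> -> -> ->; ring.
Qed.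

(** A horizontal component varies only across its shear, and nothing varies vertically. *)
Lemma sum_gradient t x :
  \sum_(i < 3) \sum_(m < 3) partial i (component (flw t) m) x ^+ 2 =
  shg false t x ^+ 2 + shg true t x ^+ 2
  + (\sum_(q < j.+1) gra q (odd j) t x) ^+ 2 + (\sum_(q < j.+1) gra q (~~ odd j) t x) ^+ 2.
Proof.
pose S b := shg b t x; pose G c := \sum_(q < j.+1) gra q c t x.
have P1 b i : partial i (component (flw t) (dir b)) x = (i == dir (~~ b))%:R * shg b t x.
  rewrite /flow shear_flow_componentE /partial.
  by have [_ ->] := is_derive_shear j.+1 (flow_rate l tau k j) (is_derive_flow_shear l k d0 j kappa) b i x t.
have P2 i : partial i (component (flw t) ord_max) x =
   \sum_(q < j.+1) ((i == dir (odd q))%:R * flow_scalar_u l tau amplitude k d j kappa q t (coord (odd q) x) (coord (~~ odd q) x)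
   + (i == dir (~~ odd q))%:R * flow_scalar_v l tau amplitude k d j kappa q t (coord (odd q) x) (coord (~~ odd q) x)).
  rewrite /flow shear_flow_component_max /partial.
  by have [_ ->] := is_derive_scalar j.+1 mean (is_derive_flow_scalar_u l tau amplitude k d j kappa)
    (is_derive_flow_scalar_v l tau amplitude k d0 j kappa) i x t.
have P3 c : partial (dir c) (component (flw t) ord_max) x = \sum_(q < j.+1) gra q c t x.
  rewrite P2; apply: eq_bigr => q _; rewrite !dir_eq.
  by case: (odd q); case: c; rewrite !(mul0r, mul1r, add0r, addr0).
have P4 : partial ord_max (component (flw t) ord_max) x = 0.
  by rewrite P2 big1 // => q _; rewrite !dir_max !mul0r addr0.
have -> : \sum_(q < j.+1) gra q (odd j) t x = (if odd j then G true else G false).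
  by rewrite /G; case: (odd j).
have -> : \sum_(q < j.+1) gra q (~~ odd j) t x = (if odd j then G false else G true).
  by rewrite /G; case: (odd j).
have {}P1 b i : partial i (component (flw t) (dir b)) x = (i == dir (~~ b))%:R * S b by exact: P1.
have {}P3 c : partial (dir c) (component (flw t) ord_max) x = G c by exact: P3.
have z00 : partial (dir false) (component (flw t) (dir false)) x = 0 by rewrite P1 dir_eq mul0r.
have z11 : partial (dir true) (component (flw t) (dir true)) x = 0 by rewrite P1 dir_eq mul0r.
have z20 : partial ord_max (component (flw t) (dir false)) x = 0 by rewrite P1 dir_max mul0r.
have z21 : partial ord_max (component (flw t) (dir true)) x = 0 by rewrite P1 dir_max mul0r.
have z10 : partial (dir true) (component (flw t) (dir false)) x = S false by rewrite P1 dir_eq mul1r.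
have z01 : partial (dir false) (component (flw t) (dir true)) x = S true by rewrite P1 dir_eq mul1r.
have g0 := P3 false; have g1 := P3 true.
rewrite (sum_square3 z00 z10 z20 z01 z11 z21 g0 g1 P4) /S.
by case: (odd j); ring.
Qed.

Lemma inv_rank_bounds : [/\ 0 < N^-1, N^-1 <= 1, N ^- 2 <= N^-1 & N ^- 2 <= 1].
Proof.
have N0 := rank_gt0; have N1 := N_ge1.
have i0 : 0 < N^-1 by rewrite invr_gt0.
have i1 : N^-1 <= 1 by rewrite invf_le1.
have i2 : N ^- 2 <= N^-1 by rewrite -exprVn expr2 ler_piMl // ltW.
by split => //; exact: le_trans i2 i1.
Qed.

Lemma shear_gradient_small b t x : `|mu * shg b t x| <= 2 * N^-1.
Proof.
have [i0 i1 i2 _] := inv_rank_bounds.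
rewrite big_mkcond big_ord_recr /= {2}/flow_rate {2}/flow_shear' ltnn -big_mkcond.
have -> : \sum_(q < j | odd q == b) flow_rate l tau k j q t * flow_shear' l k d j kappa q (coord (~~ b) x)
   = \sum_(q < j | odd q == b) rate q t * s' q (coord (~~ b) x).
  by apply: eq_bigr => q _; rewrite /flow_rate /flow_shear' ltn_ord.
rewrite mulrDr (_ : 2 * N^-1 = N^-1 + N^-1); last by ring.
apply: normD_le.
  apply: le_trans i2; apply: root_viscosity_small.
  by have [_ _ h _ _] := cascade_sums t x (fun q : 'I_j => odd q == b); exact: h.
case: eqP => _; last by rewrite mulr0 normr0 ltW.
have -> : mu * (fr t * (kappa * cos (kappa * coord (~~ b) x))) =
  rd * fr t * cos (kappa * coord (~~ b) x) by field; rewrite gt_eqF.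
rewrite -[X in _ <= X]mulr1; apply: normM_le; last exact: norm_cos_le1.
by have [_ _ h _ _] := final_rate_bounds t.
Qed.

Lemma packet_slope_bound t u v :
  `|- sin (A j * u + B j * v) + e t * sin (kappa * v) * cos (A j * u + B j * v)
    - e t ^+ 2 / 8 * cos (2 * kappa * v) * sin (A j * u + B j * v)| <= 17 / 8.
Proof.
have [_ _ _ e1] := response_bounds t.
have -> : 17 / 8 = 1 + 1 + 1 / 8 :> R by field.
apply: normB_le; first apply: normD_le.
- by rewrite normrN; exact: norm_sin_le1.
- rewrite -[X in _ <= X]mulr1; apply: normM_le; last exact: norm_cos_le1.
  rewrite -[X in _ <= X]mulr1; apply: normM_le => //; exact: norm_sin_le1.
rewrite -[X in _ <= X]mulr1; apply: normM_le; last exact: norm_sin_le1.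
rewrite -[X in _ <= X]mulr1; apply: normM_le; last exact: norm_cos_le1.
rewrite normrM [X in _ * X]ger0_norm // ler_pM2r // -[X in _ <= X]mulr1 expr2.
exact: normM_le.
Qed.

Lemma cascade_gradient_small c t x : `|mu * \sum_(q < j) gra q c t x| <= N ^- 2.
Proof.
apply: root_viscosity_small; have [_ _ _ h _] := cascade_sums t x xpredT.
apply: le_trans (h c); rewrite le_eqVlt; apply/orP; left; apply/eqP; congr `|_|.
by apply: eq_bigr => q _; rewrite /flow_scalar_u /flow_scalar_v ltn_ord.
Qed.

Lemma along_gradient_small t x :
  `|mu * \sum_(q < j.+1) gra q (odd j) t x| <= (1 + 17 / 8 * amplitude) * N ^- 2.
Proof.
rewrite big_ord_recr /= {2}/flow_scalar_u ltnn eqxx.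
rewrite mulrDr mulrDl mul1r; apply: normD_le; first exact: cascade_gradient_small.
rewrite /packet_u.
set Y := - sin _ + _ - _.
have hY : `|Y| <= 17 / 8 by exact: packet_slope_bound.
have -> : mu * (g t * A j * Y) = Y * g t * (mu * A j) by ring.
apply: normM_le; first by apply: normM_le => //; exact: envelope_bound1.
by apply: root_viscosity_small; have [_ []] := wavenumber_size.
Qed.

(** The part of the gradient that survives in the limit: the fast derivative of
    the first response. *)
Definition main_gradient t x : R := rd * (g t * e t) *
  (cos (kappa * coord (~~ odd j) x) * sin (A j * coord (odd j) x + B j * coord (~~ odd j) x)).

Lemma main_gradient_bound t x : `|main_gradient t x| <= 2 * amplitude * Cb * N.
Proof.
rewrite /main_gradient -[X in _ <= X]mulr1; apply: normM_le; last first.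
  by rewrite -[X in _ <= X]mulr1; apply: normM_le; [exact: norm_cos_le1 | exact: norm_sin_le1].
have [h _ _ _] := response_bounds t; have r0 := lt_le_trans ltr01 root_damping_ge1.
apply: (@le_trans _ _ (rd * (amplitude * (eta * Cb)))).
  apply: normM_le; first by rewrite gtr0_norm.
  by apply: normM_le => //; exact: envelope_bound1.
rewrite le_eqVlt; apply/orP; left; apply/eqP.
by rewrite /root_damping /response; field; rewrite gt_eqF // rank_gt0.
Qed.

Lemma across_gradient_near t x :
  `|mu * \sum_(q < j.+1) gra q (~~ odd j) t x - main_gradient t x| <=
  (1 + 17 / 8 * amplitude + amplitude * Cb ^+ 2) * N ^- 2.
Proof.
have N0 := rank_gt0.
rewrite big_ord_recr /= {2}/flow_scalar_v ltnn (_ : (odd j == ~~ odd j) = false); last by case: (odd j).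
set S := \sum_(q < j) _.
have hS : `|mu * S| <= N ^- 2 by exact: cascade_gradient_small.
rewrite /packet_v.
set Y := - sin _ + _ - _.
have [h1 _ _ _] := response_bounds t.
have hY : `|Y| <= 17 / 8 by exact: packet_slope_bound.
have hB : `|Y * g t * (mu * B j)| <= 17 / 8 * amplitude * N ^- 2.
  apply: normM_le; first by apply: normM_le => //; exact: envelope_bound1.
  by apply: root_viscosity_small; have [_ []] := wavenumber_size.
set xi := A j * _ + _; set v := coord (~~ odd j) x.
have hE : `|rd * (e t * (e t / 4)) * g t * (sin (2 * kappa * v) * cos xi)| <=
    amplitude * Cb ^+ 2 * N ^- 2.
  rewrite -[X in _ <= X]mulr1; apply: normM_le; last first.
    by rewrite -[X in _ <= X]mulr1; apply: normM_le; [exact: norm_sin_le1 | exact: norm_cos_le1].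
  apply: (@le_trans _ _ (rd * ((eta * Cb) * (eta * Cb / 4)) * amplitude)).
    apply: normM_le; last exact: envelope_bound1.
    apply: normM_le; first by rewrite gtr0_norm // (lt_le_trans ltr01 root_damping_ge1).
    by apply: normM_le => //; rewrite normrM [X in _ * X]ger0_norm // ler_pM2r.
  have -> : rd * (eta * Cb * (eta * Cb / 4)) * amplitude = amplitude * Cb ^+ 2 * N ^- 2 / 2.
    by rewrite /root_damping /response; field; rewrite gt_eqF.
  have : 0 <= amplitude * Cb ^+ 2 * N ^- 2.
    apply: mulr_ge0; first by apply: mulr_ge0; [exact: ltW | exact: sqr_ge0].
    by rewrite invr_ge0 sqr_ge0.
  move: (amplitude * _ * _) => p; lra.
have -> : mu * (S + g t * (B j * Y + kappa *
     (e t * cos (kappa * v) * sin xi - e t ^+ 2 / 4 * sin (2 * kappa * v) * cos xi)))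
   - main_gradient t x = mu * S + Y * g t * (mu * B j)
     - rd * (e t * (e t / 4)) * g t * (sin (2 * kappa * v) * cos xi).
  by rewrite /main_gradient -/xi -/v; field; rewrite gt_eqF.
have -> : (1 + 17 / 8 * amplitude + amplitude * Cb ^+ 2) * N ^- 2 =
   N ^- 2 + 17 / 8 * amplitude * N ^- 2 + amplitude * Cb ^+ 2 * N ^- 2 by ring.
exact: (normB_le (normD_le hS hB) hE).
Qed.

Definition gradient_error : R := 1 + 17 / 8 * amplitude + amplitude * Cb ^+ 2.
Definition dissipation_error : R := 8 + gradient_error ^+ 2
  + gradient_error * (4 * amplitude * Cb + gradient_error).

(** In the gradient times the square root of the viscosity, the derivative of the first
    response across the shear is the only term that does not tend to zero; it grows
    at most like the rank, while the error that multiplies it decreases like the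
    inverse of the square of the rank. *)
Lemma dissipation_density t x :
  `|nu * \sum_(i < 3) \sum_(m < 3) partial i (component (flw t) m) x ^+ 2 -
    main_gradient t x ^+ 2| <= dissipation_error * N^-1.
Proof.
have [i0 i1 i2 i3] := inv_rank_bounds; have N0 := rank_gt0.
have [_ _ _ _ nuE] := root_viscosity_bounds.
have K0 : 0 <= gradient_error.
  have a2 : 0 <= amplitude * Cb ^+ 2 by apply: mulr_ge0; [exact: ltW | exact: sqr_ge0].
  by rewrite /gradient_error; have := amp0; lra.
have K1 : 1 + 17 / 8 * amplitude <= gradient_error.
  by rewrite /gradient_error lerDl; apply: mulr_ge0; [exact: ltW | exact: sqr_ge0].
have s1 := shear_gradient_small false t x; have s2 := shear_gradient_small true t x.
have s3 := along_gradient_small t x; have s4 := across_gradient_near t x.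
have s5 := main_gradient_bound t x.
rewrite sum_gradient nuE.
set a := shg false t x in s1 *; set b := shg true t x in s2 *.
set y := \sum_(q < j.+1) gra q (odd j) t x in s3 *.
set z := \sum_(q < j.+1) gra q (~~ odd j) t x in s4 *.
set m := main_gradient t x in s4 s5 *.
have sq c : `|c| <= 2 * N^-1 -> `|c ^+ 2| <= 4 * N^-1.
  move=> hc; rewrite normrX expr2; apply: (@le_trans _ _ (2 * N^-1 * (2 * 1))).
    by apply: ler_pM => //; apply: le_trans hc _; rewrite ler_pM2l.
  by rewrite le_eqVlt; apply/orP; left; apply/eqP; ring.
have sq3 : `|(mu * y) ^+ 2| <= gradient_error ^+ 2 * N^-1.
  have h : `|mu * y| <= gradient_error * N ^- 2.
    by apply: le_trans s3 _; rewrite ler_wpM2r // invr_ge0 sqr_ge0.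
  rewrite expr2; apply: le_trans (normM_le h h) _.
  have -> : gradient_error * N ^- 2 * (gradient_error * N ^- 2) = gradient_error ^+ 2 * (N ^- 2 * N ^- 2) by ring.
  rewrite ler_wpM2l ?sqr_ge0 // -[X in _ <= X]mulr1 ler_pM // ?invr_ge0 ?sqr_ge0 //.
have sq4 : `|(mu * z) ^+ 2 - m ^+ 2| <= gradient_error * (4 * amplitude * Cb + gradient_error) * N^-1.
  have -> : (mu * z) ^+ 2 - m ^+ 2 = (mu * z - m) * (m + m + (mu * z - m)) by ring.
  apply: le_trans (normM_le s4 (normD_le (normD_le s5 s5) s4)) _.
  rewrite -/gradient_error.
  have -> : gradient_error * N ^- 2 * (2 * amplitude * Cb * N + 2 * amplitude * Cb * N + gradient_error * N ^- 2) =
    gradient_error * (4 * amplitude * Cb) * N^-1 + gradient_error ^+ 2 * (N ^- 2 * N ^- 2).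
    by field; rewrite gt_eqF.
  have -> : gradient_error * (4 * amplitude * Cb + gradient_error) * N^-1 =
    gradient_error * (4 * amplitude * Cb) * N^-1 + gradient_error ^+ 2 * N^-1 by ring.
  rewrite lerD2l ler_wpM2l ?sqr_ge0 // -[X in _ <= X]mulr1 ler_pM // ?invr_ge0 ?sqr_ge0 //.
have -> : mu ^+ 2 * (a ^+ 2 + b ^+ 2 + y ^+ 2 + z ^+ 2) - m ^+ 2 =
  (mu * a) ^+ 2 + (mu * b) ^+ 2 + (mu * y) ^+ 2 + ((mu * z) ^+ 2 - m ^+ 2) by ring.
have -> : dissipation_error * N^-1 = 4 * N^-1 + 4 * N^-1 + gradient_error ^+ 2 * N^-1 +
  gradient_error * (4 * amplitude * Cb + gradient_error) * N^-1.
  by rewrite /dissipation_error; ring.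
exact: (normD_le (normD_le (normD_le (sq _ s1) (sq _ s2)) sq3) sq4).
Qed.

(** The squares of [cos] and [sin] have mean one half, and the product of the two
    squares differs from one quarter by derivatives of periodic functions. *)
Lemma main_gradient_mean_square t :
  torus_Rintegral l (fun x => main_gradient t x ^+ 2) = (rd * (g t * e t)) ^+ 2 / 4 * l ^+ 3.
Proof.
pose b := odd j.
have A0 : A j != 0 by rewrite gt_eqF // wavenumber_gt0.
have k00 : kappa != 0 by rewrite gt_eqF.
have cu c : continuous (fun x : V3 => coord c x) by exact: continuous_coord.
have cmul (V : topologicalType) (m : R) (h : V -> R) : continuous h -> continuous (fun y => m * h y).
  by move=> ch y; apply: cvgM; [exact: cvg_cst | exact: ch].
have ccos (V : topologicalType) (h : V -> R) : continuous h -> continuous (fun y => cos (h y)).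
  by move=> ch; exact: continuous_compose ch (@continuous_cos R).
have c1 : continuous (fun x : V3 => cos (2 * kappa * coord (~~ b) x)) by exact: ccos (cmul _ _ _ (cu _)).
pose dh (u v : R) := cos (2 * (A j * u + B j * v)) * (1 + cos (2 * kappa * v)).
have cdh : continuous (fun p : R * R => dh p.1 p.2).
  have f1 : continuous (fun p : R * R => p.1) by move=> p; exact: cvg_fst.
  have f2 : continuous (fun p : R * R => p.2) by move=> p; exact: cvg_snd.
  have f3 := ccos _ _ (cmul _ (2 * kappa) _ f2).
  have f4 : continuous (fun p : R * R => A j * p.1 + B j * p.2).
    by move=> p; apply: cvgD; [exact: cmul f1 p | exact: cmul f2 p].
  move=> p; apply: cvgM; first exact: (ccos _ _ (cmul _ 2 _ f4) p).
  by apply: cvgD; [exact: cvg_cst | exact: f3].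
(* the oscillation across the shear is a derivative in that direction *)
have z1 : torus_Rintegral l (fun x => cos (2 * kappa * coord (~~ b) x)) = 0.
  have kap2 : exists p : nat, 2 * kappa * l = pi *+ 2 *+ p.
    by case: kappal => p E; exists (p * 2)%N; rewrite -mulrA E mulr_natl -mulrnA.
  apply: (@torus_int_derive R l l0 (~~ b) (fun u _ => (2 * kappa)^-1 * sin (2 * kappa * u))
    (fun u _ => cos (2 * kappa * u))).
  - move=> u v; have d2 := is_derive_mulc (2 * kappa) (is_derive_id u 1).
    apply: (is_derive_eq (is_derive_mulc (2 * kappa)^-1 (is_derive_sinf d2))).
    by field.
  - by apply: ccos; apply: cmul => p; exact: cvg_fst.
  by move=> u _; rewrite (periodic_mul (@sinD2pi R) kap2).
(* the rest oscillates along the shear *)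
have z2 : torus_Rintegral l (fun x => dh (coord b x) (coord (~~ b) x)) = 0.
  apply: (@torus_int_derive R l l0 b
    (fun u v => (2 * A j)^-1 * (1 + cos (2 * kappa * v)) * sin (2 * (A j * u + B j * v)))) => //.
    move=> u v; have d2 := is_derive_mulc 2 (is_derive_affine (A j) (B j * v) u).
    apply: (is_derive_eq (is_derive_mulc _ (is_derive_sinf d2))).
    by rewrite /dh; field.
  move=> u v; congr (_ * _).
  have p4 (y : R) : sin (2 * (y + pi *+ 2 + B j * v)) = sin (2 * (y + B j * v)).
    have -> : 2 * (y + pi *+ 2 + B j * v) = 2 * (y + B j * v) + pi *+ 2 + pi *+ 2 by ring.
    by rewrite !sinD2pi.
  by have := @periodic_mul R l (fun y => sin (2 * (y + B j * v))) (A j) p4 (wavenumber_period k l0 j) u.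
set a := (rd * (g t * e t)) ^+ 2 / 4.
have E x : main_gradient t x ^+ 2 = a + a * cos (2 * kappa * coord (~~ b) x)
    + - a * dh (coord b x) (coord (~~ b) x).
  rewrite /main_gradient /dh -/b; set z := kappa * _; set xi := A j * _ + _.
  have -> : 2 * kappa * coord (~~ b) x = z + z by rewrite /z; ring.
  have -> : 2 * xi = xi + xi by ring.
  rewrite (cosD z z) (cosD xi xi) /a; have := cos2Dsin2 z; have := cos2Dsin2 xi.
  move: (cos z) (sin z) (cos xi) (sin xi) => cz sz cx sx e1 e2.
  have -> : cz * cz - sz * sz = 2 * cz ^+ 2 - 1 by move: e2; lra.
  have -> : cx * cx - sx * sx = 1 - 2 * sx ^+ 2 by move: e1; lra.
  by field.
under eq_fun do rewrite E.
have cdx : continuous (fun x : V3 => dh (coord b x) (coord (~~ b) x)).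
  have h := continuous_pair (cu b) (cu (~~ b)); exact: (continuous_compose h cdh).
have ca : continuous (fun _ : V3 => a) by move=> x; exact: cvg_cst.
have cb := cmul _ a _ c1; have cc := cmul _ (- a) _ cdx.
have cab : continuous (fun x : V3 => a + a * cos (2 * kappa * coord (~~ b) x)).
  by move=> x; apply: cvgD; [exact: ca | exact: cb].
rewrite (torus_intD l0 cab cc) (torus_intD l0 ca cb) (torus_intZ l0 _ c1) (torus_intZ l0 _ cdx).
by rewrite torus_int_cst // z1 z2 !mulr0 !addr0.
Qed.

(** The dissipation rate of a wave whose squared amplitude decays like [exp (- 4 rank ^+
    2 decay)]. *)
Definition mean_rate t : R := N ^+ 2 * amplitude ^+ 2 * (beta t ^+ 2 * expR (- (4 * N ^+ 2) * decay tau t)).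

Lemma main_gradient_rate t : (rd * (g t * e t)) ^+ 2 / 4 = mean_rate t.
Proof.
rewrite /mean_rate; have [E|h] := eqVneq (beta t) 0.
  by rewrite /final_response E; ring.
have /andP[b1 b2] := decay_root_active tau0 h.
have -> : g t = amplitude * expR (- (2 * N ^+ 2) * decay tau t).
  rewrite /final_envelope stage_after // ?ending_before ?subr0 ?mulr1 ?mul1r //.
    exact: ltW.
  by rewrite ltW // (lt_trans (stage_time_half tau0 _)).
have -> : expR (- (4 * N ^+ 2) * decay tau t) = expR (- (2 * N ^+ 2) * decay tau t) ^+ 2.
  by rewrite [RHS]expr2 -expRD; congr expR; ring.
rewrite /final_response /root_damping /response.
by field; rewrite gt_eqF // rank_gt0.
Qed.

Lemma continuous_freeze_time (h : V4 -> R) t : continuous h -> continuous (fun x => h (t, x)).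
Proof.
by move=> ch; apply: continuous_compose ch; apply: continuous_pair => x; [exact: cvg_cst | exact: cvg_id].
Qed.

Local Notation density t x :=
  (\sum_(i < 3) \sum_(m < 3) partial i (component (flw t) m) x ^+ 2).

Lemma continuous_main_gradient t : continuous (main_gradient t).
Proof.
have cu c : continuous (fun x : V3 => coord c x) by exact: continuous_coord.
have cmul (m : R) (h : V3 -> R) : continuous h -> continuous (fun x => m * h x).
  by move=> ch x; apply: cvgM; [exact: cvg_cst | exact: ch].
have c1 := continuous_compose (cmul kappa _ (cu (~~ odd j))) (@continuous_cos R).
have c2 : continuous (fun x : V3 => A j * coord (odd j) x + B j * coord (~~ odd j) x).
  by move=> x; apply: cvgD; exact: cmul.
have c3 := continuous_compose c2 (@continuous_sin R).
by apply: cmul => x; apply: cvgM; [exact: c1 | exact: c3].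
Qed.

Lemma torus_dissipation_near t :
  `|torus_Rintegral l (fun x => nu * density t x) - mean_rate t * l ^+ 3| <=
  dissipation_error * N^-1 * l ^+ 3.
Proof.
have cd : continuous (fun x => nu * density t x).
  have sf : smooth_velocity flw by exact: smooth_flow.
  have := @continuous_freeze_time _ t (continuous_gradient_square sf).
  by move=> c x; apply: cvgM; [exact: cvg_cst | exact: c].
have cm : continuous (fun x => main_gradient t x ^+ 2).
  by apply: continuous_sq; exact: continuous_main_gradient.
have cmN : continuous (fun x => -1 * main_gradient t x ^+ 2).
  by move=> x; apply: cvgM; [exact: cvg_cst | exact: cm].
have cdm : continuous (fun x => nu * density t x + -1 * main_gradient t x ^+ 2).
  by move=> x; apply: cvgD; [exact: cd | exact: cmN].
have := @torus_int_near _ l l0 _ 0 (dissipation_error * N^-1) cdm.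
rewrite (torus_intD l0 cd cmN) (torus_intZ l0 _ cm) main_gradient_mean_square main_gradient_rate.
rewrite mul0r subr0 mulN1r; apply=> x.
by rewrite subr0 mulN1r; exact: dissipation_density.
Qed.

Lemma is_derive_mean_rate t :
  is_derive t 1 (fun t => - (amplitude ^+ 2 / 4) * expR (- (4 * N ^+ 2) * decay tau t)) (mean_rate t).
Proof.
have dE := is_derive_expf (is_derive_mulc (- (4 * N ^+ 2)) (is_derive_decay tau0 t)).
apply: (is_derive_eq (is_derive_mulc (- (amplitude ^+ 2 / 4)) dE)).
by rewrite /mean_rate; field.
Qed.

(** The mean rate is a multiple of the derivative of an exponential that falls from [1] almost to
    [0], so that its integral hardly depends on the damping rate: the wave loses its
    whole energy whatever the viscosity. *)
Lemma period_dissipation (E P : R -> R) : (forall t, is_derive t 1 P (E t)) ->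
  (forall t, 0 <= t < tau -> E t = torus_Rintegral l (fun x => nu * density t x)) ->
  E tau = E 0 ->
  `|(P tau - P 0) / (tau * l ^+ 3) - amplitude ^+ 2 / (4 * tau) * (1 - expR (- (4 * N ^+ 2)))| <=
  dissipation_error * N^-1.
Proof.
move=> dP EI E0.
have l3 : 0 < l ^+ 3 by rewrite exprn_gt0.
(* the end of the period is identified with its beginning, where the rate vanishes as
   well *)
have near t : 0 <= t <= tau -> `|E t - mean_rate t * l ^+ 3| <= dissipation_error * N^-1 * l ^+ 3.
  move=> /andP[t0 tt].
  have [ts|ts|->] := ltgtP t tau; first by rewrite EI ?t0 // torus_dissipation_near.
    by rewrite leNgt ts in tt.
  have -> : mean_rate tau = mean_rate 0.
    have out t' : t' <= tau / 2 \/ 5 / 8 * tau <= t' -> beta t' = 0.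
      move=> h; apply/eqP/negPn/negP => /(decay_root_active tau0)/andP[h1 h2].
      by case: h => h; move: h h1 h2; lra.
    rewrite /mean_rate !out; [ring | left | right]; move: tau0; lra.
  by rewrite E0 EI ?lexx // torus_dissipation_near.
have [M dM [M0 M1]] : exists2 M : R -> R, (forall t, is_derive t 1 M (mean_rate t)) &
    M 0 = - (amplitude ^+ 2 / 4) /\ M tau = - (amplitude ^+ 2 / 4) * expR (- (4 * N ^+ 2)).
  exists (fun t => - (amplitude ^+ 2 / 4) * expR (- (4 * N ^+ 2) * decay tau t)).
    exact: is_derive_mean_rate.
  rewrite decay_before ?mulr0 ?expR0 ?mulr1 ?decay_after ?mulr1 //; first by move: tau0; lra.
  by rewrite divr_ge0 // ltW.
have dQ t : is_derive t 1 (fun t => P t - l ^+ 3 * M t) (E t - l ^+ 3 * mean_rate t).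
  by apply: is_derive_sub => //; exact: is_derive_mulc.
have [z z0 Ez] := @mean_value R _ _ 0 tau dQ (ltW tau0).
rewrite [tau - 0]subr0 in Ez.
have -> : (P tau - P 0) / (tau * l ^+ 3) - amplitude ^+ 2 / (4 * tau) * (1 - expR (- (4 * N ^+ 2)))
   = (E z - mean_rate z * l ^+ 3) / l ^+ 3.
  have PE : P tau - P 0 = (E z - l ^+ 3 * mean_rate z) * tau + l ^+ 3 * (M tau - M 0).
    by rewrite -Ez; ring.
  by rewrite PE M0 M1; field; rewrite !gt_eqF.
by rewrite normrM [X in _ * X]gtr0_norm ?invr_gt0 // ler_pdivrMr // near.
Qed.

(** Each velocity is bounded pointwise; the factor [17 / 8] is the sum of the bounds
    [1], [1] and [1 / 8] of the three terms of the profile. *)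
Lemma flow_energy_bound t x : mean = 0 ->
  sqnorm (flw t) x <= 2 * v0 ^+ 2 + (amplitude * (17 / 8)) ^+ 2.
Proof.
move=> m0; rewrite /sqnorm sum_ord3 !shear_flow_dir shear_flow_max m0 add0r.
have sq y (Y : R) : `|y| <= Y -> y ^+ 2 <= Y ^+ 2.
  by move=> h; rewrite -[y ^+ 2]real_normK ?num_real // lerXn2r ?nnegrE // (le_trans _ h).
have := sq _ _ (velocity_bound false t x); have := sq _ _ (velocity_bound true t x).
have := sq _ _ (scalar_bound t x).
lra.
Qed.

Hypothesis dsmall : forall q,
  2 * d q * (amplitude * C q.+1.*2) ^+ 2 * l ^+ 3 * q.+1%:R <= 1.

Definition residual_error : R := 4 + 13 * amplitude * Cb ^+ 4.
Definition force_error : R := 6 * residual_error ^+ 2 * l ^+ 3 + 2 * (l ^+ 3 + 1).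

Lemma residual_near_stages t x i :
  `|ns_residual nu flw t x i - \sum_(q < j.+1) force_term l tau amplitude k d q t x 0 i| <=
  residual_error * N^-1.
Proof.
have [i0 _ _ _] := inv_rank_bounds.
have C40 : 0 <= 13 * amplitude * Cb ^+ 4.
  by apply: mulr_ge0; [have := amp0; lra | rewrite exprn_ge0 // (le_trans ler01)].
elim/ord3_case: i => [b|].
  have -> : \sum_(q < j.+1) force_term l tau amplitude k d q t x 0 (dir b) =
      \sum_(q < j) fh q b t x + fh j b t x.
    rewrite big_ord_recr /= mxE !dir_eq; congr (_ + _); last by case: b.
    by apply: eq_bigr => q _; rewrite mxE !dir_eq; case: b.
  rewrite opprD addrA; apply: (@le_trans _ _ (3 * N^-1 + N^-1)).
    by apply: normB_le; [exact: horizontal_residual_bound | exact: (horizontal_bound d l0 k0 kS HC Abig)].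
  rewrite -[X in _ + X]mul1r -mulrDl ler_pM2r // /residual_error; move: C40; lra.
have -> : \sum_(q < j.+1) force_term l tau amplitude k d q t x 0 ord_max = \sum_(q < j.+1) fv q t x.
  by apply: eq_bigr => q _; rewrite mxE !dir_max.
apply: le_trans (vertical_residual_bound t x) _.
by rewrite ler_pM2r // /residual_error; move: C40; lra.
Qed.

Lemma continuous_residual t : continuous_field (fun x => \row_i ns_residual nu flw t x i).
Proof.
move=> i; under eq_fun do rewrite mxE.
have sf : smooth_velocity flw by exact: smooth_flow.
exact: (@continuous_freeze_time _ t (smooth_continuous (smooth_ns_residual nu i sf))).
Qed.

(** Up to the present stage the residual is close to the force of that stage;
    the forces of the stages that the flow skips are small. *)
Lemma residual_near_limit t : torus_Rintegral l (sqnorm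
    ((fun x => \row_i ns_residual nu flw t x i) - limit_force l tau amplitude k d t)) <=
  force_error * N^-1.
Proof.
have [i0 i1 i2 _] := inv_rank_bounds.
pose S x : 'rV[R]_3 := \row_i \sum_(q < j.+1) force_term l tau amplitude k d q t x 0 i.
have cS : continuous_field S.
  move=> i; under eq_fun do rewrite mxE.
  apply: continuous_ord_sum => q; exact: continuous_force.
have cF : continuous_field (fun x => \row_i ns_residual nu flw t x i) by exact: continuous_residual.
have cL : continuous_field (limit_force l tau amplitude k d t) by move=> i x; exact: continuous_force.
apply: le_trans (L2_triangle l0 cF cS cL) _.
have h1 : torus_Rintegral l (sqnorm ((fun x => \row_i ns_residual nu flw t x i) - S)) <=
    3 * residual_error ^+ 2 * l ^+ 3 * N^-1.
  rewrite (_ : 3 * _ * _ * _ = 3 * (residual_error ^+ 2 * N^-1) * l ^+ 3); last by ring.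
  rewrite -torus_int_cst //; apply: le_torus_int => //.
  - exact/continuous_sqnorm/continuous_fieldB.
  - by move=> x; exact: cvg_cst.
  move=> x _; rewrite /sqnorm sum_ord3.
  have one i : (((fun x => \row_i ns_residual nu flw t x i) - S) x 0 i) ^+ 2 <= residual_error ^+ 2 * N^-1.
    rewrite !mxE; have h := residual_near_stages t x i.
    rewrite -[X in X <= _]real_normK ?num_real //.
    apply: (@le_trans _ _ ((residual_error * N^-1) ^+ 2)).
      by rewrite lerXn2r ?nnegrE // (le_trans _ h).
    by rewrite exprMn exprVn ler_wpM2l ?sqr_ge0.
  have -> : 3 * (residual_error ^+ 2 * N^-1) =
    residual_error ^+ 2 * N^-1 + residual_error ^+ 2 * N^-1 + residual_error ^+ 2 * N^-1 by ring.
  by apply: lerD; [apply: lerD|]; exact: one.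
have h2 : torus_Rintegral l (sqnorm (S - limit_force l tau amplitude k d t)) <= (l ^+ 3 + 1) * N^-1.
  have l3 : 0 < l ^+ 3 by rewrite exprn_gt0.
  have [lt|ge] := ltnP (active_stage tau t) j.+1.
    have -> : sqnorm (S - limit_force l tau amplitude k d t) = fun=> 0.
      apply/funext => x; rewrite /sqnorm big1 // => i _.
      by rewrite mxE [(S x) _ _]mxE sum_force // lt [X in _ + X]mxE subrr expr0n.
    by rewrite torus_int_cst // mul0r mulr_ge0 ?(ltW i0) // addr_ge0 // ltW.
  have -> : sqnorm (S - limit_force l tau amplitude k d t) =
      sqnorm (force_term l tau amplitude k d (active_stage tau t) t).
    apply/funext => x; apply: eq_bigr => i _.
    by rewrite mxE [(S x) _ _]mxE sum_force // ltnNge ge /= add0r mxE sqrrN.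
  case: (active_stage tau t) ge => // q jq.
  apply: le_trans (force_small l0 amp0 k0 kS d0 C1 HC Abig dsmall q t) _.
  by rewrite ler_pM2l ?addr_gt0 // lef_pV2 ?posrE ?ltr0n // ler_nat.
rewrite /force_error; apply: (@le_trans _ _ (2 * (3 * residual_error ^+ 2 * l ^+ 3 * N^-1) + 2 * ((l ^+ 3 + 1) * N^-1))).
  have aux (a1 a2 b1 b2 : R) : a1 <= b1 -> a2 <= b2 -> 2 * a1 + 2 * a2 <= 2 * b1 + 2 * b2 by lra.
  exact: (aux _ _ _ _ h1 h2).
by rewrite le_eqVlt; apply/orP; left; apply/eqP; ring.
Qed.

End FlowEstimates.

(** * Periodic solutions *)

Section Periodization.
Context {R : realType}.
Local Notation V3 := (R * R * R)%type.
Local Notation V4 := (R * V3)%type.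
Local Notation I := (torus_Rintegral _).
Variables (l tau nu : R) (w : R -> V3 -> 'rV[R]_3) (z : V3 -> 'rV[R]_3) (a b : R).
Hypotheses (l0 : 0 < l) (tau0 : 0 < tau) (a0 : 0 < a) (btau : b < tau).
Hypothesis rest : forall t, t <= a \/ b <= t -> w t = z.
Hypotheses (sw : smooth_velocity w) (pw : forall t, torus_periodic l (w t))
  (dw : forall t x, divergence (w t) x = 0).
Implicit Types (t : R) (x : V3).

Definition periodize t : V3 -> 'rV[R]_3 := w (phase tau t).
Definition periodic_force t x : 'rV[R]_3 := \row_i ns_residual nu periodize t x i.

(** Near each time the periodization is a translate of a smooth pattern. *)
Lemma smooth_periodize : smooth_velocity periodize.
Proof.
move=> i; apply: smooth_local => -[t x].
set c := period_start tau t.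
exists (fun y : V4 => w (y + (- c, 0)).1 (y + (- c, 0)).2 0 i).
  exact: (smooth_translate ((- c, 0) : V4) (sw i)).
have near := phase_local tau0 a0 btau rest t.
have c1 : (fun y : V4 => y.1) @ (t, x) --> t by exact: cvg_fst.
have near1 : \forall y \near (t, x), w (phase tau y.1) = w (y.1 - c) by exact: c1 _ near.
by apply: filterS near1 => y /= E; rewrite /periodize E addr0.
Qed.

Lemma periodize_period : time_periodic periodize.
Proof. by exists tau => // t; rewrite /periodize phaseD. Qed.

Lemma periodize_solution :
  NS_solution l nu periodic_force periodize (fun _ _ => 0).
Proof. by apply: ns_residual_solution => t; [exact: pw | exact: dw]. Qed.

Lemma periodic_force_phase t : periodic_force t = fun x => \row_i ns_residual nu w (phase tau t) x i.
Proof.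
apply/funext => x; apply/rowP => i; rewrite !mxE.
exact/ns_residual_translate/(phase_local tau0 a0 btau rest).
Qed.

Lemma jointly_continuous_velocity (u : R -> V3 -> 'rV[R]_3) : smooth_velocity u -> jointly_continuous u.
Proof. by move=> su i; exact/smooth_continuous/su. Qed.

Lemma jointly_continuous_force : jointly_continuous periodic_force.
Proof.
move=> i; under eq_fun do rewrite mxE.
exact/smooth_continuous/smooth_ns_residual/smooth_periodize.
Qed.

Lemma periodic_force_C_L2 : in_C_L2 l periodic_force.
Proof.
have pF t : torus_periodic l (periodic_force t).
  move=> i x; apply/rowP => m; rewrite [LHS]mxE [RHS]mxE.
  exact: (@ns_residual_periodic _ l nu periodize m t (fun s => pw (phase tau s)) i x).
by apply: in_C_L2_continuous; [exact: l0 | exact: pF | exact: jointly_continuous_force].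
Qed.

Lemma continuous_energy (u : R -> V3 -> 'rV[R]_3) : smooth_velocity u ->
  continuous (fun t => torus_Rintegral l (sqnorm (u t))).
Proof.
move=> su; apply: (@continuous_torus_int R l l0 (fun y : V4 => sqnorm (u y.1) y.2)).
by apply: continuous_ord_sum => i; apply: continuous_sq; exact/smooth_continuous/su.
Qed.

Lemma periodize_energyE t : L2norm_sq l (periodize t) = (torus_Rintegral l (sqnorm (periodize t)))%:E.
Proof.
have cf : continuous_field (periodize t).
  exact: jointly_continuous_at (jointly_continuous_velocity smooth_periodize).
exact: (L2norm_sqE l0 cf).
Qed.

Lemma periodize_Linfty : in_Linfty_L2 l periodize.
Proof.
have cf t : continuous_field (periodize t).
  exact: jointly_continuous_at (jointly_continuous_velocity smooth_periodize).
split=> [t|]; first by apply: in_L2_continuous => //; exact: pw.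
have [M HM] := continuous_periodic_bounded tau0 (continuous_energy smooth_periodize)
  (fun t => congr1 (fun s => torus_Rintegral l (sqnorm (w s))) (phaseD tau0 t)).
rewrite unlock; case: ifP => _ //.
apply: (@le_lt_trans _ _ (Num.sqrt M)%:E); last by rewrite ltry.
apply/ess_supP; apply: aeW => t /=.
rewrite (L2normE l0 (cf t)) abse_EFin lee_fin ger0_norm ?sqrtr_ge0 // ler_wsqrtr //.
exact: le_trans (ler_norm _) (HM t).
Qed.

Lemma periodize_mean_energy (Lim : (R -> R) -> R) P : banach_limit Lim ->
  (forall t, is_derive t 1 P (torus_Rintegral l (sqnorm (periodize t)))) ->
  Lim (mean_energy l periodize) = (P tau - P 0) / (tau * l ^+ 3).
Proof.
move=> hLim dP; have l3 : 0 < l ^+ 3 by rewrite exprn_gt0.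
have pE t : torus_Rintegral l (sqnorm (periodize (t + tau))) = torus_Rintegral l (sqnorm (periodize t)).
  by rewrite /periodize phaseD.
exact: (banach_limit_mean tau0 l3 hLim (continuous_energy smooth_periodize) pE periodize_energyE dP).
Qed.

Lemma periodize_mean_dissipation (Lim : (R -> R) -> R) : banach_limit Lim ->
  exists E P : R -> R, [/\ forall t, is_derive t 1 P (E t),
    forall t, 0 <= t < tau -> E t = torus_Rintegral l (fun x =>
       nu * \sum_(i < 3) \sum_(m < 3) partial i (component (w t) m) x ^+ 2),
    E tau = E 0 &
    Lim (mean_dissipation l nu periodize) = (P tau - P 0) / (tau * l ^+ 3)].
Proof.
move=> hLim; have l3 : 0 < l ^+ 3 by rewrite exprn_gt0.
have cg := continuous_gradient_square smooth_periodize.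
have cg' : continuous (fun y : V4 =>
    nu * \sum_(i < 3) \sum_(m < 3) partial i (component (periodize y.1) m) y.2 ^+ 2).
  by move=> y; apply: cvgM; [exact: cvg_cst | exact: cg].
pose E t := torus_Rintegral l (fun x =>
  nu * \sum_(i < 3) \sum_(m < 3) partial i (component (periodize t) m) x ^+ 2).
have cE : continuous E by exact: (continuous_torus_int l0 cg').
have [P dP] := exists_primitive cE.
have pE t : E (t + tau) = E t by rewrite /E /periodize phaseD.
have Et t : (nu%:E * L2norm_grad_sq l (periodize t) = (E t)%:E)%E.
  have cgt : continuous (fun x => \sum_(i < 3) \sum_(m < 3) partial i (component (periodize t) m) x ^+ 2).
    exact: (@continuous_freeze_time _ _ t cg).
  by rewrite /L2norm_grad_sq (torus_integralE l0 cgt) -EFinM /E torus_intZ.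
exists E, P; split; first exact: dP.
- by move=> t tt; rewrite /E /periodize phase_id.
- by rewrite -[in LHS](add0r tau) pE.
exact: (banach_limit_mean tau0 l3 hLim cE pE Et dP).
Qed.

End Periodization.

Section MeanVelocity.
Context {R : realType}.
Local Notation V3 := (R * R * R)%type.
Local Notation V4 := (R * V3)%type.
Variables (l tau U : R) (w : R -> R -> V3 -> 'rV[R]_3) (z : R -> V3 -> 'rV[R]_3) (a b : R).
Hypotheses (l0 : 0 < l) (tau0 : 0 < tau) (U0 : 0 < U) (a0 : 0 < a) (btau : b < tau).
Hypothesis rest : forall m t, t <= a \/ b <= t -> w m t = z m.
Hypotheses (sw : forall m, smooth_velocity (w m)).
Hypothesis wE : forall m t x, w m t x = w 0 t x + m *: delta_mx 0 ord_max.
Hypothesis w0U : forall t x, sqnorm (w 0 t) x <= U ^+ 2.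

(** Adding a constant vertical velocity changes the energy without changing the
    force or the dissipation, which allows prescribing the energy exactly. *)
Lemma exists_mean_velocity (Lim : (R -> R) -> R) : banach_limit Lim ->
  exists m, U = Num.sqrt (Lim (mean_energy l (periodize tau (w m)))).
Proof.
move=> hLim; have l3 : 0 < l ^+ 3 by rewrite exprn_gt0.
pose u := periodize tau (w 0).
have su : smooth_velocity u by exact: (smooth_periodize tau0 a0 btau (fun t => @rest 0 t) (sw 0)).
have cv : continuous (fun t => torus_Rintegral l (fun x => u t x 0 ord_max)).
  exact: (continuous_torus_int l0 (smooth_continuous (su ord_max))).
have [P dP] := exists_primitive (continuous_energy l0 su).
have [Q dQ] := exists_primitive cv.
have dPm (m t : R) : is_derive t 1 (fun t : R => P t + 2 * m * Q t + m ^+ 2 * l ^+ 3 * t)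
    (torus_Rintegral l (sqnorm (periodize tau (w m) t))).
  have -> : torus_Rintegral l (sqnorm (periodize tau (w m) t)) =
      torus_Rintegral l (sqnorm (u t)) + 2 * m * torus_Rintegral l (fun x => u t x 0 ord_max)
      + m ^+ 2 * l ^+ 3 * 1.
    have c0 : continuous (sqnorm (u t)).
      exact: continuous_sqnorm (jointly_continuous_at (jointly_continuous_velocity su)).
    have c1 : continuous (fun x => u t x 0 ord_max).
      exact: (@continuous_freeze_time _ _ t (smooth_continuous (su ord_max))).
    have c2 : continuous (fun x => 2 * m * u t x 0 ord_max).
      by move=> x; apply: cvgM; [exact: cvg_cst | exact: c1].
    have c3 : continuous (fun x => sqnorm (u t) x + 2 * m * u t x 0 ord_max).
      by move=> x; apply: cvgD; [exact: c0 | exact: c2].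
    have c4 : continuous (fun _ : V3 => m ^+ 2) by move=> x; exact: cvg_cst.
    rewrite mulr1 -torus_int_cst // -(torus_intZ l0 _ c1) -(torus_intD l0 c0 c2) -(torus_intD l0 c3 c4).
    congr torus_Rintegral; apply/funext => x.
    rewrite /sqnorm !sum_ord3 /u /periodize wE !mxE !(eq_sym _ ord_max) !dir_max eqxx.
    by rewrite !mulr0 !addr0 mulr1; ring.
  have d1 := is_derive_mulc (2 * m) (dQ t).
  have d2 := is_derive_mulc (m ^+ 2 * l ^+ 3) (is_derive_id t 1).
  exact: is_derive_add (is_derive_add (dP t) d1) d2.
pose e := (P tau - P 0) / (tau * l ^+ 3); pose th := (Q tau - Q 0) / (tau * l ^+ 3).
have eU : e <= U ^+ 2.
  have [c _ Ec] := mean_value dP (ltW tau0).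
  rewrite /e Ec subr0 ler_pdivrMr ?mulr_gt0 // [tau * _]mulrC mulrA ler_pM2r //.
  rewrite -torus_int_cst //; apply: le_torus_int => //; last by move=> x _; exact: w0U.
    exact: continuous_sqnorm (jointly_continuous_at (jointly_continuous_velocity su)).
  by move=> x; exact: cvg_cst.
have E m : Lim (mean_energy l (periodize tau (w m))) = e + 2 * m * th + m ^+ 2.
  rewrite (periodize_mean_energy l0 tau0 a0 btau (fun t => @rest m t) (sw m) hLim (dPm m)) /e /th.
  by field; rewrite !gt_eqF.
(* the energy is [e + 2 m th + m ^+ 2], and [e <= U ^+ 2] makes the equation for [m]
   solvable *)
exists (Num.sqrt (th ^+ 2 + U ^+ 2 - e) - th); rewrite E.
have s2 : Num.sqrt (th ^+ 2 + U ^+ 2 - e) ^+ 2 = th ^+ 2 + U ^+ 2 - e.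
  by rewrite sqr_sqrtr //; have := sqr_ge0 th; move: eU; lra.
have -> : e + 2 * (Num.sqrt (th ^+ 2 + U ^+ 2 - e) - th) * th + (Num.sqrt (th ^+ 2 + U ^+ 2 - e) - th) ^+ 2
  = U ^+ 2 by move: s2; move: (Num.sqrt _) => r s2; rewrite sqrrB s2; ring.
by rewrite sqrtr_sqr gtr0_norm.
Qed.

End MeanVelocity.

(** * Choice of the parameters *)

Section Wavenumbers.
Context {R : realType}.
Variable l : R.
Hypothesis l0 : 0 < l.

Lemma large_multiple (y : R) : exists2 n : nat, (0 < n)%N & y <= pi *+ 2 / l * n%:R.
Proof.
have w0 := unit_wavenumber_gt0 l0.
exists (Num.bound ((pi *+ 2 / l)^-1 * `|y|)).+1 => //.
apply: le_trans (ler_norm y) _; rewrite -ler_pdivrMl //.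
apply: (@le_trans _ _ (Num.bound ((pi *+ 2 / l)^-1 * `|y|))%:R); last by rewrite ler_nat.
by apply/ltW/archi_boundP; rewrite mulr_ge0 // invr_ge0 ltW.
Qed.

Lemma exists_wavenumbers (y : nat -> R) : exists k : nat -> nat,
  [/\ (0 < k 0)%N, forall q, (k q < k q.+1)%N & forall q, y q <= wavenumber l k q].
Proof.
have w0 := unit_wavenumber_gt0 l0.
have /choice[n n0] : forall q, exists n, (0 < n)%N /\ y q <= pi *+ 2 / l * n%:R.
  by move=> q; have [m m0 ym] := large_multiple (y q); exists m.
exists (fun q => \sum_(i < q.+1) n i)%N; split=> [|q|q].
- by rewrite big_ord_recl big_ord0 addn0; have [] := n0 0%N.
- by rewrite [X in (_ < X)%N]big_ord_recr /= -[X in (X < _)%N]addn0 ltn_add2l; have [] := n0 q.+1.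
have [_ h] := n0 q; apply: le_trans h _.
by rewrite ler_pM2l // ler_nat big_ord_recr /= leq_addl.
Qed.

End Wavenumbers.

Section Family.
Context {R : realType}.
Local Notation V3 := (R * R * R)%type.
Variables (Lim : (R -> R) -> R) (l U c : R).
Hypotheses (hLim : banach_limit Lim) (l0 : 0 < l) (U0 : 0 < U) (c0 : 0 < c).

(** The schedule is fixed first; its bounds dictate the wavenumbers and the sharpness of
    the sawteeth, and all of these the wavenumber of the final shear. Amplitude and
    period are such that a quarter of the squared amplitude, divided by the period,
    is [c * U ^+ 3 / l]; the amplitude leaves room in the energy for the mean
    velocity to be adjusted. *)
Lemma dissipative_family : exists (f : R -> V3 -> 'rV[R]_3) (K : R) (n : nat),
  [/\ forall t, torus_periodic l (f t), forall t, continuous_field (f t) &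
  forall j, (n <= j)%N -> exists (nu : R) (F u : R -> V3 -> 'rV[R]_3),
    [/\ 0 < nu <= j.+1%:R^-1, in_C_L2 l F /\ jointly_continuous F,
        forall t, torus_Rintegral l (sqnorm (F t - f t)) <= K * j.+1%:R^-1,
        [/\ smooth_velocity u, time_periodic u, in_Linfty_L2 l u &
            NS_solution l nu F u (fun _ _ => 0)] &
        U = Num.sqrt (Lim (mean_energy l u)) /\
        `|Lim (mean_dissipation l nu u) - c * U ^+ 3 / l| <= K * j.+1%:R^-1]].
Proof.
pose amp := U / 4; pose tau := l / (64 * c * U).
have amp0 : 0 < amp by rewrite divr_gt0.
have tau0 : 0 < tau by rewrite divr_gt0 // !mulr_gt0.
have l3 : 0 < l ^+ 3 by rewrite exprn_gt0.
have /choice[C HC0] : forall n, exists M : R, 1 <= M /\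
    forall t, `|stage' tau n t| <= M /\ `|stage'' tau n t| <= M.
  by move=> n; have [M M1 HM] := stage_bounds tau0 n; exists M.
have C1 n : 1 <= C n by have [] := HC0 n.
have HC n : forall t, `|stage' tau n t| <= C n /\ `|stage'' tau n t| <= C n by have [] := HC0 n.
have [Cb Cb1 HCb] := final_bounds tau0.
have p0 : 0 < pi :> R := pi_gt0 R.
have Cb0 : 0 < Cb := lt_le_trans ltr01 Cb1.
have Cp n : 0 < C n := lt_le_trans ltr01 (C1 n).
(* lower bounds for the wavenumbers: small accelerations, and velocities below the
   amplitude, for the shears of the cascade ([y1]) and for the final shear ([y2]) *)
pose y1 q : R := 2 * pi * C q.*2.+1.
pose y2 q : R := root_damping q ^+ 4 * Cb.
have y10 q : 0 <= y1 q by rewrite /y1 !mulr_ge0 // ltW.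
have y20 q : 0 <= y2 q.
  by rewrite /y2 mulr_ge0 ?exprn_ge0 ?(ltW Cb0) // (le_trans ler01) // root_damping_ge1.
have [k [k0 kS ky]] := exists_wavenumbers l0
  (fun q => y1 q * q.+1%:R + y1 q / amp + y2 q * rank q + y2 q / amp).
have rk0 q : 0 <= rank q :> R by rewrite /rank.
have z1 q : 0 <= y1 q * q.+1%:R by rewrite mulr_ge0.
have z2 q : 0 <= y1 q / amp by rewrite divr_ge0 // ltW.
have z3 q : 0 <= y2 q * rank q by rewrite mulr_ge0.
have z4 q : 0 <= y2 q / amp by rewrite divr_ge0 // ltW.
have Abig q : 2 * pi * C q.*2.+1 * q.+1%:R <= wavenumber l k q.
  by apply: le_trans (ky q); have := z2 q; have := z3 q; have := z4 q; rewrite /y1; lra.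
have Avel q : 2 * pi * C q.*2.+1 <= amp * wavenumber l k q.
  rewrite [leRHS]mulrC -ler_pdivrMr //; apply: le_trans (ky q).
  by have := z1 q; have := z3 q; have := z4 q; rewrite /y1; lra.
have Afin q : root_damping q ^+ 4 * Cb * rank q <= wavenumber l k q.
  by apply: le_trans (ky q); have := z1 q; have := z2 q; have := z4 q; rewrite /y2; lra.
have Afvel q : root_damping q ^+ 4 * Cb <= amp * wavenumber l k q.
  rewrite [leRHS]mulrC -ler_pdivrMr //; apply: le_trans (ky q).
  by have := z1 q; have := z2 q; have := z3 q; rewrite /y2; lra.
(* makes the integral of the square of the vertical force of stage [q.+1] at most [1 /
   q.+1] *)
pose d q : R := (2 * (amp * C q.+1.*2) ^+ 2 * l ^+ 3 * q.+1%:R)^-1.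
have dd q : 0 < 2 * (amp * C q.+1.*2) ^+ 2 * l ^+ 3 * q.+1%:R.
  by rewrite mulr_gt0 ?ltr0n // mulr_gt0 // mulr_gt0 // exprn_gt0 // mulr_gt0.
have d0 q : 0 < d q by rewrite invr_gt0.
have dsmall q : 2 * d q * (amp * C q.+1.*2) ^+ 2 * l ^+ 3 * q.+1%:R <= 1.
  rewrite (_ : _ * q.+1%:R = d q * (2 * (amp * C q.+1.*2) ^+ 2 * l ^+ 3 * q.+1%:R)); last by ring.
  by rewrite mulVf // gt_eqF.
have /choice[D HD0] : forall q, exists M : R, 0 <= M /\
    forall v, `|shear' l k d q v| <= M /\ `|shear'' l k d q v| <= M.
  by move=> q; have [M M0 HM] := shear_derivative_bounds l0 kS d0 q; exists M.
have D0 q : 0 <= D q by have [] := HD0 q.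
have HD q : forall v, `|shear' l k d q v| <= D q /\ `|shear'' l k d q v| <= D q by have [] := HD0 q.
pose ff := limit_force l tau amp k d.
pose K1 := force_error l amp Cb.
pose K2 := dissipation_error amp Cb + c * U ^+ 3 / l.
have cl0 : 0 <= c * U ^+ 3 / l by rewrite divr_ge0 ?(ltW l0) // mulr_ge0 ?(ltW c0) // exprn_ge0 // ltW.
exists (fun t => ff (phase tau t)), (Num.max K1 K2), (Num.bound Cb).
split=> [t|t|j nj].
- exact: force_periodic.
- by move=> i x; exact: continuous_force.
have CbN : Cb <= rank j.
  apply: (@le_trans _ _ (Num.bound Cb)%:R); first by apply/ltW/archi_boundP; exact: ltW.
  by rewrite ler_nat leqW.
have [K K0 Kbig] := large_multiple l0 (root_damping j * (1 + root_damping j) * cascade_size l amp k j D * rank j ^+ 2).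
pose kappa : R := pi *+ 2 / l * K%:R.
have kappa0 : 0 < kappa by rewrite mulr_gt0 ?unit_wavenumber_gt0 // ltr0n.
have kappal : exists n : nat, kappa * l = pi *+ 2 *+ n.
  by exists K; rewrite /kappa mulrAC divfK ?gt_eqF // mulr_natr.
pose w m := flow l tau amp k d j kappa m.
pose z m : V3 -> 'rV[R]_3 := fun=> \row_i (if i == dir false then 0 else if i == dir true then 0 else m).
have a0 : 0 < tau / 4 by rewrite divr_gt0.
have btau : 3 / 4 * tau < tau by move: tau0; lra.
have rest m t : t <= tau / 4 \/ 3 / 4 * tau <= t -> w m t = z m by exact: flow_rest.
have sw m : smooth_velocity (w m) by exact: smooth_flow.
have wE m t x : w m t x = w 0 t x + m *: delta_mx 0 ord_max.
  apply/rowP; elim/ord3_case => [b|]; rewrite [RHS]mxE [X in _ + X]mxE [X in _ + _ * X]mxE /w /flow.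
    by rewrite !shear_flow_dir eqxx (eq_sym _ ord_max) dir_max mulr0 addr0.
  by rewrite !shear_flow_max eqxx mulr1; ring.
have w0U t x : sqnorm (w 0 t) x <= U ^+ 2.
  apply: le_trans (flow_energy_bound d l0 tau0 amp0 k0 kS kappa C1 HC Cb1 HCb Avel (Afin j) (Afvel j) CbN t x erefl) _.
  by rewrite /amp; have := sqr_ge0 U; lra.
have [m Em] := exists_mean_velocity l0 tau0 U0 a0 btau rest sw wE w0U hLim.
have rm := rest m; have pw t : torus_periodic l (w m t) by exact: flow_periodic.
have dw t x : divergence (w m t) x = 0.
  exact: (shear_flow_divergence j.+1 (flow_rate l tau k j) m (is_derive_flow_shear l k d0 j kappa)
    (is_derive_flow_scalar_u l tau amp k d j kappa) (is_derive_flow_scalar_v l tau amp k d0 j kappa) t x).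
have i0 : 0 < j.+1%:R^-1 :> R by rewrite invr_gt0 ltr0n.
exists (viscosity j kappa), (periodic_force tau (viscosity j kappa) (w m)), (periodize tau (w m)).
split.
- have [m0 _ _ _ nuE] := root_viscosity_bounds l0 amp0 k0 kS kappa0 D0 Kbig.
  have n0 : 0 < viscosity j kappa by rewrite nuE exprn_gt0.
  rewrite n0 /= -[X in X <= _]mulr1 -[X in X <= _]gtr0_norm ?mulr1 // -[X in `|X|]mulr1.
  apply: (viscosity_small l0 amp0 k0 kS kappa0 D0 Kbig); rewrite normr1.
  exact: (cascade_size_ge1 l0 amp0 k0 kS j D0).
- split; first exact: (periodic_force_C_L2 _ l0 tau0 a0 btau rm (sw m) pw).
  exact: (@jointly_continuous_force R tau (viscosity j kappa) (w m) (z m) (tau / 4) (3 / 4 * tau)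
    tau0 a0 btau rm (sw m)).
- move=> t; rewrite (periodic_force_phase _ tau0 a0 btau rm).
  apply: le_trans (residual_near_limit l0 tau0 amp0 k0 kS d0 m kappa0 C1 HC D0 HD Cb1 HCb Abig
    (Afin j) (Afvel j) CbN Kbig dsmall (phase tau t)) _.
  by rewrite ler_pM2r // le_max lexx.
- split; [exact: (smooth_periodize tau0 a0 btau rm (sw m)) | exact: periodize_period |
    exact: (periodize_Linfty l0 tau0 a0 btau rm (sw m) pw) | exact: periodize_solution].
split; first exact: Em.
have [E [P [dP EI E0 ->]]] := periodize_mean_dissipation (viscosity j kappa) l0 tau0 a0 btau rm (sw m) hLim.
have h := period_dissipation l0 tau0 amp0 k0 kS d0 kappa0 kappal C1 HC D0 HD Cb1 HCb Abig
  (Afin j) (Afvel j) CbN Kbig dP EI E0.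
have -> : c * U ^+ 3 / l = amp ^+ 2 / (4 * tau).
  by rewrite /amp /tau; field; rewrite !gt_eqF.
set ex := expR _ in h; set a := amp ^+ 2 / (4 * tau) in h *.
have aE : a = c * U ^+ 3 / l by rewrite /a /amp /tau; field; rewrite !gt_eqF.
have exN : ex <= j.+1%:R^-1.
  have small : expR (- (2 * rank j ^+ 2)) <= j.+1%:R^-1 :> R by exact: damping_small.
  apply: le_trans small; rewrite /ex ler_expR lerN2 ler_pM2r ?ler_nat //.
  by rewrite exprn_gt0 // ltr0n.
set L := (P tau - P 0) / _ in h *.
have -> : L - a = (L - a * (1 - ex)) - a * ex by ring.
apply: (@le_trans _ _ (K2 * j.+1%:R^-1)); last by rewrite ler_pM2r // le_max lexx orbT.
rewrite /K2 mulrDl; apply: normB_le => //.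
by apply: normM_le; rewrite -?aE ger0_norm ?aE // expR_ge0.
Qed.

End Family.

(** * The sequence of solutions *)

Section Sequence.
Context {R : realType}.

Lemma cvg_small (y : nat -> R) (a K : R) : (forall j, `|y j - a| <= K * j.+1%:R^-1) ->
  y j @[j --> \oo] --> a.
Proof.
move=> ya; apply/subr_cvg0; apply/cvgr0Pnorm_le.
have cK : K * harmonic j @[j --> \oo] --> (0 : R).
  by rewrite -(mulr0 K); apply: cvgMr; exact: cvg_harmonic.
move/cvgr0Pnorm_le : cK => cK d d0; near=> j.
apply: le_trans (ya j) _; apply: le_trans (ler_norm _) _.
by near: j; exact: cK.
Unshelve. all: by end_near. Qed.

End Sequence.

Unset Implicit Arguments.
Set Strict Implicit.
Set Printing Implicit Defensive.

Theorem theorem1p3 (R : realType) (Lim : (R -> R) -> R)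
    (hLim : banach_limit Lim) (l U c : R)
    (hl : 0 < l) (hU : 0 < U) (hc : 0 < c) :
  exists (nu : nat -> R)
         (F : nat -> R -> R * R * R -> 'rV[R]_3)
         (f : R -> R * R * R -> 'rV[R]_3)
         (u : nat -> R -> R * R * R -> 'rV[R]_3)
         (p : nat -> R -> R * R * R -> R),
    [/\ forall j, 0 < nu j,
        nu j @[j --> \oo] --> 0,
        (forall j, in_C_L2 l (F j)) /\ in_C_L2 l f,
        cvg_C_L2 l F f &
    [/\ forall j,
          [/\ smooth_velocity (u j), smooth_pressure (p j),
              time_periodic (u j), in_Linfty_L2 l (u j) &
              NS_solution l (nu j) (F j) (u j) (p j)],
        forall j, U = Num.sqrt (Lim (mean_energy l (u j))) &
        Lim (mean_dissipation l (nu j) (u j)) * l / U ^+ 3 @[j --> \oo] --> c]].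
Proof.
have [f [K [n [pf cf H]]]] := dissipative_family hLim hl hU hc.
have K0 : 0 <= K.
  have [nu [F [u [_ [_ cF] h _ _]]]] := H n (leqnn n).
  have i0 : 0 < n.+1%:R^-1 :> R by rewrite invr_gt0 ltr0n.
  rewrite -(pmulr_lge0 _ i0); apply: le_trans (h 0); apply: torus_int_ge0 => x.
  exact: sqnorm_ge0.
have Kj j : K * (j + n).+1%:R^-1 <= K * j.+1%:R^-1.
  by rewrite ler_wpM2l // lef_pV2 ?posrE ?ltr0n // ler_nat ltnS leq_addr.
have /choice[nu /choice[F /choice[u Hu]]] := fun j => H (j + n)%N (leq_addl j n).
have FE j t : torus_Rintegral l (sqnorm (F j t - f t)) <= K * j.+1%:R^-1.
  by have [_ _ h _ _] := Hu j; exact: le_trans (h t) (Kj j).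
have cF j : jointly_continuous (F j) by have [_ [_ h] _ _ _] := Hu j.
have eK : K * j.+1%:R^-1 @[j --> \oo] --> (0 : R).
  apply: (@cvg_small _ _ 0 K) => j; rewrite subr0 ger0_norm //.
  by rewrite mulr_ge0 // invr_ge0.
exists nu, F, f, u, (fun=> fun=> fun=> 0); split.
- by move=> j; have [/andP[]] := Hu j.
- apply: (@cvg_small _ _ 0 1) => j; have [/andP[n0 n1] _ _ _ _] := Hu j.
  rewrite subr0 gtr0_norm // mul1r; apply: le_trans n1 _.
  by rewrite lef_pV2 ?posrE ?ltr0n // ler_nat ltnS leq_addr.
- split=> [j|]; first by have [_ []] := Hu j.
  apply: (in_C_L2_limit hl pf cf) => e e0.
  have [j _ Hj] : \forall j \near \oo, `|K * j.+1%:R^-1| <= e by move/cvgr0Pnorm_le : eK; exact.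
  exists (F j) => // t; apply: le_trans (FE j t) _.
  exact: le_trans (ler_norm _) (Hj j (leqnn j)).
- apply: (cvg_C_L2_bound hl _ cf FE eK) => j t.
  exact: jointly_continuous_at (cF j).
split=> [j|j|].
- have [_ _ _ [s1 s2 s3 s4] _] := Hu j; split=> //.
  exact: smooth_cst.
- by have [_ _ _ _ []] := Hu j.
have lU : 0 < l / U ^+ 3 by rewrite divr_gt0 // exprn_gt0.
apply: (@cvg_small _ _ _ (K * (l / U ^+ 3))) => j; have [_ _ _ _ [_ h]] := Hu j.
have -> : Lim (mean_dissipation l (nu j) (u j)) * l / U ^+ 3 - c =
   (Lim (mean_dissipation l (nu j) (u j)) - c * U ^+ 3 / l) * (l / U ^+ 3).
  by field; rewrite !gt_eqF.
rewrite normrM (gtr0_norm lU) [leRHS]mulrAC ler_pM2r //.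
exact: le_trans h (Kj j).
Qed.
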